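(* Let $n \geq 1$, let $f:\mathbb{R}^n \to \{0,1\}$ be measurable, let $0 \leq \rho < 1$, and let $(\mathbf{x},\mathbf{y})$ be $\rho$-correlated $n$-dimensional standard Gaussian random vectors. Let $\eta \subseteq \mathbb{R}^n$ be a halfspace such that $\mathbb{E}_{\mathbf{x} \sim \mathrm{N}(0,1)^n}[1_{\eta}(\mathbf{x})] = \mathbb{E}_{\mathbf{x} \sim \mathrm{N}(0,1)^n}[f(\mathbf{x})]$, where $1_\eta$ is the indicator function of $\eta$. Then \[ -H(f(\mathbf{x}) \mid \mathbf{y}) \leq -H(1_{\eta}(\mathbf{x}) \mid \mathbf{y}). \]
   Context: $\rho$-correlated $n$-dimensional standard Gaussian random vectors: $\mathbf{x}$ is a standard $n$-dimensional Gaussian vector and $\mathbf{y} = \rho \mathbf{x} + \sqrt{1-\rho^2}\,\mathbf{z}$ with $\mathbf{z}$ an independent standard $n$-dimensional Gaussian vector. For $\beta \in [0,1]$, $h(\beta) = \beta \log_2(1/\beta) + (1-\beta)\log_2(1/(1-\beta))$ is the binary entropy. For a $\{0,1\}$-valued function $g$, the conditional entropy is $H(g(\mathbf{x}) \mid \mathbf{y}) = \mathbb{E}_{\mathbf{y}}\big[h(\Pr[g(\mathbf{x}) = 1 \mid \mathbf{y}])\big]$; equivalently $-H(g(\mathbf{x})\mid \mathbf{y}) = \mathbb{E}_{\mathbf{x}\sim \mathrm{N}(0,1)^n}[-h(U_\rho g(\mathbf{x}))]$ where $U_\rho g(x) = \mathbb{E}[g(\mathbf{y}) \mid \mathbf{x}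 = x]$. A halfspace is a set of the form $\{x \in \mathbb{R}^n : \langle a, x\rangle \geq t\}$ with $a \neq 0$, $t \in \mathbb{R}$. *)

(* Defs.v *)
From HB Require Import structures.
From mathcomp Require Import all_boot all_order all_algebra.
From mathcomp Require Import all_classical all_reals all_analysis.
Set Implicit Arguments. Unset Strict Implicit. Unset Printing Implicit Defensive.
Import Order.TTheory GRing.Theory Num.Theory.
Local Open Scope classical_set_scope.
Local Open Scope ring_scope.

(* R^n is represented by n.-tuple R, with its product (= Borel) sigma-algebra
   from measurable_structure.v. *)

(* gam is the standard Gaussian measure N(0,1)^n on R^n: the (unique)
   probability measure whose value on measurable boxes is the product of
   the one-dimensional standard normal measures. *)
Definition is_std_gaussian {R : realType} (n : nat)
    (gam : probability (n.-tuple R) R) : Prop :=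
  forall A : 'I_n -> set R, (forall i, measurable (A i)) ->
    gam [set x : n.-tuple R | forall i, A i (tnth x i)] =
    (\prod_(i < n) normal_prob 0 1 (A i))%E.

Definition vlin {R : realType} (n : nat) (a b : R) (x z : n.-tuple R)
  : n.-tuple R := [tuple a * tnth x i + b * tnth z i | i < n].

Definition vdot {R : realType} (n : nat) (a x : n.-tuple R) : R :=
  \sum_(i < n) tnth a i * tnth x i.

Definition is_halfspace {R : realType} (n : nat) (eta : set (n.-tuple R)) :=
  exists (a : n.-tuple R) (t : R),
    (exists i, tnth a i != 0) /\ eta = [set x | t <= vdot a x].

Definition xlog2x {R : realType} (x : R) : R :=
  if x == 0 then 0 else x * (ln x / ln 2).

Definition binent {R : realType} (b : R) : R :=
  - xlog2x b - xlog2x (1 - b).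

(* Ornstein-Uhlenbeck / noise operator:
   U_rho g(x) = E[g(y) | x] = E_z[g(rho x + sqrt(1-rho^2) z)] *)
Definition Urho {R : realType} (n : nat) (gam : probability (n.-tuple R) R)
    (rho : R) (g : n.-tuple R -> R) (x : n.-tuple R) : R :=
  fine (\int[gam]_z (g (vlin rho (Num.sqrt (1 - rho ^+ 2)) x z))%:E)%E.

(* conditional entropy H(g(x) | y) for rho-correlated Gaussians,
   written as E_x[h(U_rho g(x))] (context's "equivalently"). *)
Definition condH {R : realType} (n : nat) (gam : probability (n.-tuple R) R)
    (rho : R) (g : n.-tuple R -> R) : \bar R :=
  (\int[gam]_x (binent (Urho gam rho g x))%:E)%E.

(* Main.v *)
Require Import Defs.
From HB Require Import structures.
From mathcomp Require Import all_boot all_order all_algebra.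
From mathcomp Require Import all_classical all_reals all_analysis.
From mathcomp Require Import ring lra measurable_realfun.
Set Implicit Arguments. Unset Strict Implicit. Unset Printing Implicit Defensive.
Import Order.TTheory GRing.Theory Num.Theory.
Import numFieldNormedType.Exports.
Local Open Scope classical_set_scope.
Local Open Scope ring_scope.

(* Write Phi and phi for the N(0,1) distribution function and density, U_r for
   the noise operator, and F for minus the binary entropy, slightly contracted
   towards the constant 1/2 so as to be smooth on [0,1].  Put H = F o Phi.

   For a half-space of measure Phi(q), Phi^-1(U_r 1_eta) is an affine function of
   a standard normal variable, so that E F(U_r 1_eta) = E H(a q + b Z) with
   b = r / sqrt(1 - r^2) and a = sqrt(1 + b^2); this is [ou b H q].  For general u
   with values in [0,1], r is decreased to 0 in m steps, each multiplying 1 - r^2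
   by 1 + e^2 while replacing G by [ou e G].  One step uses that the increment of
   Q = Phi^-1(U u) is e (b.x) + O(e^2) with |b| <= 1 (the half-spaces maximise the
   length of the Gaussian barycenter at given measure, by Neyman-Pearson), so that
   up to O(e^3) its second moment is at most the one found for a half-space; as
   G o Phi^-1 is convex, this only loses O(e^3).  In total O(m e^3) = O(m^-1/2)
   is lost.  Only finite steps and Taylor bounds occur, no stochastic calculus. *)

(** * Normal integrals: shifts, linear combinations, and their tuple versions *)

(** The loss of one step has to be bounded by a constant that depends neither on the number of steps
    nor on the point at which one conditions. Two things stand against this: Phi^-1 is not Lipschitz
    near 0 and 1, and the entropy has unbounded derivatives there. One parameter d removes both: the
    entropy is evaluated at d/2 + (1-d) t, and u is the mixture of f with its mean, with weights 1-d
    and d, so that all quantiles stay in a fixed interval [-K, K]. The half-space is not mixed, as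
    its side is computed exactly. Dominated convergence lets d tend to 0 at the end. The functions G
    met on the way share one constant, because 1 + b^2 never exceeds 1 / (1 - r^2) for the initial
    r.

    G(Q) is expanded at q with Phi(Q) - Phi(q), not Q - q, as its linear term. Its mean vanishes for
    u and for the half-space alike, and the remaining coefficient of (Q - q)^2 is nonnegative by
    convexity: hence an upper bound on the second moment of Q - q becomes one on E G(Q). *)

Section lebesgue_affine.
Context {R : realType}.
Local Notation mu := (@lebesgue_measure R).

(** The image of Lebesgue measure under a translation agrees with it on half-open intervals, which
    determine it. Integrands here and below are nonnegative, so that no integrability has to be
    carried along. *)
Lemma ge0_integral_shift (g : R -> \bar R) (a : R) :
  measurable_fun setT g -> (forall x, 0 <= g x)%E ->
  (\int[mu]_x g (x + a)%R = \int[mu]_x g x)%E.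
Proof.
move=> mg g0.
pose phi := (fun x => x + a) : measurableTypeR R -> measurableTypeR R.
have mphi : measurable_fun setT phi by exact: measurable_funD.
rewrite -(@ge0_integral_pushforward _ _ _ _ _ _ mphi mu setT g)//.
apply: eq_measure_integral => A mA _.
apply/esym/(lebesgue_measure_unique (mu := pushforward mu phi)) => //.
move=> _ [[b c]] _ <- /=.
have -> : pushforward mu phi `]b, c]%classic = mu `]b - a, c - a]%classic.
  congr (mu _); apply/seteqP; split => x /=; rewrite !in_itv/= /phi.
    by rewrite ltrBlDr lerBrDr.
  by rewrite ltrBlDr lerBrDr.
rewrite !lebesgue_measure_itv/= !lte_fin ltrD2r; case: ifP => // _.
by rewrite -!EFinB; congr EFin; ring.
Qed.

(** Uniqueness on half-open intervals gives Lebesgue measure as [a] times its image under the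
    dilation; the factor then changes sides. *)
Lemma ge0_integral_scale (g : R -> \bar R) (a : R) : 0 < a ->
  measurable_fun setT g -> (forall x, 0 <= g x)%E ->
  (\int[mu]_x g (a * x)%R = (a^-1)%:E * \int[mu]_x g x)%E.
Proof.
move=> a0 mg g0.
pose phi := (fun x => a * x) : measurableTypeR R -> measurableTypeR R.
have mphi : measurable_fun setT phi by exact: measurable_funM.
rewrite -(@ge0_integral_pushforward _ _ _ _ _ _ mphi mu setT g)//.
have ai : 0 <= a^-1 by rewrite invr_ge0 ltW.
rewrite -(@ge0_integral_mscale _ _ _ mu setT measurableT (NngNum ai))//.
apply: eq_measure_integral => A mA _.
have a0' : 0 <= a by exact: ltW.
rewrite [RHS](_ : _ = ((a^-1)%:E * mu A)%E)//.
rewrite (lebesgue_measure_unique (mu := mscale (NngNum a0') (pushforward mu phi)))//=.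
  by rewrite muleA -EFinM mulVf ?gt_eqF// mul1e.
move=> _ [[b c]] _ <- /=; rewrite /mscale/=.
have -> : pushforward mu phi `]b, c]%classic = mu `]b / a, c / a]%classic.
  by congr (mu _); apply/seteqP; split => x /=; rewrite !in_itv/= /phi;
      rewrite ltr_pdivrMr// ler_pdivlMr// ![x * a]mulrC.
rewrite !lebesgue_measure_itv/= !lte_fin ltr_pM2r ?invr_gt0//.
case: ifP => // _; last by rewrite mule0.
by rewrite -!EFinB -EFinM; congr EFin; field; rewrite gt_eqF.
Qed.

Lemma ge0_integral_opp (g : R -> \bar R) :
  measurable_fun setT g -> (forall x, 0 <= g x)%E ->
  (\int[mu]_x g (- x)%R = \int[mu]_x g x)%E.
Proof.
move=> mg g0.
pose phi := (fun x => - x) : measurableTypeR R -> measurableTypeR R.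
have mphi : measurable_fun setT phi by exact: measurableT_comp.
rewrite -(@ge0_integral_pushforward _ _ _ _ _ _ mphi mu setT g)//.
by apply: eq_measure_integral => A mA _; exact: lebesgue_measureN.
Qed.

End lebesgue_affine.

(** * One-dimensional Gaussian integrals *)

Section normal1.
Context {R : realType}.
Local Notation mu := (@lebesgue_measure R).
Local Notation N := (@normal_prob R 0 1).

Definition nphi (x : R) : R := normal_pdf 0 1 x.

Lemma nphiE x : nphi x = normal_peak 1 * expR (- (x ^+ 2) / 2).
Proof.
rewrite /nphi normal_pdfE ?oner_neq0// /normal_fun subr0 expr1n.
by rewrite mulr2n.
Qed.

(** The Radon-Nikodym derivative of [normal_prob] is almost everywhere [nphi], since both have the
    same integral over every measurable set. *)
Lemma ge0_integral_normal (g : R -> \bar R) :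
  measurable_fun setT g -> (forall x, 0 <= g x)%E ->
  (\int[N]_x g x = \int[mu]_x (g x * (nphi x)%:E))%E.
Proof.
move=> mg g0.
rewrite -(Radon_Nikodym_SigmaFinite.change_of_variables (normal_prob_dominates 0 1))//.
have mpdf : measurable_fun setT (EFin \o nphi).
  by apply/measurable_EFinP; exact: measurable_normal_pdf.
have iRN := Radon_Nikodym_SigmaFinite.f_integrable (normal_prob_dominates (0:R) 1).
apply: ae_eq_integral => //.
- by apply: emeasurable_funM => //; exact: (measurable_int mu).
- exact: emeasurable_funM.
apply: ae_eqe_mul2l.
apply: integral_ae_eq => //.
by move=> E _ mE; rewrite -Radon_Nikodym_SigmaFinite.f_integral//; exact: normal_prob_dominates.
Qed.

End normal1.

Section normal2.
Context {R : realType}.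
Local Notation mu := (@lebesgue_measure R).
Local Notation N := (@normal_prob R 0 1).

Lemma measurable_nphi : measurable_fun setT (@nphi R).
Proof. exact: measurable_normal_pdf. Qed.

Lemma nphi_gt0 x : 0 < @nphi R x.
Proof. by rewrite nphiE mulr_gt0 ?expR_gt0// normal_peak_gt0 ?oner_neq0. Qed.

Lemma nphi_ge0 x : 0 <= @nphi R x.
Proof. exact/ltW/nphi_gt0. Qed.

Lemma nphiN x : @nphi R (- x) = nphi x.
Proof. by rewrite !nphiE sqrrN. Qed.

Hint Resolve nphi_ge0 measurable_nphi : core.

Lemma measurable_mul_nphi (g : R -> \bar R) :
  measurable_fun setT g -> measurable_fun setT (fun x => g x * (nphi x)%:E)%E.
Proof. by move=> mg; apply: emeasurable_funM => //; exact/measurable_EFinP. Qed.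

Lemma integral_nphi : (\int[mu]_x (nphi x)%:E = 1)%E.
Proof. exact: integral_normal_pdf. Qed.

Lemma ge0_normal_opp (g : R -> \bar R) :
  measurable_fun setT g -> (forall x, 0 <= g x)%E ->
  (\int[N]_x g (- x)%R = \int[N]_x g x)%E.
Proof.
move=> mg g0; rewrite !ge0_integral_normal//; last first.
  by apply: (measurableT_comp mg); exact: oppr_measurable.
rewrite -[RHS](@ge0_integral_opp _ (fun x => g x * (nphi x)%:E)%E); last 2 first.
- exact: measurable_mul_nphi.
- by move=> x; rewrite mule_ge0// lee_fin.
by apply: eq_integral => x _; rewrite nphiN.
Qed.

(** One-dimensional Cameron-Martin formula: the exponential is the quotient of [nphi (x - a)] by
    [nphi x]. *)
Lemma ge0_normal_shift (g : R -> \bar R) (a : R) :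
  measurable_fun setT g -> (forall x, 0 <= g x)%E ->
  (\int[N]_x g (x + a)%R = \int[N]_x (g x * (expR (a * x - a ^+ 2 / 2))%:E))%E.
Proof.
move=> mg g0; rewrite !ge0_integral_normal//; last 3 first.
- apply: emeasurable_funM => //; apply/measurable_EFinP/measurableT_comp => //.
  by apply: measurable_funB => //; exact: measurable_funM.
- by move=> x; rewrite mule_ge0// lee_fin expR_ge0.
- by apply: (measurableT_comp mg); exact: measurable_funD.
pose k x := (g x * (nphi (x - a))%:E)%E.
transitivity (\int[mu]_x k (x + a)%R)%E.
  by apply: eq_integral => x _; rewrite /k addrK.
rewrite (@ge0_integral_shift _ k); last 2 first.
- apply: emeasurable_funM => //; apply/measurable_EFinP.
  by apply: (measurableT_comp measurable_nphi); exact: measurable_funB.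
- by move=> x; rewrite /k mule_ge0// lee_fin.
apply: eq_integral => x _; rewrite /k -muleA -EFinM; congr (_ * _%:E)%E.
rewrite !nphiE mulrCA -expRD; congr (_ * expR _).
by field.
Qed.

(** The variable [u = a * x + b * z] replaces z, Tonelli's theorem exchanges x and u, and
    integrating the joint density over x leaves the density of [c * y] at u. *)
Let normal_comb_gt0 (g : R -> \bar R) (a b : R) :
  measurable_fun setT g -> (forall x, 0 <= g x)%E -> 0 < b ->
  (\int[N]_x \int[N]_z g (a * x + b * z)%R =
   \int[N]_y g (Num.sqrt (a ^+ 2 + b ^+ 2) * y)%R)%E.
Proof.
move=> mg g0 b0; set c := Num.sqrt _.
have c2 : c ^+ 2 = a ^+ 2 + b ^+ 2.
  by rewrite sqr_sqrtr// addr_ge0// sqr_ge0.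
have c0 : 0 < c by rewrite sqrtr_gt0 ltr_wpDl ?sqr_ge0// exprn_gt0.
have inner x : (\int[N]_z g (a * x + b * z)%R =
   \int[mu]_u (g u * (b^-1 * nphi ((u - a * x) / b))%:E))%E.
  rewrite ge0_integral_normal//; last first.
    by apply: (measurableT_comp mg); apply: measurable_funD => //; exact: measurable_funM.
  pose k u := (g u * (nphi ((u - a * x) / b))%:E)%E.
  have mk : measurable_fun setT k.
    apply: emeasurable_funM => //; apply/measurable_EFinP.
    apply: (measurableT_comp measurable_nphi).
    by apply: measurable_funM => //; exact: measurable_funB.
  have k0 u : (0 <= k u)%E by rewrite /k mule_ge0// lee_fin.
  transitivity (\int[mu]_z k (b * z + a * x)%R)%E.
    apply: eq_integral => z _; rewrite /k.
    congr (g _ * (nphi _)%:E)%E; first ring.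
    by field; rewrite gt_eqF.
  rewrite (@ge0_integral_scale _ (fun w => k (w + a * x)%R))//; last first.
    by apply: (measurableT_comp mk); exact: measurable_funD.
  rewrite (@ge0_integral_shift _ k)// -ge0_integralZl//; last first.
    by rewrite lee_fin invr_ge0 ltW.
  by apply: eq_integral => u _; rewrite /k muleCA -EFinM.
pose I x := (\int[mu]_u (g u * (b^-1 * nphi ((u - a * x) / b))%:E))%E.
transitivity (\int[N]_x I x)%E; first by apply: eq_integral => x _; exact: inner.
have mF : measurable_fun setT (fun p : R * R =>
    (g p.2 * (b^-1 * nphi ((p.2 - a * p.1) / b))%:E * (nphi p.1)%:E)%E).
  apply: emeasurable_funM; last first.
    by apply/measurable_EFinP; exact: (measurableT_comp measurable_nphi).
  apply: emeasurable_funM; first exact: measurableT_comp.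
  apply/measurable_EFinP; apply: measurable_funM => //.
  apply: (measurableT_comp measurable_nphi); apply: measurable_funM => //.
  by apply: measurable_funB => //; exact: measurable_funM.
have F0 (p : R * R) :
    (0 <= g p.2 * (b^-1 * nphi ((p.2 - a * p.1) / b))%:E * (nphi p.1)%:E)%E.
  by rewrite !mule_ge0// lee_fin// mulr_ge0// invr_ge0 ltW.
rewrite (@ge0_integral_normal _ I); last 2 first.
- rewrite (_ : I = fun x => \int[N]_z g (a * x + b * z)%R)%E; last exact/funext.
  have mG : measurable_fun setT (fun p : R * R => g (a * p.1 + b * p.2)%R).
    by apply: (measurableT_comp mg); apply: measurable_funD; exact: measurable_funM.
  exact: (@measurable_fun_fubini_tonelli_F _ _ _ _ _ N _ mG (fun=> g0 _)).
- by move=> x; rewrite integral_ge0// => y _; rewrite mule_ge0// lee_fin// mulr_ge0// invr_ge0 ltW.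
transitivity (\int[mu]_x \int[mu]_u (g u * (b^-1 * nphi ((u - a * x) / b))%:E * (nphi x)%:E))%E.
  apply: eq_integral => x _; rewrite ge0_integralZr//.
  - apply: emeasurable_funM => //; apply/measurable_EFinP; apply: measurable_funM => //.
    by apply: (measurableT_comp measurable_nphi); apply: measurable_funM => //; exact: measurable_funB.
  - by move=> u _; rewrite mule_ge0// lee_fin// mulr_ge0// invr_ge0 ltW.
  - by rewrite lee_fin.
rewrite (@fubini_tonelli _ _ _ _ _ mu mu _ mF F0)/=.
rewrite ge0_integral_normal//; last first.
  by apply: (measurableT_comp mg); exact: measurable_funM.
pose k u := (g u * (nphi (c^-1 * u))%:E)%E.
have mk : measurable_fun setT k.
  apply: emeasurable_funM => //; apply/measurable_EFinP.
  by apply: (measurableT_comp measurable_nphi); exact: measurable_funM.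
have k0 u : (0 <= k u)%E by rewrite /k mule_ge0// lee_fin.
transitivity (\int[mu]_y k (c * y)%R)%E; last first.
  by apply: eq_integral => y _; rewrite /k mulKf// gt_eqF.
rewrite (@ge0_integral_scale _ k)// -ge0_integralZl//; last by rewrite lee_fin invr_ge0 ltW.
apply: eq_integral => u _.
(* Completing the square in x: given u, the variable x is normal with mean [a * u / c ^+ 2] and
   standard deviation q. *)
pose q := (b / c : R).
have q0 : 0 < q by rewrite divr_gt0.
have q0' : 0 < q^-1 by rewrite invr_gt0.
transitivity (\int[mu]_x ((g u * (b^-1 * nphi (c^-1 * u))%:E) * (nphi (q^-1 * (x - a * u / c ^+ 2)))%:E))%E.
  apply: eq_integral => x _; rewrite -!muleA -!EFinM; congr (_ * _%:E)%E.
  rewrite -!mulrA; congr (_ * _); rewrite !nphiE mulrACA [RHS]mulrACA -!expRD.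
  congr (_ * expR _); rewrite /q invf_div.
  rewrite [(c / b * _) ^+ 2]exprMn [(c / b) ^+ 2]expr_div_n [(c^-1 * u) ^+ 2]exprMn exprVn c2.
  field; apply/andP; split; last by rewrite gt_eqF.
  by rewrite -c2 expf_neq0// gt_eqF.
rewrite ge0_integralZl//; last 3 first.
- apply/measurable_EFinP; apply: (measurableT_comp measurable_nphi).
  by apply: measurable_funM => //; exact: measurable_funB.
- by move=> x _; rewrite lee_fin.
- by rewrite mule_ge0// lee_fin mulr_ge0// invr_ge0 ltW.
have -> : (\int[mu]_x (nphi (q^-1 * (x - a * u / c ^+ 2)))%:E = q%:E)%E.
  rewrite (@ge0_integral_shift _ (fun x => (nphi (q^-1 * x))%:E)); last 2 first.
  - apply/measurable_EFinP; apply: (measurableT_comp measurable_nphi).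
    exact: measurable_funM.
  - by move=> x; rewrite lee_fin.
  rewrite (@ge0_integral_scale _ (fun x => (nphi x)%:E))//; last 2 first.
  - exact/measurable_EFinP.
  - by move=> x; rewrite lee_fin.
  by rewrite integral_nphi mule1 invrK.
rewrite /k muleCA -muleA -!EFinM; congr (_ * _%:E)%E; rewrite /q.
by field; rewrite !gt_eqF.
Qed.

(** A negative b reduces to a positive one by the symmetry of z. For [b = 0] the square root is the
    absolute value of a, and the symmetry of the normal law absorbs the sign. *)
Lemma ge0_normal_comb (g : R -> \bar R) (a b : R) :
  measurable_fun setT g -> (forall x, 0 <= g x)%E ->
  (\int[N]_x \int[N]_z g (a * x + b * z)%R =
   \int[N]_y g (Num.sqrt (a ^+ 2 + b ^+ 2) * y)%R)%E.
Proof.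
move=> mg g0; have [b0|b0|b0] := ltgtP 0 b.
- exact: normal_comb_gt0.
- have b0' : 0 < - b by rewrite oppr_gt0.
  have := @normal_comb_gt0 g a (- b) mg g0 b0'; rewrite sqrrN => <-.
  apply: eq_integral => x _.
  have mgx : measurable_fun setT (fun z => g (a * x + b * z)).
    by apply: (measurableT_comp mg); apply: measurable_funD => //; exact: measurable_funM.
  rewrite -(ge0_normal_opp mgx)//.
  by apply: eq_integral => z _; rewrite mulrN mulNr.
- rewrite -b0 expr0n addr0 sqrtr_sqr.
  transitivity (\int[N]_x g (a * x)%R)%E.
    by apply: eq_integral => x _; under eq_integral do rewrite mul0r addr0; rewrite integral_cst//= probability_setT mule1.
  have [a0|a0] := leP 0 a; first by rewrite ger0_norm.
  have mga : measurable_fun setT (fun z => g (a * z)).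
    by apply: (measurableT_comp mg); exact: measurable_funM.
  rewrite ltr0_norm// -(ge0_normal_opp mga)//.
  by apply: eq_integral => z _; rewrite mulrN mulNr.
Qed.

End normal2.

(** * The standard Gaussian measure on tuples *)

Section tuple_gaussian.
Context {R : realType}.
Local Notation N := (@normal_prob R 0 1).

Definition tuple_box n (A : 'I_n -> set R) : set (n.-tuple R) :=
  [set x | forall i, A i (tnth x i)].

Lemma measurable_tuple_box n (A : 'I_n -> set R) :
  (forall i, measurable (A i)) -> measurable (tuple_box A).
Proof.
move=> mA.
rewrite (_ : tuple_box A = \bigcap_(i in [set: 'I_n]) ((fun x => tnth x i) @^-1` A i)).
  apply: fin_bigcap_measurable => // i _; rewrite -[X in measurable X]setTI.
  exact: measurable_tnth.
by apply/seteqP; split => x /= h i; [move=> _; exact: h|exact: h].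
Qed.

(** Boxes form a generating family that is stable under intersection, and on which [is_std_gaussian]
    prescribes the values: what uniqueness of the measure requires. *)
Lemma measurable_tupleE n :
  @measurable _ (n.-tuple R) = <<s [set B | exists2 A : 'I_n -> set R,
     (forall i, measurable (A i)) & B = tuple_box A] >>.
Proof.
apply/seteqP; split; last first.
  apply: smallest_sub; first exact: sigma_algebra_measurable.
  by move=> _ [A mA ->]; exact: measurable_tuple_box.
apply: smallest_sub; first exact: smallest_sigma_algebra.
apply: (big_ind (fun S => S `<=` _)) => //.
  by move=> S1 S2 h1 h2; rewrite subUset.
move=> i _ _ [B mB <-]; apply: sub_sigma_algebra; rewrite setTI.
exists (fun j => if j == i then B else setT).
  by move=> j; case: ifP.
apply/seteqP; split => x /=; last by move/(_ i); rewrite eqxx.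
by move=> Bx j; case: eqP => // ->.
Qed.

Lemma std_gaussian_unique n (mu : {measure set (n.-tuple R) -> \bar R})
    (gam : probability (n.-tuple R) R) :
  is_std_gaussian gam ->
  (forall A : 'I_n -> set R, (forall i, measurable (A i)) ->
    mu (tuple_box A) = (\prod_(i < n) N (A i))%E) ->
  forall B, measurable B -> mu B = gam B.
Proof.
move=> gamE muE B mB.
have boxT : tuple_box (fun _ : 'I_n => [set: R]) = setT by apply/seteqP; split.
apply: (measure_unique _ (fun _ => setT) (@measurable_tupleE n)) => //.
- move=> _ _ [A mA ->] [A' mA' ->]; exists (fun i => A i `&` A' i).
    by move=> i; exact: measurableI.
  by apply/seteqP; split => x /=; [move=> [h h'] i; split|move=> h; split => i; case: (h i)].
- by move=> _; exists (fun _ => setT).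
- by rewrite bigcup_const.
- by move=> _ [A mA ->]; rewrite muE// -gamE.
- move=> _; rewrite -boxT muE// big1 ?ltry// => i _; exact: probability_setT.
Qed.

(** Inductions on the dimension need a Gaussian measure in the lower one; it is obtained as a
    marginal of the given measure. *)
Lemma std_gaussian_behead n (gam : probability (n.+1.-tuple R) R) :
  is_std_gaussian gam ->
  exists gam' : probability (n.-tuple R) R, is_std_gaussian gam'.
Proof.
move=> gamE.
pose X : n.+1.-tuple R -> n.-tuple R := fun x => [tuple of behead x].
have mX : measurable_fun setT X by exact: measurable_behead.
pose XX : {RV gam >-> n.-tuple R} := HB.pack X (isMeasurableFun.Build _ _ _ _ X mX).
exists (distribution gam XX : probability _ _) => A mA.
pose A' (i : 'I_n.+1) := if unlift ord0 i is Some j then A j else setT.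
transitivity (gam (tuple_box A')).
  congr (gam _); apply/seteqP; split => x /= h.
    move=> i; rewrite /A'; case: unliftP => [j ->|//].
    by move: (h j); rewrite /X tnth_behead (_ : inord _ = lift ord0 j)//; apply: val_inj; rewrite /= inordK// ltnS.
  move=> i; have := h (lift ord0 i); rewrite /A' liftK.
  by rewrite /X tnth_behead; rewrite (_ : inord _ = lift ord0 i)//; apply: val_inj; rewrite /= inordK// ltnS.
rewrite /tuple_box gamE; last by move=> i; rewrite /A'; case: unlift.
rewrite big_ord_recl /A' unlift_none probability_setT mul1e.
by apply: eq_bigr => i _; rewrite liftK.
Qed.

Definition tcons n (p : R * n.-tuple R) : n.+1.-tuple R := [tuple of p.1 :: p.2].

Lemma measurable_tcons n : measurable_fun setT (@tcons n).
Proof. exact: (measurable_cons measurable_fst measurable_snd). Qed.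

(** The image under [tcons] of the product of [N] and [gam'] has the right values on boxes, hence is
    [gam]; Tonelli's theorem does the rest. The n-dimensional formulas below follow from this by
    induction. *)
Lemma ge0_std_gaussian_cons n (gam : probability (n.+1.-tuple R) R)
    (gam' : probability (n.-tuple R) R) (g : n.+1.-tuple R -> \bar R) :
  is_std_gaussian gam -> is_std_gaussian gam' ->
  measurable_fun setT g -> (forall x, 0 <= g x)%E ->
  (\int[gam]_x g x = \int[N]_x \int[gam']_t g (tcons (x, t)))%E.
Proof.
move=> gamE gamE' mg g0.
pose tc : measurableTypeR R * n.-tuple R -> n.+1.-tuple R := @tcons n.
have mc : measurable_fun setT tc := @measurable_tcons n.
pose P := (N \x gam')%E.
transitivity (\int[pushforward P tc]_x g x)%E.
  apply: eq_measure_integral => A mA _; apply/esym.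
  apply: (std_gaussian_unique (mu := pushforward P tc)) => // B mB.
  transitivity (P (B ord0 `*` tuple_box (fun i => B (lift ord0 i)))).
    congr (P _); apply/seteqP; split => -[x t] /=.
      by move=> h; split => [|i]; [have := h ord0|have := h (lift ord0 i); rewrite tnthS].
    by move=> [h0 h] i; case: (unliftP ord0 i) => [j ->|->//]; rewrite tnthS; exact: h.
  rewrite /P product_measure1E//; last exact: measurable_tuple_box.
  by rewrite [X in (_ * X)%E]gamE'// big_ord_recl.
  exact: mB.
rewrite (@ge0_integral_pushforward _ _ _ _ _ _ mc P setT g)// preimage_setT fubini_tonelli1//; [exact: (measurableT_comp mg mc)|move=> x; exact: g0].
Qed.

End tuple_gaussian.

(** * Combinations, marginals and shifts in dimension n *)

Section tuple_gaussian2.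
Context {R : realType}.
Local Notation N := (@normal_prob R 0 1).

Lemma measurable_vlin d (T : measurableType d) n (a b : R) (X Y : T -> n.-tuple R) :
  measurable_fun setT X -> measurable_fun setT Y ->
  measurable_fun setT (fun t => vlin a b (X t) (Y t)).
Proof.
move=> mX mY; apply/measurable_fun_tnthP => i.
rewrite (_ : _ \o _ = fun t => a * tnth (X t) i + b * tnth (Y t) i).
  apply: measurable_funD; apply: measurable_funM => //.
    exact: (measurableT_comp (measurable_tnth i) mX).
  exact: (measurableT_comp (measurable_tnth i) mY).
by apply/funext => t /=; rewrite tnth_mktuple.
Qed.

Definition vscale n (c : R) (x : n.-tuple R) : n.-tuple R :=
  [tuple c * tnth x i | i < n].

Lemma measurable_vscale n (c : R) : measurable_fun setT (@vscale n c).
Proof.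
rewrite (_ : @vscale n c = fun x => vlin c 0 x x); last first.
  by apply/funext => x; apply: eq_from_tnth => i; rewrite !tnth_mktuple mul0r addr0.
by apply: measurable_vlin; exact: measurable_id.
Qed.

Lemma measurable_tconsP d (T : measurableType d) n (X : T -> R) (Y : T -> n.-tuple R) :
  measurable_fun setT X -> measurable_fun setT Y ->
  measurable_fun setT (fun t => tcons (X t, Y t)).
Proof. exact: measurable_cons. Qed.

Lemma measurable_vdot n (a : n.-tuple R) : measurable_fun setT (vdot a).
Proof.
apply: measurable_sum => i; apply: measurable_funM => //; exact: measurable_tnth.
Qed.

Lemma tnth_tcons0 n x (t : n.-tuple R) : tnth (tcons (x, t)) ord0 = x.
Proof. by []. Qed.

Lemma tnth_tconsS n x (t : n.-tuple R) i : tnth (tcons (x, t)) (lift ord0 i) = tnth t i.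
Proof. by rewrite tnthS. Qed.

Lemma vlin_tcons n a b (x y : R) (s t : n.-tuple R) :
  vlin a b (tcons (x, s)) (tcons (y, t)) = tcons (a * x + b * y, vlin a b s t).
Proof.
apply: eq_from_tnth => i; rewrite tnth_mktuple.
by case: (unliftP ord0 i) => [j ->|->]; rewrite ?tnth_tconsS ?tnth_mktuple// !tnth_tcons0.
Qed.

Lemma vscale_tcons n c (x : R) (s : n.-tuple R) :
  vscale c (tcons (x, s)) = tcons (c * x, vscale c s).
Proof.
apply: eq_from_tnth => i; rewrite tnth_mktuple.
by case: (unliftP ord0 i) => [j ->|->]; rewrite ?tnth_tconsS ?tnth_mktuple// !tnth_tcons0.
Qed.

Lemma vdot_tcons n (x y : R) (s t : n.-tuple R) :
  vdot (tcons (x, s)) (tcons (y, t)) = x * y + vdot s t.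
Proof.
rewrite /vdot big_ord_recl !tnth_tcons0; congr (_ + _).
by apply: eq_bigr => i _; rewrite !tnth_tconsS.
Qed.

Lemma tcons_eta n (x : n.+1.-tuple R) : exists y t, x = tcons (y, t).
Proof.
exists (thead x), [tuple of behead x]; rewrite {1}(tuple_eta x).
by apply/val_inj.
Qed.

Lemma vdot_ge0 n (a : n.-tuple R) : 0 <= vdot a a.
Proof. by apply: sumr_ge0 => i _; rewrite -expr2 sqr_ge0. Qed.

Lemma integral_tuple0 (gam : probability (0.-tuple R) R) (g : 0.-tuple R -> \bar R) :
  (\int[gam]_x g x = g [tuple])%E.
Proof.
rewrite (eq_integral (cst (g [tuple]))); last by move=> x _; rewrite tuple0.
by rewrite integral_cst//= probability_setT mule1.
Qed.

(** The one-dimensional formula treats the heads, the induction hypothesis the tails. *)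
Lemma ge0_std_gaussian_comb n (gam : probability (n.-tuple R) R)
    (g : n.-tuple R -> \bar R) (a b : R) :
  is_std_gaussian gam ->
  measurable_fun setT g -> (forall x, 0 <= g x)%E ->
  (\int[gam]_x \int[gam]_z g (vlin a b x z) =
   \int[gam]_x g (vscale (Num.sqrt (a ^+ 2 + b ^+ 2)) x))%E.
Proof.
elim: n gam g => [|n IH] gam g gamE mg g0.
  by rewrite !integral_tuple0 [vlin _ _ _ _]tuple0 [vscale _ _]tuple0.
have [gam' gamE'] := std_gaussian_behead gamE.
set c := Num.sqrt _.
have mF : measurable_fun setT
    (fun p : n.+1.-tuple R * n.+1.-tuple R => g (vlin a b p.1 p.2)).
  by apply: (measurableT_comp mg); exact: measurable_vlin.
rewrite (ge0_std_gaussian_cons gamE gamE'); last 2 first.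
- exact: (@measurable_fun_fubini_tonelli_F _ _ _ _ _ gam _ mF (fun=> g0 _)).
- by move=> x; exact: integral_ge0.
rewrite (ge0_std_gaussian_cons gamE gamE' (g := fun x => g (vscale c x))); last 2 first.
- by apply: (measurableT_comp mg); exact: measurable_vscale.
- by move=> x.
pose k y := (\int[gam']_t g (tcons (y, vscale c t)))%E.
have mk : measurable_fun setT k.
  have mG : measurable_fun setT (fun p : R * n.-tuple R => g (tcons (p.1, vscale c p.2))).
    apply: (measurableT_comp mg); apply: measurable_tconsP => //.
    by apply: (measurableT_comp (measurable_vscale c)).
  exact: (@measurable_fun_fubini_tonelli_F _ _ _ _ _ gam' _ mG (fun=> g0 _)).
have k0 y : (0 <= k y)%E by exact: integral_ge0.
transitivity (\int[N]_x \int[N]_y k (a * x + b * y)%R)%E; last first.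
  rewrite (ge0_normal_comb _ _ mk k0) -/c; apply: eq_integral => y _.
  by apply: eq_integral => t _; rewrite vscale_tcons.
apply: eq_integral => x _.
transitivity (\int[gam']_t \int[N]_y \int[gam']_s g (tcons (a * x + b * y, vlin a b t s)%R))%E.
  apply: eq_integral => t _.
  rewrite (ge0_std_gaussian_cons gamE gamE' (g := fun z => g (vlin a b (tcons (x, t)) z))).
  - apply: eq_integral => y _; apply: eq_integral => s _.
    by rewrite vlin_tcons.
  - apply: (measurableT_comp mg); exact: measurable_vlin.
  - by move=> z.
have mG : measurable_fun setT (fun p : n.-tuple R * R * n.-tuple R =>
    g (tcons (a * x + b * p.1.2, vlin a b p.1.1 p.2))).
  apply: (measurableT_comp mg); apply: measurable_tconsP.
    apply: measurable_funD => //; apply: measurable_funM => //.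
    exact: (measurableT_comp measurable_snd measurable_fst).
  apply: measurable_vlin => //.
  exact: (measurableT_comp measurable_fst measurable_fst).
(* Exchanging the tail t with the head y makes the two tail integrals adjacent, so that the
   induction hypothesis applies to them. *)
rewrite (@fubini_tonelli _ _ _ (measurableTypeR R) _ gam' N
  (fun p => \int[gam']_s g (tcons (a * x + b * p.2, vlin a b p.1 s)%R))%E)/=.
- apply: eq_integral => y _.
  rewrite (IH gam' (fun t => g (tcons (a * x + b * y, t))))//.
  by apply: (measurableT_comp mg); apply: measurable_tconsP.
- exact: (@measurable_fun_fubini_tonelli_F _ _ _ _ _ gam' _ mG (fun=> g0 _)).
- by move=> p; exact: integral_ge0.
Qed.

(** The head contributes the variance [a0 ^+ 2], the tail [vdot a' a'] by induction, and
    [ge0_normal_comb] adds them. *)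
Lemma ge0_std_gaussian_marginal n (gam : probability (n.-tuple R) R)
    (g : R -> \bar R) (a : n.-tuple R) :
  is_std_gaussian gam ->
  measurable_fun setT g -> (forall x, 0 <= g x)%E ->
  (\int[gam]_x g (vdot a x) = \int[N]_y g (Num.sqrt (vdot a a) * y)%R)%E.
Proof.
elim: n gam g a => [|n IH] gam g a gamE mg g0.
  rewrite integral_tuple0 /vdot !big_ord0 sqrtr0.
  by under eq_integral do rewrite mul0r; rewrite integral_cst//= probability_setT mule1.
have [gam' gamE'] := std_gaussian_behead gamE.
have [a0 [a' ->]] := tcons_eta a.
rewrite (ge0_std_gaussian_cons gamE gamE' (g := fun x => g (vdot _ x))); last 2 first.
- by apply: (measurableT_comp mg); exact: measurable_vdot.
- by move=> x.
have := ge0_normal_comb a0 (Num.sqrt (vdot a' a')) mg g0.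
rewrite sqr_sqrtr ?vdot_ge0// vdot_tcons -expr2 => <-.
apply: eq_integral => x _.
transitivity (\int[gam']_t g (a0 * x + vdot a' t)%R)%E.
  by apply: eq_integral => t _; rewrite vdot_tcons.
by rewrite (IH gam' (fun y => g (a0 * x + y)))//; apply: (measurableT_comp mg);
  exact: measurable_funD.
Qed.

(** Cameron-Martin formula in dimension n; the exponential is a product over the coordinates. *)
Lemma ge0_std_gaussian_shift n (gam : probability (n.-tuple R) R)
    (g : n.-tuple R -> \bar R) (e : R) (x : n.-tuple R) :
  is_std_gaussian gam ->
  measurable_fun setT g -> (forall x, 0 <= g x)%E ->
  (\int[gam]_z g (vlin 1 e z x) =
   \int[gam]_z (g z * (expR (e * vdot x z - e ^+ 2 * vdot x x / 2))%:E))%E.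
Proof.
elim: n gam g x => [|n IH] gam g x gamE mg g0.
  rewrite !integral_tuple0 [vlin _ _ _ _]tuple0 /vdot !big_ord0 !mulr0 mul0r subr0.
  by rewrite expR0 mule1.
have [gam' gamE'] := std_gaussian_behead gamE.
have [x0 [x' ->]] := tcons_eta x.
have me m (y : m.-tuple R) : measurable_fun setT (fun z : m.-tuple R =>
    (expR (e * vdot y z - e ^+ 2 * vdot y y / 2))%:E).
  apply/measurable_EFinP; apply: measurableT_comp => //.
  apply: measurable_funB => //; apply: measurable_funM => //; exact: measurable_vdot.
rewrite (ge0_std_gaussian_cons gamE gamE'); last 2 first.
- by apply: (measurableT_comp mg); apply: measurable_vlin.
- by move=> z.
rewrite (ge0_std_gaussian_cons gamE gamE'); last 2 first.
- by apply: emeasurable_funM => //; exact: me.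
- by move=> z; rewrite mule_ge0// lee_fin expR_ge0.
pose E t := (expR (e * vdot x' t - e ^+ 2 * vdot x' x' / 2))%:E.
pose k y := (\int[gam']_t (g (tcons (y, t)) * E t))%E.
have mk : measurable_fun setT k.
  have mG : measurable_fun setT (fun p : R * n.-tuple R => g (tcons p) * E p.2)%E.
    apply: emeasurable_funM; first by apply: (measurableT_comp mg); exact: measurable_tcons.
    exact: (measurableT_comp (me _ _) measurable_snd).
  apply: (@measurable_fun_fubini_tonelli_F _ _ _ _ _ gam' _ mG _) => p.
  by rewrite mule_ge0// lee_fin expR_ge0.
have k0 y : (0 <= k y)%E.
  by apply: integral_ge0 => t _; rewrite mule_ge0// lee_fin expR_ge0.
transitivity (\int[N]_y k (y + e * x0)%R)%E.
  apply: eq_integral => y _.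
  transitivity (\int[gam']_t g (tcons (y + e * x0, vlin 1 e t x')%R))%E.
    by apply: eq_integral => t _; rewrite vlin_tcons mul1r.
  rewrite (IH gam' (fun t => g (tcons (y + e * x0, t))))//.
  by apply: (measurableT_comp mg); exact: measurable_tconsP.
rewrite (ge0_normal_shift _ mk k0); apply: eq_integral => y _.
rewrite /k -ge0_integralZr//; last 2 first.
- apply: emeasurable_funM; last exact: me.
  by apply: (measurableT_comp mg); exact: measurable_tconsP.
- by move=> t _; rewrite mule_ge0// lee_fin expR_ge0.
apply: eq_integral => t _; rewrite -muleA /E -EFinM -expRD !vdot_tcons.
by congr (_ * (expR _)%:E)%E; field.
Qed.

(** The l1 norm is chosen because its exponential is a product over the coordinates, whose
    integrability follows by induction on n. *)
Definition l1 n (x : n.-tuple R) : R := \sum_(i < n) `|tnth x i|.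

Lemma measurable_l1 n : measurable_fun setT (@l1 n).
Proof.
apply: measurable_sum => i; apply: measurableT_comp => //; exact: measurable_tnth.
Qed.

(** The integrand is at most [expR (J * x) + expR (- J * x)], and exponentials of linear functions
    are integrable because [ge0_normal_shift] for the constant 1 gives [expR (a * x - a ^+ 2 / 2)]
    the mean 1. *)
Lemma normal_exp_abs_lty (J : R) : (\int[N]_x (expR (J * `|x|))%:E < +oo)%E.
Proof.
have h (a : R) : (\int[N]_x (expR (a * x))%:E < +oo)%E.
  have := @ge0_normal_shift R (cst 1%E) a (@measurable_cst _ _ _ _ _ _) (fun=> lee01).
  under [in X in _ = X -> _]eq_integral do rewrite mul1e expRD EFinM.
  rewrite integral_cst//= probability_setT mule1 ge0_integralZr//; last first.
    by apply/measurable_EFinP; apply: measurableT_comp => //; exact: measurable_funM.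
  move=> h; rewrite ltey; apply/eqP => hy; move: h; by rewrite hy gt0_mulye ?lte_fin ?expR_gt0.
apply: (@le_lt_trans _ _ (\int[N]_x ((expR (J * x))%:E + (expR (- J * x))%:E))%E).
  apply: ge0_le_integral => //.
  - by apply/measurable_EFinP; apply: measurableT_comp => //; apply: measurable_funM.
  - by apply: emeasurable_funD; apply/measurable_EFinP; apply: measurableT_comp => //; exact: measurable_funM.
  - move=> x _; rewrite -EFinD lee_fin; have [x0|x0] := leP 0 x.
      by rewrite ger0_norm// lerDl expR_ge0.
    by rewrite ltr0_norm// mulrN -mulNr lerDr expR_ge0.
rewrite ge0_integralD//; first by rewrite lte_add_pinfty.
- by apply/measurable_EFinP; apply: measurableT_comp => //; exact: measurable_funM.
- by apply/measurable_EFinP; apply: measurableT_comp => //; exact: measurable_funM.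
Qed.

Lemma std_gaussian_exp_l1_lty n (gam : probability (n.-tuple R) R) (J : R) :
  is_std_gaussian gam -> (\int[gam]_x (expR (J * l1 x))%:E < +oo)%E.
Proof.
elim: n gam => [|n IH] gam gamE; first by rewrite integral_tuple0 ltry.
have [gam' gamE'] := std_gaussian_behead gamE.
have me m : measurable_fun setT (fun x : m.-tuple R => (expR (J * l1 x))%:E).
  apply/measurable_EFinP; apply: measurableT_comp => //; apply: measurable_funM => //.
  exact: measurable_l1.
rewrite (ge0_std_gaussian_cons gamE gamE')//.
pose M := (\int[gam']_x (expR (J * l1 x))%:E)%E.
have M0 : (0 <= M)%E by apply: integral_ge0 => x _; rewrite lee_fin expR_ge0.
apply: (@le_lt_trans _ _ (\int[N]_x ((expR (J * `|x|))%:E * M))%E).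
  rewrite le_eqVlt; apply/orP; left; apply/eqP.
  apply: eq_integral => x _; rewrite /M -ge0_integralZl//.
  apply: eq_integral => t _; rewrite -EFinM -expRD -mulrDr; congr (expR (_ * _))%:E.
  rewrite /l1 big_ord_recl tnth_tcons0; congr (_ + _).
  by apply: eq_bigr => i _; rewrite tnth_tconsS.
  exact: me.
rewrite ge0_integralZr//; last first.
  by apply/measurable_EFinP; apply: measurableT_comp => //; apply: measurable_funM.
have My : (M < +oo)%E by exact: IH.
have := normal_exp_abs_lty J.
have : (0 <= \int[N]_x (expR (J * `|x|))%:E)%E.
  by apply: integral_ge0 => x _; rewrite lee_fin expR_ge0.
by case: (\int[N]_x _)%E => // r r0 _; case: M M0 My => // s s0 _; rewrite -EFinM ltry.
Qed.

End tuple_gaussian2.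

(** * The normal distribution function *)

Section taylor.
Context {R : realType}.
Implicit Types f : R -> R.

Lemma is_derive_continuous f f1 :
  (forall x : R, is_derive x 1 f (f1 x)) -> continuous f.
Proof.
move=> df x; apply: differentiable_continuous; apply/derivable1_diffP.
by have [] := df x.
Qed.

Lemma mvt_any f f1 (x d : R) : (forall x : R, is_derive x 1 f (f1 x)) ->
  exists2 c, `|c - x| <= `|d| & f (x + d) - f x = f1 c * d.
Proof.
move=> df; have cf := is_derive_continuous df.
have [d0|d0|d0] := ltgtP 0 d.
- have [||c cxd e] := @MVT _ f f1 x (x + d).
  + by rewrite ltrDl.
  + exact: continuous_subspaceT.
  exists c; last by rewrite e; congr (_ * _); ring.
  move: cxd; rewrite in_itv/= => /andP[xc cd].
  by rewrite !gtr0_norm ?subr_gt0// lerBlDl ltW.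
- have [||c cxd e] := @MVT _ f f1 (x + d) x.
  + by rewrite gtrDl.
  + exact: continuous_subspaceT.
  exists c; last by rewrite -opprB e; ring.
  move: cxd; rewrite in_itv/= => /andP[xc cd].
  by rewrite !ltr0_norm ?subr_lt0// opprB; lra.
- by rewrite -d0; exists x; rewrite ?subrr ?normr0// addr0 subrr mulr0.
Qed.

Lemma taylor1 f f1 (C x d : R) :
  (forall x : R, is_derive x 1 f (f1 x)) -> (forall x y, `|f1 y - f1 x| <= C * `|y - x|) ->
  `|f (x + d) - f x - f1 x * d| <= C * d ^+ 2.
Proof.
move=> df lf; have [c cd ->] := mvt_any x d df.
rewrite -mulrBl normrM -[d ^+ 2]real_normK ?num_real// expr2 mulrA ler_wpM2r//.
have C0 : 0 <= C by have := lf 0 1; rewrite subr0 normr1 mulr1; exact: le_trans.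
by apply: (le_trans (lf _ _)); rewrite ler_wpM2l.
Qed.

(** The mean value theorem is applied to f minus the nonconstant part of its quadratic Taylor
    polynomial at x; [taylor1] bounds the derivative of this difference. The constant is not sharp,
    as only the order of the error matters. *)
Lemma taylor2 f f1 f2 (C x d : R) :
  (forall x : R, is_derive x 1 f (f1 x)) -> (forall x : R, is_derive x 1 f1 (f2 x)) ->
  (forall x y, `|f2 y - f2 x| <= C * `|y - x|) ->
  `|f (x + d) - f x - f1 x * d - f2 x * d ^+ 2 / 2| <= C * `|d| ^+ 3.
Proof.
move=> df df1 lf.
have C0 : 0 <= C by have := lf 0 1; rewrite subr0 normr1 mulr1; exact: le_trans.
pose g t := f t - f1 x * (t - x) - f2 x / 2 * (t - x) ^+ 2.
pose g1 t := f1 t - f1 x - f2 x * (t - x).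
have dg (t : R) : is_derive t 1 g (g1 t).
  have h : is_derive t 1 (fun t : R => t - x) 1.
    by apply: is_derive_eq; rewrite subr0.
  rewrite /g; apply: is_derive_eq.
  by rewrite /GRing.scale/= /g1; field.
have [c cd e] := mvt_any x d dg.
have -> : f (x + d) - f x - f1 x * d - f2 x * d ^+ 2 / 2 = g (x + d) - g x.
  by rewrite /g; field.
rewrite e normrM exprS [_ * `|d| ^+ 2]mulrC mulrA ler_wpM2r//.
rewrite /g1; have -> : c = x + (c - x) by ring.
rewrite [x + (c - x) - x](_ : _ = c - x); last by ring.
apply: (le_trans (taylor1 (C := C) x (c - x) df1 lf)).
by rewrite ler_wpM2l// -[(c - x) ^+ 2]real_normK ?num_real// lerXn2r ?nnegrE.
Qed.

End taylor.

(** * Density and distribution function of N(0,1) *)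

Section gaussian_cdf.
Context {R : realType}.
Local Notation mu := (@lebesgue_measure R).
Local Notation N := (@normal_prob R 0 1).

Definition Gcdf (x : R) : R := fine (N `]-oo, x]%classic).

Lemma Gcdf_EFin x : N `]-oo, x]%classic = (Gcdf x)%:E.
Proof. by rewrite /Gcdf fineK// fin_num_measure. Qed.

Lemma is_derive_Gcdf (x : R) : is_derive x 1 Gcdf (nphi x).
Proof.
have x1 : x < x + 1 by rewrite ltrDl.
have iN : mu.-integrable [set` Interval -oo%O (BRight (x + 1))] (EFin \o @nphi R).
  by apply: (integrableS measurableT) => //; exact: integrable_normal_pdf.
have cN : {for x, continuous (@nphi R)}.
  by move: x {x1 iN}; apply: continuous_normal_pdf; rewrite oner_neq0.
have [d e] := continuous_FTC1 x1 iN (ltNyr _) cN.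
have -> : Gcdf = fun x0 => (\int[mu]_(t in [set` Interval -oo%O (BRight x0)]) nphi t)%R.
  by apply/funext => y.
by apply: (DeriveDef d); rewrite -derive1E.
Qed.

Lemma is_derive_nphi (x : R) : is_derive x 1 (@nphi R) (- x * nphi x).
Proof.
rewrite (_ : @nphi R = (fun x => normal_peak 1 * expR (- (x ^+ 2) / 2))); last first.
  by apply/funext => y; exact: nphiE.
have h : is_derive x 1 (fun x : R => - x ^+ 2 / 2) (- x).
  by apply: is_derive_eq; rewrite /GRing.scale/=; field.
have h2 : is_derive x 1 (fun x : R => expR (- x ^+ 2 / 2)) (expR (- x ^+ 2 / 2) * - x).
  exact: is_derive1_comp.
by apply: is_derive_eq; rewrite /GRing.scale/=; ring.
Qed.

Lemma normal_peak1_le1 : normal_peak (1 : R) <= 1.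
Proof.
rewrite /normal_peak invf_le1 ?sqrtr_gt0; last first.
  by rewrite expr1n mul1r pmulrn_lgt0// pi_gt0.
rewrite -[leLHS]sqrtr1 ler_sqrt expr1n mul1r; last by rewrite mulrn_wge0// pi_ge0.
by have := pi_ge2 R; rewrite mulr2n; lra.
Qed.

(** A form of [1 + x ^+ 2 / 2 <= expR (x ^+ 2 / 2)]. It is the common source of the absolute bounds
    on [nphi x] and on its products with the absolute value of x and with [x ^+ 2]. *)
Lemma nphi_le_inv (x : R) : nphi x * (1 + x ^+ 2 / 2) <= 1.
Proof.
rewrite nphiE -mulrA; apply: (@le_trans _ _ (1 * 1)); last by rewrite mulr1.
apply: ler_pM => //.
- exact: normal_peak_ge0.
- by rewrite mulr_ge0 ?expR_ge0// addr_ge0// divr_ge0// sqr_ge0.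
- exact: normal_peak1_le1.
by rewrite mulNr expRN mulrC ler_pdivrMr ?expR_gt0// mul1r expR_ge1Dx.
Qed.

Lemma nphi_le1 (x : R) : nphi x <= 1.
Proof.
apply: le_trans (nphi_le_inv x); rewrite ler_peMr ?nphi_ge0// lerDl.
by rewrite divr_ge0// sqr_ge0.
Qed.

Lemma nphi_abs_le1 (x : R) : `|x| * nphi x <= 1.
Proof.
apply: le_trans (nphi_le_inv x); rewrite mulrC ler_wpM2l ?nphi_ge0//.
have := sqr_ge0 (`|x| - 1); rewrite -[x ^+ 2]real_normK ?num_real//.
by set y := `|x|; nra.
Qed.

Lemma nphi_sqr_le2 (x : R) : x ^+ 2 * nphi x <= 2.
Proof. by have := nphi_le_inv x; have := nphi_gt0 x; nra. Qed.

Lemma Gcdf_ge0 x : 0 <= Gcdf x.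
Proof. by rewrite /Gcdf fine_ge0. Qed.

Lemma ltr_Gcdf : {mono Gcdf : x y / x < y}.
Proof.
apply: leW_mono; apply: le_mono => x y xy.
have [c _ e] := mvt_any x (y - x) is_derive_Gcdf.
have {}e : Gcdf y - Gcdf x = nphi c * (y - x) by rewrite -e; congr (Gcdf _ - _); ring.
by rewrite -subr_gt0 e mulr_gt0 ?subr_gt0// nphi_gt0.
Qed.

Lemma ler_Gcdf : {mono Gcdf : x y / x <= y}.
Proof. by move=> x y; rewrite !leNgt ltr_Gcdf. Qed.

Lemma Gcdf_gt0 x : 0 < Gcdf x.
Proof. by rewrite (le_lt_trans (Gcdf_ge0 (x - 1)))// ltr_Gcdf gtrBl. Qed.

Lemma Gcdf_lt1 x : Gcdf x < 1.
Proof.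
apply: (@lt_le_trans _ _ (Gcdf (x + 1))); first by rewrite ltr_Gcdf ltrDl.
by rewrite -lee_fin -Gcdf_EFin probability_le1.
Qed.

Lemma measurable_Gcdf : measurable_fun setT Gcdf.
Proof.
apply: continuous_measurable_fun; exact: is_derive_continuous is_derive_Gcdf.
Qed.

(** Exponential Markov inequality: on [x <= - K] the function [expR (- K) * expR (- x)] is at least
    1. *)
Lemma Gcdf_small (e : R) : 0 < e -> exists K, Gcdf (- K) < e.
Proof.
move=> e0.
pose M := fine (\int[N]_x (expR (1 * `|x|))%:E)%E.
have M0 : 0 <= M by rewrite fine_ge0// integral_ge0// => x _; rewrite lee_fin expR_ge0.
have ME : (\int[N]_x (expR (1 * `|x|))%:E = M%:E)%E.
  rewrite /M fineK// ge0_fin_numE ?normal_exp_abs_lty//.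
  by apply: integral_ge0 => x _; rewrite lee_fin expR_ge0.
have mexp : measurable_fun setT (fun x : R => (expR (1 * `|x|))%:E).
  by apply/measurable_EFinP; apply: measurableT_comp => //; apply: measurable_funM.
(* As [expR K >= 1 + K], this K gives [e * expR K >= e + M > M]. *)
pose K := M / e.
exists K.
have h : Gcdf (- K) <= expR (- K) * M.
  rewrite -lee_fin -Gcdf_EFin EFinM -ME -ge0_integralZl//.
  rewrite -[X in N X]setIT -(integral_indic N measurableT)//.
  apply: ge0_le_integral => //.
  - by apply/measurable_EFinP; exact: measurable_indic.
  - by apply: emeasurable_funM.
  - move=> x _; rewrite -EFinM lee_fin indicE; case: (boolP (x \in _)); last first.
      by move=> _; rewrite mulr_ge0// expR_ge0.
    rewrite inE/= in_itv/= => xK; rewrite -expRD -[leLHS]expR0 ler_expR mul1r.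
    by have := ler_norm (- x); rewrite normrN; lra.
apply: (le_lt_trans h); rewrite expRN mulrC ltr_pdivrMr ?expR_gt0//.
apply: (@lt_le_trans _ _ (e * (1 + K))); last by rewrite ler_wpM2l ?(ltW e0)// expR_ge1Dx.
by rewrite /K mulrDr mulr1 mulrC divfK ?gt_eqF// ltrDr.
Qed.

Lemma Gcdf_opp x : N `[x, +oo[%classic = (Gcdf (- x))%:E.
Proof.
rewrite -Gcdf_EFin.
rewrite -[LHS](_ : (\int[N]_y (\1_(`[x, +oo[%classic) y)%:E)%E = _); last first.
  by rewrite integral_indic// setIT.
rewrite -[RHS](_ : (\int[N]_y (\1_(`]-oo, (- x)%R]%classic) y)%:E)%E = _); last first.
  by rewrite integral_indic// setIT.
rewrite -[RHS](@ge0_normal_opp R (fun y => (\1_(`]-oo, (- x)%R]%classic) y)%:E)).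
- apply: eq_integral => y _; congr EFin; rewrite !indicE; congr ((_ : bool)%:R).
  by apply/idP/idP; rewrite !inE/= !in_itv/= andbT lerN2.
- exact/measurable_EFinP/measurable_indic.
- by move=> y; rewrite lee_fin.
Qed.

Lemma Gcdf_oppE x : Gcdf (- x) = 1 - Gcdf x.
Proof.
have h : N `]-oo, x[%classic = (Gcdf x)%:E.
  rewrite -Gcdf_EFin /normal_prob integral_itv_bndo_bndc//.
  by apply: measurable_funTS; apply/measurable_EFinP; exact: measurable_normal_pdf.
apply: EFin_inj; rewrite -Gcdf_opp EFinB -h -[X in N X]setCK setCitvr.
by rewrite probability_setC.
Qed.

End gaussian_cdf.

(** * Expectations of functions dominated by powers of a weight *)

Section dominated.
Context {R : realType} d (T : measurableType d) (P : probability T R) (w : T -> R).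

Implicit Types (f g : T -> R) (c C : R).

(** For such a w, the functions satisfying [dom] form an algebra of integrable functions: sums and
    products are again dominated by a power of w. Integrability can then be read off the shape of an
    integrand. The weights in use are [expabs] in dimension one and [expl1] in dimension n. *)
Definition weight := [/\ measurable_fun setT w, (forall x, 1 <= w x) &
  (forall J : nat, \int[P]_x (w x ^+ J)%:E < +oo)%E].

Definition dom (f : T -> R) := measurable_fun setT f /\
  exists (C : R) (J : nat), 0 <= C /\ forall x, `|f x| <= C * w x ^+ J.

Hypothesis W : weight.

Lemma dom_le (C : R) (J : nat) (f : T -> R) : measurable_fun setT f ->
  (forall x, `|f x| <= C * w x ^+ J) -> dom f.
Proof.
move=> mf h; split => //; exists `|C|, J; split => // x.
apply: (le_trans (h x)); rewrite ler_wpM2r ?ler_norm//.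
by case: W => _ w1 _; rewrite exprn_ge0// (le_trans ler01).
Qed.

Lemma dom_integrable f : dom f -> P.-integrable setT (EFin \o f).
Proof.
case: W => mw w1 iw [mf [C [J [C0 h]]]].
have w0 x J' : 0 <= w x ^+ J' by rewrite exprn_ge0// (le_trans ler01).
apply: (@le_integrable _ _ _ P setT measurableT _ (fun x => C%:E * (w x ^+ J)%:E)%E).
- exact/measurable_EFinP.
- move=> x _; rewrite -EFinM !abse_EFin lee_fin (le_trans (h x))//.
  by rewrite ger0_norm// mulr_ge0.
- apply: integrableZl => //; apply/integrableP; split.
    by apply/measurable_EFinP; exact: measurable_funX.
  by under eq_integral do rewrite abse_EFin ger0_norm//.
Qed.

Lemma dom_cst c : dom (cst c).
Proof. by apply: (@dom_le `|c| 0%N) => // x; rewrite expr0 mulr1. Qed.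

Lemma dom_w : dom w.
Proof.
case: W => mw w1 _; apply: (@dom_le 1 1%N) => // x.
by rewrite mul1r expr1 ger0_norm// (le_trans ler01).
Qed.

Lemma dom_bounded C f : measurable_fun setT f -> (forall x, `|f x| <= C) -> dom f.
Proof. by move=> mf h; apply: (@dom_le C 0%N) => // x; rewrite expr0 mulr1. Qed.

Lemma domD f g : dom f -> dom g -> dom (fun x => f x + g x).
Proof.
case: W => mw w1 _ [mf [C [J [C0 hf]]]] [mg [C' [J' [C0' hg]]]].
apply: (@dom_le (C + C') (J + J')%N); first exact: measurable_funD.
move=> x; rewrite (le_trans (ler_normD _ _))// mulrDl lerD//.
  by rewrite (le_trans (hf x))// ler_wpM2l// ler_weXn2l// leq_addr.
by rewrite (le_trans (hg x))// ler_wpM2l// ler_weXn2l// leq_addl.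
Qed.

Lemma domM f g : dom f -> dom g -> dom (fun x => f x * g x).
Proof.
case: W => mw w1 _ [mf [C [J [C0 hf]]]] [mg [C' [J' [C0' hg]]]].
apply: (@dom_le (C * C') (J + J')%N); first exact: measurable_funM.
move=> x; rewrite normrM exprD mulrACA ler_pM//.
Qed.

Lemma domZ c f : dom f -> dom (fun x => c * f x).
Proof. by apply: domM; exact: dom_cst. Qed.

Lemma domN f : dom f -> dom (fun x => - f x).
Proof.
move=> df; rewrite (_ : (fun x => - f x) = (fun x => (-1) * f x)); first exact: domZ.
by apply/funext => x; rewrite mulN1r.
Qed.

Lemma domB f g : dom f -> dom g -> dom (fun x => f x - g x).
Proof. by move=> df dg; apply: domD => //; exact: domN. Qed.

Lemma domX f J : dom f -> dom (fun x => f x ^+ J).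
Proof.
move=> df; elim: J => [|J IH].
  by rewrite (_ : (fun x => _) = cst 1); [exact: dom_cst|apply/funext => x; rewrite expr0].
rewrite (_ : (fun x => _) = fun x => f x * f x ^+ J); first exact: domM.
by apply/funext => x; rewrite exprS.
Qed.

Lemma dom_norm f : dom f -> dom (fun x => `|f x|).
Proof.
move=> [mf [C [J [C0 h]]]]; apply: (@dom_le C J) => [|x]; last by rewrite normr_id.
exact: measurableT_comp.
Qed.

Lemma dom_measurable f : dom f -> measurable_fun setT f.
Proof. by case. Qed.

Lemma ErD f g : dom f -> dom g ->
  \int[P]_x (f x + g x) = \int[P]_x f x + \int[P]_x g x.
Proof. by move=> df dg; rewrite RintegralD//; exact: dom_integrable. Qed.

Lemma ErB f g : dom f -> dom g ->
  \int[P]_x (f x - g x) = \int[P]_x f x - \int[P]_x g x.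
Proof. by move=> df dg; rewrite RintegralB//; exact: dom_integrable. Qed.

Lemma ErZ c f : dom f -> \int[P]_x (c * f x) = c * \int[P]_x f x.
Proof. by move=> df; rewrite RintegralZl//; exact: dom_integrable. Qed.

Lemma Er_cst c : \int[P]_x c = c.
Proof. by rewrite /Rintegral integral_cst//= probability_setT mule1. Qed.

Lemma Er_le f g : dom f -> dom g -> (forall x, f x <= g x) ->
  \int[P]_x f x <= \int[P]_x g x.
Proof. by move=> df dg h; apply: le_Rintegral => //; exact: dom_integrable. Qed.

Lemma Er_norm f : dom f -> `|\int[P]_x f x| <= \int[P]_x `|f x|.
Proof. by move=> df; apply: le_normr_Rintegral => //; exact: dom_integrable. Qed.

Lemma Er_EFin f : dom f -> (\int[P]_x (f x)%:E = (\int[P]_x f x)%:E)%E.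
Proof.
by move=> df; rewrite /Rintegral fineK// integrable_fin_num//; exact: dom_integrable.
Qed.

Lemma Er_norm_le f g : dom f -> dom g -> (forall x, `|f x| <= g x) ->
  `|\int[P]_x f x| <= \int[P]_x g x.
Proof.
move=> df dg h; apply: (le_trans (Er_norm df)); apply: Er_le => //; exact: dom_norm.
Qed.

End dominated.

(** * Expectations under N(0,1) and Stein's identity *)

Section normal_expectation.
Context {R : realType}.
Local Notation N := (@normal_prob R 0 1).

Definition expabs (x : R) : R := expR `|x|.

Lemma expabs_ge1 x : 1 <= expabs x.
Proof. by rewrite -expR0 ler_expR. Qed.

Lemma weight_expabs : weight N expabs.
Proof.
split; [by apply: measurableT_comp => //; exact: normr_measurable|exact: expabs_ge1|].
move=> J; have := normal_exp_abs_lty (J%:R : R).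
by under eq_integral do rewrite mulrC expRM_natr.
Qed.

Lemma le_abs_expabs x : 1 + `|x| <= expabs x.
Proof. exact: expR_ge1Dx. Qed.

Lemma expR_taylor1 (u : R) : `|expR u - 1 - u| <= u ^+ 2 * expR `|u|.
Proof.
have de (x : R) : is_derive x 1 expR (expR x) by exact: is_derive_expR.
have [c cu e] := mvt_any 0 u de.
have -> : expR u - 1 - u = (expR c - 1) * u.
  by move: e; rewrite add0r expR0 => ->; ring.
have [c' cu' e'] := mvt_any 0 c de.
move: e'; rewrite add0r expR0 => ->.
rewrite !subr0 in cu cu'.
have -> : `|expR c' * c * u| = (`|c| * `|u|) * expR c'.
  by rewrite !normrM ger0_norm ?expR_ge0// -mulrA mulrC.
rewrite -[u ^+ 2]real_normK ?num_real// expr2.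
rewrite ler_pM ?mulr_ge0 ?expR_ge0//; first by rewrite ler_wpM2r.
by rewrite ler_expR (le_trans (ler_norm _))// (le_trans cu').
Qed.

(** For [|a| <= 1] the exponent u is at most [|a| * (1 + |y|)] in absolute value, so the remainder
    of [expR_taylor1] is of order [a ^+ 2]. The summand 1 of the constant accounts for the term
    [a ^+ 2 / 2] of u. *)
Lemma gauss_tilt_taylor (a y : R) : `|a| <= 1 ->
  `|expR (a * y - a ^+ 2 / 2) - 1 - a * y| <= (expR 1 + 1) * (a ^+ 2 * expabs y ^+ 3).
Proof.
move=> a1; set u := a * y - a ^+ 2 / 2.
have -> : expR u - 1 - a * y = (expR u - 1 - u) - a ^+ 2 / 2 by rewrite /u; ring.
have na : a ^+ 2 = `|a| ^+ 2 by rewrite real_normK ?num_real.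
have u1 : `|u| <= `|a| * (1 + `|y|).
  rewrite (le_trans (ler_normB _ _))// normrM mulrDr mulr1 addrC lerD2r.
  rewrite ger0_norm ?divr_ge0 ?sqr_ge0// na; have := normr_ge0 a; nra.
have u2 : `|u| <= 1 + `|y|.
  by rewrite (le_trans u1)// -[leRHS]mul1r ler_wpM2r// addr_ge0.
have w0 : 0 <= expabs y by rewrite (le_trans ler01) ?expabs_ge1.
have h1 : u ^+ 2 <= a ^+ 2 * expabs y ^+ 2.
  rewrite -[u ^+ 2]real_normK ?num_real// na -exprMn lerXn2r ?nnegrE//.
    by rewrite mulr_ge0.
  by rewrite (le_trans u1)// ler_wpM2l// le_abs_expabs.
have h2 : expR `|u| <= expR 1 * expabs y by rewrite /expabs -expRD ler_expR.
apply: (le_trans (ler_normB _ _)); rewrite mulrDl mul1r lerD//.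
  apply: (le_trans (expR_taylor1 u)).
  rewrite (_ : expR 1 * _ = (a ^+ 2 * expabs y ^+ 2) * (expR 1 * expabs y)); last ring.
  by rewrite ler_pM ?sqr_ge0 ?expR_ge0.
rewrite ger0_norm ?divr_ge0 ?sqr_ge0// ler_pM ?sqr_ge0//.
by apply: (@le_trans _ _ 1); [lra|rewrite exprn_ege1// expabs_ge1].
Qed.

Lemma measurable_tilt (a : R) : measurable_fun setT (fun y : R => expR (a * y - a ^+ 2 / 2)).
Proof.
apply: measurableT_comp => //; apply: measurable_funB => //; exact: measurable_funM.
Qed.

Lemma dom_id : dom expabs (fun y : R => y).
Proof.
apply: (dom_le weight_expabs (C := 1) (J := 1%N)) => // x.
by rewrite mul1r expr1 (le_trans _ (le_abs_expabs x))// lerDr.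
Qed.

Lemma dom_tilt (a : R) : dom expabs (fun y : R => expR (a * y - a ^+ 2 / 2)).
Proof.
apply: (dom_le weight_expabs (C := 1) (J := Num.bound `|a|)); first exact: measurable_tilt.
move=> x; rewrite mul1r ger0_norm ?expR_ge0// /expabs -expRM_natl ler_expR.
rewrite lerBlDr (le_trans (ler_norm _))// normrM.
apply: (@le_trans _ _ ((Num.bound `|a|)%:R * `|x|)).
  by rewrite ler_wpM2r// ltW// archi_boundP.
by rewrite lerDl divr_ge0// sqr_ge0.
Qed.

Lemma dom_shift (k : R -> R) (a : R) : dom expabs k -> dom expabs (fun y => k (y + a)).
Proof.
move=> [mk [C [J [C0 h]]]].
apply: (dom_le weight_expabs (C := C * expabs a ^+ J) (J := J)).
  by apply: (measurableT_comp mk); exact: measurable_funD.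
move=> x; apply: (le_trans (h _)); rewrite -mulrA -exprMn ler_wpM2l//.
have w0 y : 0 <= expabs y by rewrite (le_trans ler01) ?expabs_ge1.
rewrite lerXn2r ?nnegrE// ?mulr_ge0// /expabs -expRD ler_expR addrC.
by rewrite (le_trans (ler_normD _ _)).
Qed.

(** The formula for nonnegative functions is applied to [|k|] and to [|k| + k], and the results are
    subtracted. *)
Lemma normal_shift_real (k : R -> R) (a : R) : dom expabs k ->
  \int[N]_y k (y + a) = \int[N]_y (k y * expR (a * y - a ^+ 2 / 2)).
Proof.
move=> dk; have W := weight_expabs.
have ge0 (k' : R -> R) : dom expabs k' -> (forall y, 0 <= k' y) ->
    \int[N]_y k' (y + a) = \int[N]_y (k' y * expR (a * y - a ^+ 2 / 2)).
  move=> dk' k0; rewrite /Rintegral; congr fine.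
  rewrite (@ge0_normal_shift _ (EFin \o k'))//.
  by apply/measurable_EFinP; exact: dom_measurable dk'.
have dn := dom_norm W dk.
have e1 := ge0 _ dn (fun _ => normr_ge0 _).
have e2 := ge0 _ (domD W dn dk) (fun y => ltac:(by have := ler_norm (- k y); rewrite normrN; lra)).
move: e2; rewrite (ErD W (f := fun y => `|k (y + a)|) (g := fun y => k (y + a)));
  [|exact: dom_shift dn|exact: dom_shift dk].
have dt := dom_tilt a.
under [in RHS]eq_Rintegral do rewrite mulrDl.
rewrite (ErD W (domM W dn dt) (domM W dk dt)) e1.
by move/addrI.
Qed.

(** Stands for dividing by a and letting a tend to 0 in a first-order comparison. *)
Lemma le_quadratic_eq0 (x C : R) :
  (forall a, 0 < a -> a <= 1 -> a * `|x| <= C * a ^+ 2) -> x = 0.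
Proof.
move=> h; apply/eqP; rewrite -normr_le0 leNgt; apply/negP => x0.
have C0 : 0 < C by have := h 1 ltr01 (lexx _); rewrite mul1r expr1n mulr1; exact: lt_le_trans.
(* For this a, the hypothesis would give [|x| <= C * a <= |x| / 2]. *)
pose a := Num.min 1 (`|x| / (2 * C)).
have a0 : 0 < a by rewrite lt_min ltr01 divr_gt0// mulr_gt0.
have a1 : a <= 1 by rewrite ge_min lexx.
have := h a a0 a1; rewrite expr2 mulrCA ler_pM2l// => h2.
have : a <= `|x| / (2 * C) by rewrite ge_min lexx orbT.
by rewrite ler_pdivlMr ?mulr_gt0//; nra.
Qed.

(* Compare k(y + a) with k(y) exp(a y - a^2/2) to first order in a. *)
Lemma stein (k k' : R -> R) (C : R) (J : nat) : dom expabs k -> dom expabs k' ->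
  (forall a y, `|a| <= 1 -> `|k (y + a) - k y - a * k' y| <= C * a ^+ 2 * expabs y ^+ J) ->
  \int[N]_y (y * k y) = \int[N]_y k' y.
Proof.
move=> dk dk' h; have W := weight_expabs.
have dyk := domM W dom_id dk.
apply/eqP; rewrite -subr_eq0; apply/eqP.
have dnk := dom_norm W dk.
pose C1 := C * \int[N]_y (expabs y ^+ J).
pose C2 := (expR 1 + 1) * \int[N]_y (`|k y| * expabs y ^+ 3).
apply: (@le_quadratic_eq0 _ (C1 + C2)) => a a0 a1.
have na1 : `|a| <= 1 by rewrite gtr0_norm.
have e := normal_shift_real a dk.
have ds := dom_shift a dk.
have dt := dom_tilt a.
have b1 : `|\int[N]_y (k (y + a) - k y - a * k' y)| <= C1 * a ^+ 2.
  rewrite /C1 [leRHS]mulrAC -(ErZ W)//; last exact: (domX W _ (dom_w W)).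
  apply: (Er_norm_le W) => //.
  - by apply: (domB W) => //; [exact: (domB W)|exact: (domZ W)].
  - by apply: (domZ W) => //; exact: (domX W _ (dom_w W)).
  - by move=> y; exact: h.
have b2 : `|\int[N]_y (k y * expR (a * y - a ^+ 2 / 2) - k y - a * (y * k y))| <= C2 * a ^+ 2.
  rewrite /C2 [leRHS]mulrAC -(ErZ W)//; last first.
    by apply: (domM W) => //; exact: (domX W _ (dom_w W)).
  apply: (Er_norm_le W) => //.
  - by apply: (domB W) => //; [apply: (domB W) => //; exact: (domM W)|exact: (domZ W)].
  - by apply: (domZ W) => //; apply: (domM W) => //; exact: (domX W _ (dom_w W)).
  - move=> y.
    rewrite (_ : _ - _ = k y * (expR (a * y - a ^+ 2 / 2) - 1 - a * y)); last ring.
    rewrite normrM mulrCA ler_wpM2l//.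
    by apply: (le_trans (gauss_tilt_taylor y na1)); rewrite mulrA.
move: b1 b2.
rewrite !(ErB W)//; try by [exact: (domB W)|exact: (domM W)|exact: (domZ W)|apply: (domB W) => //; exact: (domM W)].
rewrite !(ErZ W)// e.
set X := \int[N]_y (k y * _); set X0 := \int[N]_y k y.
set A := \int[N]_y k' y; set B := \int[N]_y (y * k y).
move=> b1 b2; rewrite mulrDl.
have -> : a * `|B - A| = `|(X - X0 - a * A) - (X - X0 - a * B)|.
  by rewrite -[in LHS](gtr0_norm a0) -normrM; congr `|_|; ring.
by rewrite (le_trans (ler_normB _ _))// lerD.
Qed.

Lemma normal_mean0 : \int[N]_y y = 0.
Proof.
have := @stein (cst 1) (cst 0) 0 0 (dom_cst weight_expabs _) (dom_cst weight_expabs _).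
under eq_Rintegral do rewrite mulr1.
move=> -> ; first by rewrite Er_cst.
by move=> a y _; rewrite /= mulr0 !subrr normr0 !mul0r.
Qed.

Lemma normal_var1 : \int[N]_y (y ^+ 2) = 1.
Proof.
have := @stein id (cst 1) 0 0 dom_id (dom_cst weight_expabs _).
under eq_Rintegral do rewrite -expr2.
move=> ->; first by rewrite Er_cst.
move=> a y _ /=; rewrite (_ : y + a - y - a * 1 = 0); last ring.
by rewrite normr0 !mul0r.
Qed.

(** The bound covers all [a >= 0] and not only small ones, because a will be e times the norm of an
    arbitrary vector. *)
Lemma tilt_L1 : exists2 C : R, 0 <= C & forall a, 0 <= a ->
  \int[N]_y `|expR (a * y - a ^+ 2 / 2) - 1 - a * y| <= C * a ^+ 2.
Proof.
have W := weight_expabs.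
have dw3 : dom expabs (fun y => expabs y ^+ 3) by exact: (domX W _ (dom_w W)).
have dn := dom_norm W dom_id.
pose A := \int[N]_y (expabs y ^+ 3); pose B := \int[N]_y `|y|.
have A0 : 0 <= A.
  by apply: Rintegral_ge0 => y _; rewrite exprn_ge0// (le_trans ler01) ?expabs_ge1.
have B0 : 0 <= B by exact: Rintegral_ge0.
have e0 : 0 <= expR (1 : R) by exact: expR_ge0.
(* The first summand is the second-order bound for [a <= 1]. For [a > 1] the three terms are
   estimated separately by [1 + 1 + a * B], which is at most [(2 + B) * a ^+ 2]. *)
exists ((expR 1 + 1) * A + 2 + B); first by rewrite !addr_ge0// mulr_ge0// addr_ge0.
move=> a a0.
have dt := dom_tilt a.
have day : dom expabs (fun y => a * y) by exact: (domZ W a dom_id).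
have dt1 : dom expabs (fun y => expR (a * y - a ^+ 2 / 2) - 1).
  exact: (domB W dt (dom_cst W 1)).
have dd := dom_norm W (domB W dt1 day).
have [a1|a1] := leP a 1.
  apply: (@le_trans _ _ ((expR 1 + 1) * A * a ^+ 2)); last first.
    by rewrite ler_wpM2r ?sqr_ge0// -addrA lerDl addr_ge0.
  rewrite -mulrA [A * _]mulrC -(ErZ W (a ^+ 2) dw3).
  have dz := domZ W (a ^+ 2) dw3.
  rewrite -(ErZ W _ dz); apply: (Er_le W dd (domZ W _ dz)) => y.
  by apply: gauss_tilt_taylor; rewrite ger0_norm.
have e1 : \int[N]_y expR (a * y - a ^+ 2 / 2) = 1.
  have := normal_shift_real a (dom_cst W 1).
  under [in X in _ = X -> _]eq_Rintegral do rewrite mul1r.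
  by move=> <-; exact: (Er_cst N).
have da := dom_norm W day.
have dt2 := domD W dt (dom_cst W 1).
apply: (@le_trans _ _ (\int[N]_y (expR (a * y - a ^+ 2 / 2) + 1 + `|a * y|))).
  apply: (Er_le W dd (domD W dt2 da)) => y.
  apply: (le_trans (ler_normB _ _)); rewrite lerD2r.
  by apply: (le_trans (ler_normB _ _)); rewrite normr1 ger0_norm// expR_ge0.
rewrite (ErD W dt2 da) (ErD W dt (dom_cst W 1)) (Er_cst N) e1.
under eq_Rintegral do rewrite normrM ger0_norm//.
rewrite (ErZ W a dn) -/B.
have : 0 <= (expR 1 + 1) * A by rewrite mulr_ge0// addr_ge0.
set X := (_ + _) * A => X0.
have h1 : 1 <= a ^+ 2 by rewrite exprn_ege1// ltW.
have h2 : a * B <= B * a ^+ 2 by rewrite mulrC ler_wpM2l// expr2 ler_peMr// ltW.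
have h3 : 0 <= X * a ^+ 2 by rewrite mulr_ge0// sqr_ge0.
by rewrite !mulrDl; lra.
Qed.

End normal_expectation.

(** * Functions of the quantile that are convex in the probability *)

Section gconvex.
Context {R : realType}.
Local Notation N := (@normal_prob R 0 1).

(* [H1] and [H2] play the roles of H' and H''.  Since
   (H o Phi^-1)'' o Phi = (H'' + y H') / phi^2, [gc_cvx] is the convexity of H o Phi^-1. *)
Record gconvex (C : R) (H H1 H2 : R -> R) : Prop := Gconvex {
  gc_m : measurable_fun setT H;
  gc_m1 : measurable_fun setT H1;
  gc_m2 : measurable_fun setT H2;
  gc_ge0 : forall y, 0 <= H y;
  gc_le : forall y, H y <= C;
  gc_1 : forall y, `|H1 y| <= C;
  gc_2 : forall y, `|H2 y| <= C;
  gc_t2 : forall y d,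
    `|H (y + d) - H y - H1 y * d - H2 y * d ^+ 2 / 2| <= C * `|d| ^+ 3;
  gc_t1 : forall y d, `|H1 (y + d) - H1 y - H2 y * d| <= C * d ^+ 2;
  gc_cvx : forall y, 0 <= H2 y + y * H1 y }.

Lemma gconvex_C0 C H H1 H2 : gconvex C H H1 H2 -> 0 <= C.
Proof. by move=> h; apply: le_trans (gc_ge0 h 0) (gc_le h 0). Qed.

Lemma gconvex_le C C' H H1 H2 : C <= C' -> gconvex C H H1 H2 -> gconvex C' H H1 H2.
Proof.
move=> CC' [? ? ? ? hl h1 h2 t2 t1 ?]; split => //.
- by move=> y; exact: le_trans CC'.
- by move=> y; exact: le_trans CC'.
- by move=> y; exact: le_trans CC'.
- by move=> y d; rewrite (le_trans (t2 y d))// ler_wpM2r// exprn_ge0.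
- by move=> y d; rewrite (le_trans (t1 y d))// ler_wpM2r// sqr_ge0.
Qed.

(* For a half-space eta and a partially revealed point x, let q = Phi^-1(Pr[eta | x]).
   Revealing more of x turns q into a variable distributed as
   sqrt(1 + b^2) q + b Z, where b depends on how much is revealed. *)
Definition ou (b : R) (k : R -> R) (q : R) : R :=
  \int[N]_z k (Num.sqrt (1 + b ^+ 2) * q + b * z).

Let W := @weight_expabs R.

Lemma measurable_affine (k : R -> R) (c b : R) : measurable_fun setT k ->
  measurable_fun setT (fun z => k (c + b * z)).
Proof.
by move=> mk; apply: (measurableT_comp mk); apply: measurable_funD => //; exact: measurable_funM.
Qed.

Lemma dom_affine (k : R -> R) (C c b : R) : measurable_fun setT k ->
  (forall y, `|k y| <= C) -> dom expabs (fun z => k (c + b * z)).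
Proof. by move=> mk h; apply: (dom_bounded W (C := C)) => //; exact: measurable_affine. Qed.

(** Adding C makes the integrand nonnegative, so that Tonelli's theorem yields measurability. *)
Lemma measurable_ou (b C : R) (k : R -> R) : measurable_fun setT k ->
  (forall y, `|k y| <= C) -> measurable_fun setT (ou b k).
Proof.
move=> mk h; pose k' y := k y + C.
have k0 y : 0 <= k' y by have := ler_norm (- k y); rewrite normrN /k'; have := h y; lra.
have mk' : measurable_fun setT k' by exact: measurable_funD.
have -> : ou b k = fun q => ou b k' q - C.
  apply/funext => q; rewrite /ou /k' (ErD W (dom_affine _ _ mk h) (dom_cst W C)).
  by rewrite (Er_cst N) addrK.
apply: measurable_funB => //.
apply: (measurableT_comp (f := fine)); first exact: fine_measurable.
have mG : measurable_fun setT
    (fun p : R * R => (k' (Num.sqrt (1 + b ^+ 2) * p.1 + b * p.2))%:E).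
  apply/measurable_EFinP/(measurableT_comp mk').
  by apply: measurable_funD; exact: measurable_funM.
apply: (@measurable_fun_fubini_tonelli_F _ _ _ _ _ N _ mG) => p.
by rewrite lee_fin.
Qed.

Lemma sqrt1b_ge1 (b : R) : 1 <= Num.sqrt (1 + b ^+ 2).
Proof. by rewrite -[leLHS]sqrtr1 ler_sqrt ?lerDl ?sqr_ge0// addr_ge0// sqr_ge0. Qed.

Lemma sqr_sqrt1b (b : R) : Num.sqrt (1 + b ^+ 2) ^+ 2 = 1 + b ^+ 2.
Proof. by rewrite sqr_sqrtr// addr_ge0// sqr_ge0. Qed.

(** Differentiating under the integral brings out a factor [a >= 1] for each order, whence [a ^+ 3]
    for the third-order remainder. Convexity survives because [gc_cvx] for the average is the
    average of [gc_cvx] for H. *)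
Lemma gconvex_ou C b H H1 H2 : gconvex C H H1 H2 ->
  let a := Num.sqrt (1 + b ^+ 2) in
  gconvex (C * a ^+ 3) (ou b H) (fun q => a * ou b H1 q) (fun q => a ^+ 2 * ou b H2 q).
Proof.
move=> h a; have C0 := gconvex_C0 h.
have a1 : 1 <= a by exact: sqrt1b_ge1.
have a0 : 0 <= a by rewrite (le_trans ler01).
have hH y : `|H y| <= C by rewrite ger0_norm ?(gc_ge0 h)// (gc_le h).
have [[mH mH1] mH2] := (gc_m h, gc_m1 h, gc_m2 h).
have CC k : (k <= 3)%N -> C * a ^+ k <= C * a ^+ 3.
  by move=> k3; rewrite ler_wpM2l// ler_weXn2l.
have D (k : R -> R) (q : R) : measurable_fun setT k -> (forall y, `|k y| <= C) ->
    dom expabs (fun z => k (a * q + b * z)) by move=> mk hk; exact: (dom_affine _ _ mk hk).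
have bd (k : R -> R) (q : R) : measurable_fun setT k -> (forall y, `|k y| <= C) -> `|ou b k q| <= C.
  move=> mk hk; rewrite -[leRHS](Er_cst N).
  by apply: (Er_norm_le W (D k q mk hk) (dom_cst W C)) => z; exact: hk.
split.
- exact: measurable_ou hH.
- by apply: measurable_funM => //; exact: measurable_ou (gc_1 h).
- by apply: measurable_funM => //; exact: measurable_ou (gc_2 h).
- by move=> q; apply: Rintegral_ge0 => z _; exact: gc_ge0 h _.
- move=> q; apply: (le_trans (ler_norm _)); apply: (le_trans (bd _ _ mH hH)).
  by have := CC 0%N isT; rewrite expr0 mulr1.
- move=> q; rewrite normrM ger0_norm// mulrC.
  apply: (@le_trans _ _ (C * a)); first by rewrite ler_wpM2r// bd//; exact: gc_1 h.
  exact: (CC 1%N).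
- move=> q; rewrite normrM ger0_norm ?sqr_ge0// mulrC.
  apply: (@le_trans _ _ (C * a ^+ 2)); last exact: CC.
  by rewrite ler_wpM2r ?sqr_ge0// bd//; exact: gc_2 h.
- move=> q d.
  pose F z := H (a * q + b * z + a * d) - H (a * q + b * z)
    - H1 (a * q + b * z) * (a * d) - H2 (a * q + b * z) * (a * d) ^+ 2 / 2.
  have -> : ou b H (q + d) - ou b H q - a * ou b H1 q * d - a ^+ 2 * ou b H2 q * d ^+ 2 / 2
      = \int[N]_z F z.
    rewrite /F.
    have E1 := D H (q + d) mH hH.
    have e z : a * (q + d) + b * z = a * q + b * z + a * d by ring.
    have E1' : dom expabs (fun z => H (a * q + b * z + a * d)).
      by rewrite (_ : (fun z => _) = fun z => H (a * (q + d) + b * z))//;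
        apply/funext => z; rewrite e.
    have E0 := D H q mH hH.
    have E2 := D H1 q mH1 (gc_1 h); have E3 := D H2 q mH2 (gc_2 h).
    have F2 : dom expabs (fun z => H1 (a * q + b * z) * (a * d)) by exact: (domM W E2 (dom_cst W _)).
    have F3 : dom expabs (fun z => H2 (a * q + b * z) * (a * d) ^+ 2 / 2).
      by apply: (domM W _ (dom_cst W _)); exact: (domM W E3 (dom_cst W _)).
    have F12 := domB W (domB W E1' E0) F2.
    rewrite (ErB W F12 F3) (ErB W (domB W E1' E0) F2) (ErB W E1' E0).
    have -> : \int[N]_z (H1 (a * q + b * z) * (a * d)) = a * ou b H1 q * d.
      by under eq_Rintegral do rewrite mulrC; rewrite (ErZ W _ E2) -/(ou b H1 q); ring.
    have -> : \int[N]_z (H2 (a * q + b * z) * (a * d) ^+ 2 / 2) = a ^+ 2 * ou b H2 q * d ^+ 2 / 2.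
      under eq_Rintegral do rewrite -mulrA mulrC.
      by rewrite (ErZ W _ E3) -/(ou b H2 q); field.
    congr (_ - _ - _ - _); rewrite /ou -/a; apply: eq_Rintegral => z _; congr (H _).
    exact: e.
  rewrite -[leRHS](_ : C * `|a * d| ^+ 3 = _); last by rewrite normrM ger0_norm// exprMn mulrA.
  have mF : measurable_fun setT F.
    have m (c : R) (k : R -> R) : measurable_fun setT k -> measurable_fun setT (fun z => k (c + b * z)).
      exact: measurable_affine.
    rewrite /F; apply: measurable_funB; [apply: measurable_funB; [apply: measurable_funB|]|].
    + rewrite (_ : (fun z => _) = fun z => H ((a * q + a * d) + b * z)); first exact: m.
      by apply/funext => z; congr (H _); ring.
    + exact: m.
    + by apply: measurable_funM => //; exact: m.
    + by apply: measurable_funM => //; apply: measurable_funM => //; exact: m.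
  rewrite -[leRHS](Er_cst N); apply: (Er_norm_le W _ (dom_cst W _)).
    by apply: (dom_bounded W (C := C * `|a * d| ^+ 3)) => // z; exact: (gc_t2 h).
  by move=> z; exact: (gc_t2 h).
- move=> q d.
  pose F z := H1 (a * q + b * z + a * d) - H1 (a * q + b * z) - H2 (a * q + b * z) * (a * d).
  have -> : a * ou b H1 (q + d) - a * ou b H1 q - a ^+ 2 * ou b H2 q * d = a * \int[N]_z F z.
    rewrite /F.
    have e z : a * (q + d) + b * z = a * q + b * z + a * d by ring.
    have E1 := D H1 (q + d) mH1 (gc_1 h).
    have E1' : dom expabs (fun z => H1 (a * q + b * z + a * d)).
      by rewrite (_ : (fun z => _) = fun z => H1 (a * (q + d) + b * z))//;
        apply/funext => z; rewrite e.
    have E2 := D H1 q mH1 (gc_1 h); have E3 := D H2 q mH2 (gc_2 h).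
    have F3 : dom expabs (fun z => H2 (a * q + b * z) * (a * d)).
      exact: (domM W E3 (dom_cst W _)).
    rewrite (ErB W (domB W E1' E2) F3) (ErB W E1' E2).
    have -> : \int[N]_z (H2 (a * q + b * z) * (a * d)) = a * ou b H2 q * d.
      by under eq_Rintegral do rewrite mulrC; rewrite (ErZ W _ E3) -/(ou b H2 q); ring.
    have -> : \int[N]_z H1 (a * q + b * z + a * d) = ou b H1 (q + d).
      by rewrite /ou -/a; apply: eq_Rintegral => z _; congr (H1 _); rewrite e.
    by rewrite -/(ou b H1 q); ring.
  rewrite normrM ger0_norm//.
  rewrite -[leRHS](_ : a * (C * (a * d) ^+ 2) = _); last by ring.
  rewrite ler_wpM2l//.
  have mF : measurable_fun setT F.
    have m (c : R) (k : R -> R) : measurable_fun setT k -> measurable_fun setT (fun z => k (c + b * z)).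
      exact: measurable_affine.
    rewrite /F; apply: measurable_funB; [apply: measurable_funB|].
    + rewrite (_ : (fun z => _) = fun z => H1 ((a * q + a * d) + b * z)); first exact: m.
      by apply/funext => z; congr (H1 _); ring.
    + exact: m.
    + by apply: measurable_funM => //; exact: m.
  rewrite -[leRHS](Er_cst N); apply: (Er_norm_le W _ (dom_cst W _)).
    by apply: (dom_bounded W (C := C * (a * d) ^+ 2)) => // z; exact: (gc_t1 h).
  by move=> z; exact: (gc_t1 h).
- move=> q.
  have E2 := D H1 q mH1 (gc_1 h); have E3 := D H2 q mH2 (gc_2 h).
  (* Stein's identity in z. With [y = a * q + b * z], it turns the mean of [H2 y + y * H1 y] into
     [(1 + b ^+ 2) * ou b H2 q + q * a * ou b H1 q], and [1 + b ^+ 2 = a ^+ 2]. *)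
  have st : \int[N]_z (z * H1 (a * q + b * z)) = b * ou b H2 q.
    rewrite /ou -/a -(ErZ W _ E3).
    apply: (@stein _ _ _ (C * b ^+ 2) 0%N) => //; first exact: (domZ W).
    move=> t y _; rewrite expr0 mulr1 -mulrA -exprMn.
    have := gc_t1 h (a * q + b * y) (b * t).
    by congr (`| _ - _ - _| <= _); [congr (H1 _); ring|ring].
  rewrite (_ : _ + _ = \int[N]_z (H2 (a * q + b * z) + (a * q + b * z) * H1 (a * q + b * z))).
    by apply: Rintegral_ge0 => z _; exact: (gc_cvx h).
  have dz := domM W (@dom_id R) E2.
  transitivity (\int[N]_z (H2 (a * q + b * z) + (a * q) * H1 (a * q + b * z)
      + b * (z * H1 (a * q + b * z)))); last first.
    by apply: eq_Rintegral => z _; ring.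
  have Eq := domZ W (a * q) E2.
  rewrite (ErD W (domD W E3 Eq) (domZ W b dz)) (ErD W E3 Eq) (ErZ W _ E2) (ErZ W _ dz) st.
  rewrite -/(ou b H2 q) -/(ou b H1 q).
  have := sqr_sqrt1b b; rewrite -/a => ->; ring.
Qed.

End gconvex.

(** * The averages [ou] under composition, and their fixed function *)

Section ou_semigroup.
Context {R : realType}.
Local Notation N := (@normal_prob R 0 1).
Let W := @weight_expabs R.

Lemma ou_EFin (k : R -> R) (C b q : R) : measurable_fun setT k ->
  (forall y, `|k y| <= C) ->
  (\int[N]_z (k (Num.sqrt (1 + b ^+ 2) * q + b * z))%:E = (ou b k q)%:E)%E.
Proof. by move=> mk hk; rewrite (Er_EFin W)//; exact: dom_affine hk. Qed.

(** The two independent noises have total variance [(1 + b ^+ 2) * e ^+ 2 + b ^+ 2], which is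
    [b' ^+ 2]. *)
Lemma ou_ou (k : R -> R) (C b e b' q : R) : measurable_fun setT k ->
  (forall y, 0 <= k y) -> (forall y, k y <= C) ->
  0 <= b' -> 1 + b' ^+ 2 = (1 + e ^+ 2) * (1 + b ^+ 2) ->
  ou e (ou b k) q = ou b' k q.
Proof.
move=> mk k0 kC b'0 b'E.
have hk y : `|k y| <= C by rewrite ger0_norm.
rewrite /ou [LHS]/Rintegral [RHS]/Rintegral; congr fine.
under eq_integral => y _.
  rewrite -/(ou b k _) -(ou_EFin _ _ mk hk) mulrDr mulrA -sqrtrM ?addr_ge0 ?sqr_ge0//.
  rewrite [(1 + b ^+ 2) * _]mulrC -b'E.
  under eq_integral => z _ do rewrite -addrA (mulrA _ e y).
  over.
set g := fun s => (k (Num.sqrt (1 + b' ^+ 2) * q + s))%:E.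
have mg : measurable_fun setT g.
  by apply/measurable_EFinP/(measurableT_comp mk); exact: measurable_funD.
have g0 y : (0 <= g y)%E by rewrite lee_fin.
rewrite (ge0_normal_comb (Num.sqrt (1 + b ^+ 2) * e) b mg g0).
apply: eq_integral => y _; rewrite /g; congr (k (_ + _ * _))%:E.
rewrite exprMn sqr_sqrt1b (_ : _ + _ = b' ^+ 2) ?sqrtr_sqr ?ger0_norm//.
by rewrite -[RHS](addKr 1) b'E; ring.
Qed.

(** Let a be the square root of [1 + b ^+ 2]. Then [Gcdf (a * q + b * x)] is the probability that
    [z - b * x <= a * q], and [z - b * x] is distributed as [a * y]. In other words, the conditional
    probability of a half-space is a martingale. *)
Lemma ou_Gcdf (b q : R) : ou b Gcdf q = Gcdf q.
Proof.
pose g s : \bar R := (\1_(`]-oo, Num.sqrt (1 + b ^+ 2) * q]%classic) s)%:E.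
have mg : measurable_fun setT g by exact/measurable_EFinP/measurable_indic.
have g0 y : (0 <= g y)%E by rewrite lee_fin.
have a0 : 0 < Num.sqrt (1 + b ^+ 2) by rewrite (lt_le_trans ltr01)// sqrt1b_ge1.
have := ge0_normal_comb (- b) 1 mg g0.
rewrite sqrrN expr1n addrC.
have -> : (\int[N]_y g (Num.sqrt (1 + b ^+ 2) * y)%R = (Gcdf q)%:E)%E.
  rewrite -Gcdf_EFin -[RHS](_ : (\int[N]_y (\1_(`]-oo, q]%classic) y)%:E)%E = _); last first.
    by rewrite integral_indic// setIT.
  apply: eq_integral => y _; rewrite /g !indicE; congr ((_ : bool)%:R)%:E.
  by apply/idP/idP; rewrite !inE/= !in_itv/= ler_pM2l.
have -> : (\int[N]_x \int[N]_z g (- b * x + 1 * z)%R = (ou b Gcdf q)%:E)%E.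
  rewrite -(@ou_EFin _ 1); last 2 first.
  - exact: measurable_Gcdf.
  - by move=> y; rewrite ger0_norm ?Gcdf_ge0// ltW// Gcdf_lt1.
  apply: eq_integral => x _; rewrite -Gcdf_EFin.
  rewrite -[RHS](_ : (\int[N]_y (\1_(`]-oo, (Num.sqrt (1 + b ^+ 2) * q + b * x)%R]%classic) y)%:E)%E = _); last first.
    by rewrite integral_indic// setIT.
  apply: eq_integral => y _; rewrite /g !indicE; congr ((_ : bool)%:R)%:E.
  by apply/idP/idP; rewrite !inE/= !in_itv/= mul1r mulNr [- _ + y]addrC lerBlDr.
by move=> h; apply: EFin_inj; exact: h.
Qed.

End ou_semigroup.

(** * Local expansions with explicit constants *)

Section expand.
Context {R : realType}.

Lemma lip_of_derive (f f1 : R -> R) (C : R) :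
  (forall x : R, is_derive x 1 f (f1 x)) -> (forall x, `|f1 x| <= C) ->
  forall x y, `|f y - f x| <= C * `|y - x|.
Proof.
move=> df h x y; have [c _ e] := mvt_any x (y - x) df.
have -> : f y - f x = f1 c * (y - x) by rewrite -e; congr (f _ - _); ring.
by rewrite normrM ler_wpM2r.
Qed.

Lemma is_derive_nphi1 (x : R) :
  is_derive x 1 (fun x : R => - x * nphi x) ((x ^+ 2 - 1) * nphi x).
Proof.
have h := is_derive_nphi x.
have h1 : is_derive x 1 (fun x : R => - x) (- 1) by apply: is_derive_eq.
apply: is_derive_eq; rewrite /GRing.scale/=; ring.
Qed.

(** The 3 bounds the third derivative [(x ^+ 2 - 1) * nphi x], through [x ^+ 2 * nphi x <= 2] and
    [nphi x <= 1]. *)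
Lemma Gcdf_taylor2 (x d : R) :
  `|Gcdf (x + d) - Gcdf x - nphi x * d + x * nphi x * d ^+ 2 / 2| <= 3 * `|d| ^+ 3.
Proof.
have l y z : `|(- z * nphi z) - (- y * nphi y) : R| <= 3 * `|z - y|.
  apply: (lip_of_derive is_derive_nphi1) => {}y.
  rewrite mulrBl mul1r (le_trans (ler_normB _ _))//.
  have := nphi_sqr_le2 y; have := nphi_le1 y; have := nphi_ge0 y => h0 h1 h2.
  by rewrite [`|y ^+ 2 * _|]ger0_norm ?(mulr_ge0 (sqr_ge0 _))// ger0_norm//; lra.
have := taylor2 x d is_derive_Gcdf is_derive_nphi l.
by congr (`|_| <= _); field.
Qed.

Lemma Gcdf_taylor1 (x d : R) :
  `|Gcdf (x + d) - Gcdf x - nphi x * d| <= d ^+ 2.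
Proof.
rewrite -[leRHS]mul1r; apply: (@taylor1 R Gcdf nphi).
  exact: is_derive_Gcdf.
apply: (lip_of_derive is_derive_nphi) => y.
by rewrite normrM normrN [`|nphi y|]ger0_norm ?nphi_ge0// nphi_abs_le1.
Qed.

Lemma nphi_ge (K q : R) : `|q| <= K -> nphi K <= nphi q.
Proof.
move=> qK; rewrite !nphiE ler_wpM2l ?normal_peak_ge0// ler_expR.
rewrite ler_wpM2r ?invr_ge0// lerN2 -[q ^+ 2]real_normK ?num_real//.
by rewrite lerXn2r// nnegrE// (le_trans _ qK).
Qed.

(* Subtracting the right multiple of Phi removes the linear term, and leaves half
   the quantity of [gc_cvx] as the quadratic coefficient. *)
Lemma gconvex_expand (C K : R) G G1 G2 (q : R) : gconvex C G G1 G2 -> `|q| <= K ->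
  forall y, `|G y - G q - G1 q / nphi q * (Gcdf y - Gcdf q)
     - (G2 q + q * G1 q) / 2 * (y - q) ^+ 2|
    <= (C + C / nphi K * 3) * `|y - q| ^+ 3.
Proof.
move=> h qK y; have C0 := gconvex_C0 h.
pose d := y - q; have yE : y = q + d by rewrite /d; ring.
rewrite {1 2}yE -/d.
have q0 := nphi_gt0 q.
pose A := G (q + d) - G q - G1 q * d - G2 q * d ^+ 2 / 2.
pose B := Gcdf (q + d) - Gcdf q - nphi q * d + q * nphi q * d ^+ 2 / 2.
have -> : G (q + d) - G q - G1 q / nphi q * (Gcdf (q + d) - Gcdf q)
     - (G2 q + q * G1 q) / 2 * d ^+ 2 = A - G1 q / nphi q * B.
  by rewrite /A /B; field; rewrite gt_eqF.
rewrite (le_trans (ler_normB _ _))// mulrDl lerD//; first exact: gc_t2 h _ _.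
rewrite normrM -mulrA ler_pM//; last exact: Gcdf_taylor2.
rewrite normrM normfV [`|nphi q|]gtr0_norm// ler_pM ?invr_ge0//.
- exact/ltW.
- exact: gc_1 h _.
by rewrite lef_pV2 ?posrE ?nphi_gt0//; exact: nphi_ge.
Qed.

End expand.

Section gconvex_psi.
Context {R : realType}.

(** The terms in [p1] cancel in [H2 y + y * H1 y], which leaves [p2 (Gcdf y) * nphi y ^+ 2]:
    convexity of p is what [gc_cvx] asks for. *)
Lemma gconvex_psi (M : R) (p p1 p2 p3 : R -> R) :
  (forall t : R, 0 < t < 1 -> is_derive t 1 p (p1 t)) ->
  (forall t : R, 0 < t < 1 -> is_derive t 1 p1 (p2 t)) ->
  (forall t : R, 0 < t < 1 -> is_derive t 1 p2 (p3 t)) ->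
  (forall t, 0 < t < 1 -> 0 <= p t <= M) ->
  (forall t, 0 < t < 1 -> `|p1 t| <= M) ->
  (forall t, 0 < t < 1 -> 0 <= p2 t <= M) ->
  (forall t, 0 < t < 1 -> `|p3 t| <= M) ->
  gconvex (7 * M) (p \o Gcdf) (fun y => p1 (Gcdf y) * nphi y)
    (fun y => p2 (Gcdf y) * nphi y ^+ 2 - y * nphi y * p1 (Gcdf y)).
Proof.
move=> d1 d2 d3 b0 b1 b2 b3.
have G01 y : 0 < @Gcdf R y < 1 by rewrite Gcdf_gt0 Gcdf_lt1.
have M0 : 0 <= M by have /andP[] := b0 _ (G01 0); exact: le_trans.
have c (f f1 : R -> R) (y : R) : is_derive (Gcdf y) 1 f (f1 (Gcdf y)) ->
    is_derive y 1 (fun y => f (Gcdf y)) (f1 (Gcdf y) * nphi y).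
  by move=> df; have dG := is_derive_Gcdf y; exact: is_derive1_comp.
pose H1 y : R := p1 (Gcdf y) * nphi y.
pose H2 y : R := p2 (Gcdf y) * nphi y ^+ 2 - y * nphi y * p1 (Gcdf y).
(* The derivative of [H2]. Its three summands are at most [M], [3 * M] and [3 * M], whence the 7. *)
pose H3 y : R := p3 (Gcdf y) * nphi y ^+ 3 - 3 * (p2 (Gcdf y) * nphi y * (y * nphi y))
   + (y ^+ 2 * nphi y - nphi y) * p1 (Gcdf y).
have D1 (y : R) : is_derive y 1 (p \o Gcdf) (H1 y) by exact/c/d1.
have D2 (y : R) : is_derive y 1 H1 (H2 y).
  have e1 := c _ _ y (d2 _ (G01 y)); have e2 := is_derive_nphi y.
  by apply: is_derive_eq; rewrite /GRing.scale/= /H2; ring.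
have D3 (y : R) : is_derive y 1 H2 (H3 y).
  have e1 := c _ _ y (d2 _ (G01 y)); have e2 := is_derive_nphi y.
  have e3 := c _ _ y (d3 _ (G01 y)).
  by apply: is_derive_eq; rewrite /GRing.scale/= /H3; ring.
have n0 y : 0 <= @nphi R y by exact: nphi_ge0.
have n1 y : @nphi R y <= 1 by exact: nphi_le1.
have nk y k : @nphi R y ^+ k <= 1 by rewrite exprn_ile1.
have B1 y : `|H1 y| <= M.
  by rewrite normrM -[leRHS]mulr1 ler_pM// ?b1// ger0_norm.
have yn y : `|y * @nphi R y| <= 1 by rewrite normrM [`|nphi y|]ger0_norm// nphi_abs_le1.
have B2' y : `|p2 (Gcdf y)| <= M by have /andP[? ?] := b2 _ (G01 y); rewrite ger0_norm.
have B2 y : `|H2 y| <= 2 * M.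
  rewrite (le_trans (ler_normB _ _))// mulrDl mul1r lerD//.
    by rewrite normrM -[leRHS]mulr1 ler_pM// ger0_norm ?exprn_ge0.
  by rewrite normrM -[leRHS]mul1r ler_pM// b1.
have B3 y : `|H3 y| <= 7 * M.
  rewrite (_ : 7 * M = M + 3 * M + 3 * M); last by ring.
  apply: (le_trans (ler_normD _ _)); apply: lerD.
    apply: (le_trans (ler_normB _ _)); apply: lerD.
      by rewrite normrM -[leRHS]mulr1 ler_pM// ?b3// ger0_norm ?exprn_ge0.
    rewrite normrM ger0_norm// ler_wpM2l// normrM -[leRHS]mulr1 ler_pM//.
    by rewrite normrM -[leRHS]mulr1 ler_pM// ger0_norm.
  rewrite normrM ler_pM// ?b1//.
  apply: (le_trans (ler_normB _ _)).
  by rewrite [`|y ^+ 2 * _|]ger0_norm ?(mulr_ge0 (sqr_ge0 _))// ger0_norm//;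
    have := nphi_sqr_le2 y; have := n1 y; lra.
have cont (f f1 : R -> R) : (forall y : R, is_derive y 1 f (f1 y)) -> measurable_fun setT f.
  by move=> df; apply: continuous_measurable_fun; exact: is_derive_continuous df.
have M7 : M <= 7 * M by rewrite ler_peMl//; lra.
split.
- exact: cont D1.
- exact: cont D2.
- exact: cont D3.
- by move=> y; have /andP[] := b0 _ (G01 y).
- by move=> y; have /andP[_ h] := b0 _ (G01 y); exact: le_trans h M7.
- by move=> y; exact: le_trans (B1 y) M7.
- by move=> y; apply: (le_trans (B2 y)); rewrite ler_wpM2r//; lra.
- by move=> y d; exact: (taylor2 y d D1 D2 (lip_of_derive D3 B3)).
- by move=> y d; exact: (taylor1 y d D2 (lip_of_derive D3 B3)).
- move=> y; have : 0 <= p2 (Gcdf y) * nphi y ^+ 2.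
    by rewrite mulr_ge0 ?exprn_ge0//; have /andP[] := b2 _ (G01 y).
  by congr (_ <= _); ring.
Qed.

End gconvex_psi.

(** * The effect of a small noise on a function on R^n *)

Section gaussian_expectation.
Context {R : realType} {n : nat} (gam : probability (n.-tuple R) R).
Hypothesis gamE : is_std_gaussian gam.
Local Notation N := (@normal_prob R 0 1).
Implicit Types (x z a c : n.-tuple R).

Definition expl1 (x : n.-tuple R) : R := expR (l1 x).

Lemma l1_ge0 x : 0 <= l1 x.
Proof. by apply: sumr_ge0. Qed.

Lemma expl1_ge1 x : 1 <= expl1 x.
Proof. by rewrite -expR0 ler_expR l1_ge0. Qed.

Lemma weight_expl1 : weight gam expl1.
Proof.
split; [by apply: measurableT_comp => //; exact: measurable_l1|exact: expl1_ge1|].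
move=> J; have := std_gaussian_exp_l1_lty (J%:R : R) gamE.
by under eq_integral do rewrite mulrC expRM_natr.
Qed.

Let W := weight_expl1.

Lemma le_l1_expl1 x : l1 x <= expl1 x.
Proof. by apply: le_trans (expR_ge1Dx _); rewrite lerDr. Qed.

Lemma abs_tnth_le_l1 x i : `|tnth x i| <= l1 x.
Proof. by rewrite /l1 (bigD1 i)//= lerDl sumr_ge0. Qed.

Lemma abs_vdot_le a x : `|vdot a x| <= l1 a * l1 x.
Proof.
rewrite /vdot (le_trans (ler_norm_sum _ _ _))// {1}/l1 mulr_suml ler_sum// => i _.
by rewrite normrM ler_wpM2l// abs_tnth_le_l1.
Qed.

Lemma dom_vdot a : dom expl1 (vdot a).
Proof.
apply: (dom_le W (C := l1 a) (J := 1%N)); first exact: measurable_vdot.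
move=> x; rewrite expr1 (le_trans (abs_vdot_le _ _))// ler_wpM2l ?l1_ge0//.
exact: le_l1_expl1.
Qed.

(** Cameron-Martin density of the law of [vlin 1 e z x] with respect to that of z. *)
Definition tilt (e : R) x z := expR (e * vdot x z - e ^+ 2 * vdot x x / 2).

Lemma measurable_tiltn e x : measurable_fun setT (tilt e x).
Proof.
apply: measurableT_comp => //; apply: measurable_funB => //; apply: measurable_funM => //.
exact: measurable_vdot.
Qed.

Lemma dom_tiltn e x : dom expl1 (tilt e x).
Proof.
apply: (dom_le W (C := 1) (J := Num.bound (`|e| * l1 x))); first exact: measurable_tiltn.
move=> z; rewrite mul1r ger0_norm ?expR_ge0// /expl1 -expRM_natl ler_expR.
rewrite lerBlDr (le_trans (ler_norm _))// normrM.
apply: (@le_trans _ _ (`|e| * l1 x * l1 z)).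
  by rewrite -mulrA ler_wpM2l// abs_vdot_le.
apply: (@le_trans _ _ ((Num.bound (`|e| * l1 x))%:R * l1 z)).
  by rewrite ler_wpM2r ?l1_ge0// ltW// archi_boundP// mulr_ge0// l1_ge0.
by rewrite lerDl divr_ge0// mulr_ge0 ?sqr_ge0// vdot_ge0.
Qed.

Definition vnorm x : R := Num.sqrt (vdot x x).

Lemma vnorm_ge0 x : 0 <= vnorm x. Proof. exact: sqrtr_ge0. Qed.

Lemma sqr_vnorm x : vnorm x ^+ 2 = vdot x x.
Proof. by rewrite sqr_sqrtr// vdot_ge0. Qed.

Lemma marginal_real (k : R -> R) a : measurable_fun setT k -> (forall y, 0 <= k y) ->
  \int[gam]_x k (vdot a x) = \int[N]_y k (vnorm a * y).
Proof.
move=> mk k0; rewrite /Rintegral (ge0_std_gaussian_marginal (g := EFin \o k))//.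
exact/measurable_EFinP.
Qed.

Lemma integral_vdot_sqr a : \int[gam]_x (vdot a x ^+ 2) = vdot a a.
Proof.
rewrite (marginal_real (k := fun y => y ^+ 2)); last 2 first.
- exact: measurable_funX.
- by move=> y; exact: sqr_ge0.
under eq_Rintegral do rewrite exprMn.
rewrite (ErZ (@weight_expabs R)); last exact: (domX (@weight_expabs R) _ (@dom_id R)).
by rewrite normal_var1 mulr1 sqr_vnorm.
Qed.

(* The marginal formula is available for nonnegative integrands only, whence the
   detour through (y + 1)^2. *)
Lemma integral_vdot a : \int[gam]_x vdot a x = 0.
Proof.
have := @marginal_real (fun y => (y + 1) ^+ 2) a _ _.
rewrite (_ : \int[gam]_x _ = vdot a a + 2 * \int[gam]_x vdot a x + 1); last first.
  have da := dom_vdot a; have d2 := domX W 2 da; have dz := domZ W 2 da.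
  transitivity (\int[gam]_x (vdot a x ^+ 2 + 2 * vdot a x + 1)).
    by apply: eq_Rintegral => x _; ring.
  rewrite (ErD W (domD W d2 dz) (dom_cst W 1)) (ErD W d2 dz) (ErZ W 2 da).
  by rewrite (Er_cst gam) integral_vdot_sqr.
rewrite (_ : \int[N]_x _ = vnorm a ^+ 2 + 1); last first.
  have W1 := @weight_expabs R; have di := @dom_id R.
  have d2 := domZ W1 (vnorm a ^+ 2) (domX W1 2 di).
  have dz := domZ W1 (2 * vnorm a) di.
  transitivity (\int[N]_y (vnorm a ^+ 2 * y ^+ 2 + 2 * vnorm a * y + 1)).
    by apply: eq_Rintegral => y _; ring.
  rewrite (ErD W1 (domD W1 d2 dz) (dom_cst W1 1)) (ErD W1 d2 dz).
  rewrite (ErZ W1 _ (domX W1 2 di)) (ErZ W1 _ di) normal_var1 normal_mean0 (Er_cst N).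
  by rewrite mulr0 addr0 mulr1.
rewrite sqr_vnorm => h.
have {}h : vdot a a + 2 * \int[gam]_x vdot a x + 1 = vdot a a + 1.
  apply: h; last by move=> y; exact: sqr_ge0.
  by apply: measurable_funX; exact: measurable_funD.
lra.
Qed.

(** The integrand depends on z only through [vdot x z], so this is [tilt_L1] at
    [a = e * vnorm x]. *)
Lemma tilt_L1n : exists2 C : R, 0 <= C & forall e x, 0 <= e ->
  \int[gam]_z `|tilt e x z - 1 - e * vdot x z| <= C * (e ^+ 2 * vdot x x).
Proof.
have [C C0 h] := @tilt_L1 R; exists C => // e x e0.
rewrite (marginal_real (k := fun y => `|expR (e * y - e ^+ 2 * vdot x x / 2) - 1 - e * y|)) //.
  apply: le_trans (_ : C * (e * vnorm x) ^+ 2 <= _).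
    apply: le_trans (h _ (mulr_ge0 e0 (vnorm_ge0 x))).
    rewrite le_eqVlt; apply/orP; left; apply/eqP; apply: eq_Rintegral => y _.
    by rewrite exprMn sqr_vnorm mulrA.
  by rewrite exprMn sqr_vnorm.
apply: measurableT_comp => //; apply: measurable_funB; last exact: measurable_funM.
apply: measurable_funB => //; apply: measurableT_comp => //.
by apply: measurable_funB => //; exact: measurable_funM.
Qed.

Section one_function.
Variable u : n.-tuple R -> R.
Hypothesis mu : measurable_fun setT u.
Hypothesis u0 : forall x, 0 <= u x.
Hypothesis u1 : forall x, u x <= 1.

Let un x : `|u x| <= 1. Proof. by rewrite ger0_norm. Qed.

Let du : dom expl1 u. Proof. exact: (dom_bounded W mu un). Qed.

Lemma shift_real (e : R) x :
  \int[gam]_z u (vlin 1 e z x) = \int[gam]_z (u z * tilt e x z).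
Proof.
rewrite /Rintegral (ge0_std_gaussian_shift (g := EFin \o u))//.
exact/measurable_EFinP.
Qed.

(** By [shift_taylor], this is the gradient at 0 of the mean of u as a function of the shift. *)
Definition barycenter : n.-tuple R := [tuple \int[gam]_z (u z * tnth z i) | i < n].

Lemma dom_tnth i : dom expl1 (fun z => tnth z i).
Proof.
apply: (dom_le W (C := 1) (J := 1%N)); first exact: measurable_tnth.
by move=> z; rewrite mul1r expr1 (le_trans (abs_tnth_le_l1 z i))// le_l1_expl1.
Qed.

Lemma vdot_barycenter x : \int[gam]_z (u z * vdot x z) = vdot barycenter x.
Proof.
rewrite /vdot.
have h (r : seq 'I_n) : dom expl1 (fun z => u z * \sum_(i <- r) tnth x i * tnth z i) /\
   \int[gam]_z (u z * \sum_(i <- r) tnth x i * tnth z i)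
    = \sum_(i <- r) tnth barycenter i * tnth x i.
  elim: r => [|i r [IHd IH]].
    split.
      rewrite (_ : (fun z => _) = cst 0); first exact: (dom_cst W).
      by apply/funext => z; rewrite big_nil mulr0.
    rewrite big_nil; under eq_Rintegral do rewrite big_nil mulr0; exact: (Er_cst gam).
  have di : dom expl1 (fun z => tnth x i * (u z * tnth z i)).
    by apply: (domZ W); apply: (domM W) => //; exact: dom_tnth.
  have e : (fun z => u z * \sum_(j <- i :: r) tnth x j * tnth z j) =
     fun z => tnth x i * (u z * tnth z i) + u z * \sum_(j <- r) tnth x j * tnth z j.
    by apply/funext => z; rewrite big_cons; ring.
  rewrite e; split; first exact: (domD W).
  rewrite (ErD W di IHd) IH big_cons (ErZ W); last by apply: (domM W) => //; exact: dom_tnth.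
  by rewrite tnth_mktuple mulrC.
by have [_ ->] := h (index_enum 'I_n).
Qed.

(** As u is merely measurable, the shift is first moved from u to the Gaussian density, and it is
    the density that is expanded. *)
Lemma shift_taylor C : (forall e x, 0 <= e ->
  \int[gam]_z `|tilt e x z - 1 - e * vdot x z| <= C * (e ^+ 2 * vdot x x)) ->
  forall e x, 0 <= e ->
  `|\int[gam]_z u (vlin 1 e z x) - \int[gam]_z u z - e * vdot barycenter x|
    <= C * (e ^+ 2 * vdot x x).
Proof.
move=> h e x e0; apply: le_trans (h e x e0).
have dt := dom_tiltn e x; have dv := dom_vdot x.
have duv := domM W du dv; have dut := domM W du dt.
have dd : dom expl1 (fun z => tilt e x z - 1 - e * vdot x z).
  by apply: (domB W); [exact: (domB W dt (dom_cst W 1))|exact: (domZ W)].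
rewrite shift_real -vdot_barycenter -(ErZ W e duv) -(ErB W dut du).
rewrite -(ErB W (domB W dut du) (domZ W e duv)).
apply: (Er_norm_le W).
- by apply: (domB W); [exact: (domB W)|exact: (domZ W)].
- exact: (dom_norm W).
move=> z; rewrite (_ : _ - _ = u z * (tilt e x z - 1 - e * vdot x z)); last by ring.
by rewrite normrM -[leRHS]mul1r ler_wpM2r.
Qed.

Lemma prob_halfspace (t : R) x : 0 < vnorm x ->
  gam [set z | t <= vdot x z] = (Gcdf (- (t / vnorm x)))%:E.
Proof.
move=> x0; rewrite -Gcdf_opp.
set A := [set z | t <= vdot x z].
have AE : A = vdot x @^-1` `[t, +oo[%classic.
  by apply/seteqP; split => z /=; rewrite in_itv/= andbT.
have mA : measurable A.
  by rewrite AE -[X in measurable X]setTI; exact: measurable_vdot.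
have := @ge0_std_gaussian_marginal R n gam (fun y => (\1_(`[t, +oo[%classic) y)%:E) x gamE.
rewrite (_ : (\int[gam]_z _ = gam A)%E); last first.
  rewrite -[RHS](_ : (\int[gam]_z (\1_A z)%:E)%E = _).
    by apply: eq_integral => z _; rewrite AE !indicE.
  by rewrite integral_indic// setIT.
move=> ->; last 2 first.
- exact/measurable_EFinP/measurable_indic.
- by move=> y; rewrite lee_fin.
rewrite -[RHS](_ : (\int[N]_y (\1_(`[t / vnorm x, +oo[%classic) y)%:E)%E = _); last first.
  by rewrite integral_indic// setIT.
apply: eq_integral => y _; rewrite !indicE; congr ((_ : bool)%:R)%:E.
by apply/idP/idP; rewrite !inE/= !in_itv/= !andbT ler_pdivrMr// mulrC.
Qed.

End one_function.

(** At a given mean, a half-space orthogonal to x gains most from a shift along x: [tilt] is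
    nondecreasing in [vdot x z], so a half-space [A] collects its largest values. The right-hand
    side is the value for [A]. *)
Lemma neyman_pearson (u : n.-tuple R -> R) (q e : R) x : measurable_fun setT u ->
  (forall z, 0 <= u z) -> (forall z, u z <= 1) ->
  0 < vnorm x -> 0 <= e -> \int[gam]_z u z = Gcdf q ->
  \int[gam]_z u (vlin 1 e z x) <= Gcdf (q + e * vnorm x).
Proof.
move=> mu u0 u1 r0 e0 uq; set r := vnorm x in r0 *.
pose A := [set z | - (q * r) <= vdot x z].
have mA : measurable A.
  have -> : A = vdot x @^-1` `[- (q * r), +oo[%classic.
    by apply/seteqP; split => z /=; rewrite in_itv/= andbT.
  by rewrite -[X in measurable X]setTI; exact: measurable_vdot.
pose v z : R := \1_A z.
have mv : measurable_fun setT v by exact: measurable_indic.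
have v0 z : 0 <= v z by [].
have v1 z : v z <= 1 by rewrite /v indicE; case: (_ \in _).
have Ev : \int[gam]_z v z = Gcdf q.
  rewrite /Rintegral integral_indic// setIT.
  apply: (congr1 fine (y := (Gcdf q)%:E)).
  apply: (etrans (prob_halfspace (- (q * r)) r0)); congr EFin.
  by congr (Gcdf _); rewrite mulNr opprK mulfK// gt_eqF.
have Evs : \int[gam]_z v (vlin 1 e z x) = Gcdf (q + e * r).
  pose B := [set z | - (q * r) - e * r ^+ 2 <= vdot x z].
  have vB z : v (vlin 1 e z x) = \1_B z.
    rewrite /v !indicE; congr ((_ : bool)%:R).
    have -> : (z \in B) = (- (q * r) - e * r ^+ 2 <= vdot x z).
      by apply/idP/idP; rewrite inE.
    have -> : (vlin 1 e z x \in A) = (- (q * r) <= vdot x (vlin 1 e z x)).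
      by apply/idP/idP; rewrite inE.
    rewrite lerBlDr sqr_vnorm; congr (_ <= _).
    rewrite /vdot mulr_sumr -big_split/=; apply: eq_bigr => i _.
    by rewrite tnth_mktuple; ring.
  have mB : measurable B.
    have -> : B = vdot x @^-1` `[- (q * r) - e * r ^+ 2, +oo[%classic.
      by apply/seteqP; split => z /=; rewrite in_itv/= andbT.
    by rewrite -[X in measurable X]setTI; exact: measurable_vdot.
  under eq_Rintegral do rewrite vB.
  rewrite /Rintegral integral_indic// setIT.
  apply: (congr1 fine (y := (Gcdf (q + e * r))%:E)).
  apply: (etrans (prob_halfspace (- (q * r) - e * r ^+ 2) r0)); congr EFin.
  by congr (Gcdf _); rewrite -/r; field; rewrite gt_eqF.
rewrite -Evs (shift_real mu u0) (shift_real mv v0).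
(* The value of [tilt] on the boundary of [A]. Since v is the indicator of [A], the product of
   [u z - v z] and [tilt e x z - L0] is never positive. *)
pose L0 := expR (e * - (q * r) - e ^+ 2 * vdot x x / 2).
have dt := dom_tiltn e x.
have du : dom expl1 u by apply: (dom_bounded W mu (C := 1)) => z; rewrite ger0_norm.
have dv : dom expl1 v by apply: (dom_bounded W mv (C := 1)) => z; rewrite ger0_norm.
have dut := domM W du dt; have dvt := domM W dv dt.
have duL := domZ W L0 du; have dvL := domZ W L0 dv.
apply: (@le_trans _ _ (\int[gam]_z (v z * tilt e x z + (L0 * u z - L0 * v z)))).
  apply: (Er_le W dut (domD W dvt (domB W duL dvL))) => z.
  have h : (u z - v z) * (tilt e x z - L0) <= 0.
    rewrite /v indicE; case: (boolP (z \in A)) => /= zA.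
      rewrite mulr_le0_ge0 ?subr_le0 ?u1// subr_ge0 ler_expR lerD2r ler_wpM2l//.
      by move: zA; rewrite inE.
    rewrite mulr_ge0_le0 ?subr0// subr_le0 ler_expR lerD2r ler_wpM2l//.
    by apply/ltW; rewrite ltNge; apply/negP => h; move/negP: zA; apply; rewrite inE.
  by rewrite -subr_le0; move: h; congr (_ <= _); ring.
rewrite (ErD W dvt (domB W duL dvL)) (ErB W duL dvL) (ErZ W _ du) (ErZ W _ dv).
by rewrite uq Ev subrr addr0.
Qed.

(* Derivative at e = 0 of [neyman_pearson] along the barycenter itself. *)
Lemma barycenter_le (u : n.-tuple R -> R) (q : R) : measurable_fun setT u ->
  (forall z, 0 <= u z) -> (forall z, u z <= 1) -> \int[gam]_z u z = Gcdf q ->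
  vdot (barycenter u) (barycenter u) <= nphi q ^+ 2.
Proof.
move=> mu u0 u1 uq; have [C C0 hC] := tilt_L1n.
set c := barycenter u; pose r := vnorm c.
suff : r <= nphi q.
  by move=> rq; rewrite -sqr_vnorm lerXn2r ?nnegrE ?vnorm_ge0 ?nphi_ge0.
have [r0|r0] := eqVneq r 0; first by rewrite r0 nphi_ge0.
have rp : 0 < r by rewrite lt_neqAle eq_sym r0 vnorm_ge0.
rewrite -(ler_pM2l rp) leNgt; apply/negP => lt.
pose x := r * r - r * nphi q.
have x0 : 0 < x by rewrite subr_gt0.
(* The first-order expansion of the shifted mean has slope [r * r], that of the bound of
   [neyman_pearson] has slope [r * nphi q]; the two quadratic errors make up [C + 1]. *)
have key e : 0 < e -> e * x <= (C + 1) * r ^+ 2 * e ^+ 2.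
  move=> e0; have h1 := shift_taylor mu u0 u1 hC c (ltW e0).
  have h2 := neyman_pearson mu u0 u1 rp (ltW e0) uq.
  have h3 := Gcdf_taylor1 q (e * r).
  move: h1 h2 h3; rewrite uq -/c -sqr_vnorm -/r.
  rewrite !ler_norml => /andP[h1 _] h2 /andP[_ h3].
  by rewrite /x; nra.
have D0 : 0 < (C + 1) * r ^+ 2 by rewrite mulr_gt0 ?exprn_gt0// ltr_wpDl.
(* At this e, [key] would give [x <= x / 2]. *)
pose e := x / (2 * ((C + 1) * r ^+ 2)).
have e0 : 0 < e by rewrite divr_gt0// mulr_gt0.
have := key e e0; rewrite expr2 mulrCA ler_pM2l//.
have -> : (C + 1) * r ^+ 2 * e = x / 2 by rewrite /e; field; rewrite gt_eqF// gt_eqF// ltr_wpDl.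
lra.
Qed.

End gaussian_expectation.

Ltac nonneg := repeat first [done | apply: mulr_ge0 | apply: exprn_ge0 | apply: addr_ge0].

(** * The Gaussian quantile function *)

Section quantile.
Context {R : realType}.

(* Junk value 0 outside of ]0, 1[. *)
Definition Gquantile (m : R) : R := xget 0 [set q | Gcdf q = m].

Lemma Gcdf_inj : injective (@Gcdf R).
Proof.
by move=> x y e; apply/le_anti; rewrite -!(ler_Gcdf x) -(ler_Gcdf y) e lexx.
Qed.

Lemma Gquantile_eq m q : Gcdf q = m -> Gquantile m = q.
Proof. by move=> e; apply: Gcdf_inj; rewrite e /Gquantile; case: xgetP => [_ -> //|/(_ q)]. Qed.

Lemma Gcdf_surj (K m : R) : Gcdf (- K) <= m <= Gcdf K ->
  exists2 q, `|q| <= K & Gcdf q = m.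
Proof.
move=> mK.
have KK : - K <= K by rewrite -ler_Gcdf; case/andP: mK; exact: le_trans.
have cf : {within `[- K, K], continuous (@Gcdf R)}.
  by apply: continuous_subspaceT; exact: is_derive_continuous is_derive_Gcdf.
have h : Num.min (Gcdf (- K)) (Gcdf K) <= m <= Num.max (Gcdf (- K)) (Gcdf K).
  by rewrite minEle maxEle ler_Gcdf KK.
have [q qK e] := IVT KK cf h.
by exists q => //; move: qK; rewrite in_itv/= ler_norml.
Qed.

Lemma GquantileP (K m : R) : Gcdf (- K) <= m <= Gcdf K ->
  Gcdf (Gquantile m) = m /\ `|Gquantile m| <= K.
Proof. by move=> /Gcdf_surj[q qK e]; rewrite (Gquantile_eq e). Qed.

Lemma measurable_Gquantile d (T : measurableType d) (K : R) (u : T -> R) : measurable_fun setT u ->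
  (forall x, Gcdf (- K) <= u x <= Gcdf K) -> measurable_fun setT (fun x => Gquantile (u x)).
Proof.
move=> mu uK.
apply: (measurability (@RGenCInfty.G R)) => [|/= _ [_] [r] -> <-].
  exact: RGenCInfty.measurableE.
rewrite setTI (_ : _ @^-1` _ = u @^-1` `[Gcdf r, +oo[%classic).
  by rewrite -[X in measurable X]setTI; exact: mu.
have E x : Gcdf (Gquantile (u x)) = u x by have [] := GquantileP (uK x).
by apply/seteqP; split => x /=; rewrite !in_itv/= !andbT -(ler_Gcdf r) E.
Qed.

(** Says that the quantile is Lipschitz with constant [(nphi K)^-1] between [Gcdf (- K)] and
    [Gcdf K]: the reason for keeping quantiles bounded by K. *)
Lemma Gcdf_lower (K x y : R) : `|x| <= K -> `|y| <= K ->
  nphi K * `|y - x| <= `|Gcdf y - Gcdf x|.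
Proof.
wlog xy : x y / x <= y.
  move=> h xK yK; have [|/ltW] := leP x y; first by move=> ?; exact: h.
  by move=> yx; rewrite distrC [leRHS]distrC; exact: h.
move=> xK yK.
move: xy; rewrite le_eqVlt => /predU1P[->|xy]; first by rewrite !subrr normr0 mulr0.
have [||c cxy e] := @MVT R Gcdf nphi x y xy.
- by move=> z _; exact: is_derive_Gcdf.
- by apply: continuous_subspaceT; exact: is_derive_continuous is_derive_Gcdf.
rewrite e normrM ler_wpM2r// ger0_norm ?nphi_ge0//; apply: nphi_ge.
move: cxy xK yK; rewrite in_itv/= !ler_norml => /andP[c1 c2] /andP[x1 _] /andP[_ y2].
by rewrite (le_trans x1 (ltW c1)) (le_trans (ltW c2)).
Qed.

End quantile.

(** * Moments of the quantile increment *)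

Section quantile_expansion.
Context {R : realType} {n : nat} (gam : probability (n.-tuple R) R).
Hypothesis gamE : is_std_gaussian gam.
Let W := weight_expl1 gamE.

(** x is the increment being revealed, z the noise averaged out. The variance of [z + e x] is
    [1 + e ^+ 2] per coordinate, so that averaging over x does not in general give back the mean of
    u. *)
Definition noise (e : R) (u : n.-tuple R -> R) (x : n.-tuple R) : R :=
  \int[gam]_z u (vlin 1 e z x).

Lemma measurable_noise e (u : n.-tuple R -> R) : measurable_fun setT u ->
  (forall x, 0 <= u x) -> measurable_fun setT (noise e u).
Proof.
move=> mu u0; apply: (measurableT_comp (f := fine)); first exact: fine_measurable.
have mG : measurable_fun setT
    (fun p : n.-tuple R * n.-tuple R => (u (vlin 1 e p.2 p.1))%:E).
  by apply/measurable_EFinP/(measurableT_comp mu); exact: measurable_vlin.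
by apply: (@measurable_fun_fubini_tonelli_F _ _ _ _ _ gam _ mG) => p; rewrite lee_fin.
Qed.

Lemma Er_range (a b : R) (v : n.-tuple R -> R) : measurable_fun setT v ->
  (forall x, a <= v x <= b) -> a <= \int[gam]_x v x <= b.
Proof.
move=> mv vab.
have dv : dom expl1 v.
  apply: (dom_bounded W mv (C := `|a| + `|b|)) => x; have /andP[h1 h2] := vab x.
  rewrite ler_norml; have := ler_norm b; have := ler_norm (- a); rewrite normrN.
  by have := normr_ge0 a; have := normr_ge0 b; lra.
apply/andP; split.
  rewrite -[leLHS](Er_cst gam a).
  by apply: (Er_le W (dom_cst W a) dv) => x; have /andP[] := vab x.
rewrite -[leRHS](Er_cst gam b).
by apply: (Er_le W dv (dom_cst W b)) => x; have /andP[] := vab x.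
Qed.

(** D comes before u because the lemma will be applied to u conditioned at every point. The shift
    expansion determines [Gcdf (Q x) - Gcdf q0] up to [e ^+ 2], and division by the slope [nphi q0]
    gives [Q x - q0], with linear term [e * vdot c x / nphi q0]. *)
Lemma quantile_expansion (K : R) : exists2 D : R, 0 <= D &
  forall (u : n.-tuple R -> R) (e : R), measurable_fun setT u ->
  (forall x, Gcdf (- K) <= u x <= Gcdf K) -> 0 <= e -> e <= 1 ->
  let q := Gquantile (\int[gam]_x noise e u x) in
  \int[gam]_x ((Gquantile (noise e u x) - q) ^+ 2) <= e ^+ 2 + D * e ^+ 3 /\
  \int[gam]_x (`|Gquantile (noise e u x) - q| ^+ 3) <= D * e ^+ 3.
Proof.
have [C1 C10 hC1] := tilt_L1n gamE.
pose k : R := nphi K; have k0 : 0 < k by exact: nphi_gt0.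
pose M j : R := \int[gam]_x (expl1 x ^+ j).
have w0 x : 0 <= @expl1 R n x by rewrite (le_trans ler01)// expl1_ge1.
have M0 j : 0 <= M j by apply: Rintegral_ge0 => x _; rewrite exprn_ge0.
have dw j : dom (@expl1 R n) (fun x => expl1 x ^+ j) by exact: (domX W _ (dom_w W)).
pose C2 := (1 + C1) / k; have C20 : 0 <= C2 by rewrite divr_ge0 ?addr_ge0// ltW.
pose C3 := (C1 + C2 ^+ 2) / k.
have C30 : 0 <= C3 by rewrite divr_ge0 ?addr_ge0 ?sqr_ge0// ltW.
pose C4 := C1 * M 2 / k; have C40 : 0 <= C4 by rewrite divr_ge0 ?mulr_ge0// ltW.
pose C5 := C3 + C4; have C50 : 0 <= C5 by rewrite addr_ge0.
pose C6 := 2 * C5 + C5 ^+ 2; have C60 : 0 <= C6 by rewrite addr_ge0 ?mulr_ge0 ?sqr_ge0.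
exists (C6 * M 8 + (1 + C5) ^+ 3 * M 12).
  by apply: addr_ge0; apply: mulr_ge0 => //; apply: exprn_ge0; exact: addr_ge0.
move=> u e mu uK e0 e1 q.
have u0 x : 0 <= u x by have /andP[h _] := uK x; rewrite (le_trans _ h)// Gcdf_ge0.
have u1 x : u x <= 1 by have /andP[_ h] := uK x; rewrite (le_trans h)// ltW// Gcdf_lt1.
have mU := measurable_noise e mu u0.
have UK x : Gcdf (- K) <= noise e u x <= Gcdf K.
  by apply: Er_range => //; apply: (measurableT_comp mu); exact: measurable_vlin.
have [qK qn] : Gcdf q = \int[gam]_x noise e u x /\ `|q| <= K.
  by apply: GquantileP; exact: Er_range.
(* The expansion is made at [q0], the quantile of the mean of u, whereas the statement is about q,
   the quantile of the mean after noise. [A5] bounds their difference. *)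
pose U0 := \int[gam]_x u x; pose q0 := Gquantile U0.
have [q0K q0n] : Gcdf q0 = U0 /\ `|q0| <= K by apply: GquantileP; exact: Er_range.
pose f0 := @nphi R q0; have f00 : 0 < f0 by exact: nphi_gt0.
have kf : k <= f0 by exact: nphi_ge.
have f01 : f0 <= 1 by exact: nphi_le1.
pose c := barycenter gam u.
have cc : vdot c c <= f0 ^+ 2 by apply: barycenter_le.
have ci i : `|tnth c i| <= f0.
  rewrite -(@ler_pXn2r _ 2) ?nnegrE ?(ltW f00)// real_normK ?num_real//.
  apply: le_trans cc; rewrite /vdot (bigD1 i)//= -expr2 lerDl sumr_ge0// => j _.
  by rewrite -expr2 sqr_ge0.
have cx x : `|vdot c x| <= f0 * expl1 x.
  apply: (@le_trans _ _ (f0 * l1 x)); last by rewrite ler_wpM2l ?le_l1_expl1// ltW.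
  rewrite /vdot (le_trans (ler_norm_sum _ _ _))// /l1 mulr_sumr ler_sum// => i _.
  by rewrite normrM ler_wpM2r.
have w1 x j : 1 <= @expl1 R n x ^+ j by rewrite exprn_ege1// expl1_ge1.
have ww x i j : (i <= j)%N -> @expl1 R n x ^+ i <= expl1 x ^+ j.
  by move=> ij; rewrite ler_weXn2l// expl1_ge1.
have e2 j : e ^+ (j + 1) <= e ^+ 1 by rewrite addn1 expr1 exprS ler_piMr// exprn_ile1.
have xx x : vdot x x <= @expl1 R n x ^+ 2.
  apply: le_trans (ler_norm _) _; apply: le_trans (abs_vdot_le _ _) _.
  by rewrite expr2 ler_pM ?l1_ge0 ?le_l1_expl1.
pose Q x := Gquantile (noise e u x).
have QK x : Gcdf (Q x) = noise e u x /\ `|Q x| <= K by exact: GquantileP.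
have A0 x : `|noise e u x - U0 - e * vdot c x| <= C1 * (e ^+ 2 * expl1 x ^+ 2).
  apply: (le_trans (shift_taylor gamE mu u0 u1 hC1 x e0)).
  by rewrite ler_wpM2l// ler_wpM2l// sqr_ge0.
have A1 x : `|noise e u x - U0| <= (1 + C1) * (e * expl1 x ^+ 2).
  rewrite -[_ - U0](subrK (e * vdot c x)) (le_trans (ler_normD _ _))//.
  rewrite mulrDl mul1r addrC lerD//.
    rewrite normrM ger0_norm// ler_wpM2l// (le_trans (cx x))//.
    by rewrite -[leRHS]mul1r ler_pM ?(ltW f00)//; exact: (ww x 1%N 2%N).
  apply: (le_trans (A0 x)); rewrite ler_wpM2l// ler_wpM2r ?exprn_ge0//.
  exact: (e2 1%N).
have A2 x : `|Q x - q0| <= C2 * (e * expl1 x ^+ 2).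
  have [QE Qn] := QK x.
  have := le_trans (Gcdf_lower q0n Qn); rewrite QE q0K => /(_ _ (A1 x)).
  by rewrite mulrC -ler_pdivlMr// => h; apply: (le_trans h); rewrite /C2 mulrAC.
have A4 x : `|Q x - q0 - e * (vdot c x / f0)| <= C3 * (e ^+ 2 * expl1 x ^+ 4).
  have [QE Qn] := QK x.
  have h := Gcdf_taylor1 q0 (Q x - q0).
  have {}h : `|noise e u x - U0 - f0 * (Q x - q0)| <= (Q x - q0) ^+ 2.
    by move: h; rewrite [q0 + _](_ : _ = Q x) ?QE ?q0K//; ring.
  have h2 : (Q x - q0) ^+ 2 <= C2 ^+ 2 * (e ^+ 2 * expl1 x ^+ 4).
    rewrite -[(_ - _) ^+ 2]real_normK ?num_real//.
    rewrite (_ : C2 ^+ 2 * _ = (C2 * (e * expl1 x ^+ 2)) ^+ 2); last by ring.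
    by rewrite lerXn2r ?nnegrE//; nonneg.
  have h3 : f0 * `|Q x - q0 - e * (vdot c x / f0)| <= (C1 + C2 ^+ 2) * (e ^+ 2 * expl1 x ^+ 4).
    rewrite -{1}(gtr0_norm f00) -normrM.
    rewrite (_ : f0 * _ = (noise e u x - U0 - e * vdot c x)
       - (noise e u x - U0 - f0 * (Q x - q0))); last by field; rewrite gt_eqF.
    rewrite (le_trans (ler_normB _ _))// mulrDl lerD ?(le_trans h)//.
    apply: (le_trans (A0 x)); rewrite ler_wpM2l// ler_wpM2l ?sqr_ge0//.
    exact: ww.
  rewrite /C3 mulrAC ler_pdivlMr// mulrC; apply: le_trans h3.
  by rewrite ler_wpM2r.
have dU : dom (@expl1 R n) (noise e u).
  apply: (dom_bounded W mU (C := 1)) => x; have /andP[h1 h2] := UK x.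
  rewrite ger0_norm; first by rewrite (le_trans h2)// ltW// Gcdf_lt1.
  by rewrite (le_trans _ h1)// Gcdf_ge0.
have dc := dom_vdot gamE c.
have dQ : dom (@expl1 R n) Q.
  apply: (dom_bounded W (C := K)); first exact: measurable_Gquantile UK.
  by move=> x; have [] := QK x.
(* The linear term has mean zero, so only the second-order remainder displaces the mean. *)
have A5 : `|q - q0| <= C4 * e ^+ 2.
  have : `|\int[gam]_x noise e u x - U0| <= C1 * e ^+ 2 * M 2.
    have dd := domB W (domB W dU (dom_cst W U0)) (domZ W e dc).
    rewrite (_ : _ - U0 = \int[gam]_x (noise e u x - U0 - e * vdot c x)); last first.
      rewrite (ErB W (domB W dU (dom_cst W U0)) (domZ W e dc)).
      rewrite (ErB W dU (dom_cst W U0)) (Er_cst gam) (ErZ W e dc) (integral_vdot gamE).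
      by rewrite mulr0 subr0.
    rewrite /M -(ErZ W _ (dw 2%N)).
    by apply: (Er_norm_le W dd (domZ W _ (dw 2%N))) => x; rewrite -mulrA.
  rewrite -qK -q0K => h.
  have := le_trans (Gcdf_lower q0n qn) h.
  rewrite mulrC -ler_pdivlMr// => h'; apply: (le_trans h').
  by rewrite /C4 le_eqVlt; apply/orP; left; apply/eqP; ring.
pose B x := vdot c x / f0.
have Bw x : `|B x| <= expl1 x.
  by rewrite normrM normfV (gtr0_norm f00) ler_pdivrMr// mulrC.
have A6 x : `|Q x - q - e * B x| <= C5 * (e ^+ 2 * expl1 x ^+ 4).
  rewrite (_ : _ - _ = (Q x - q0 - e * B x) - (q - q0)); last by ring.
  rewrite (le_trans (ler_normB _ _))// mulrDl lerD//.
  apply: (le_trans A5); rewrite ler_wpM2l// ler_peMr ?sqr_ge0//.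
(* The cross term with the error [dl] is of order [e ^+ 3], and [dl ^+ 2] of order [e ^+ 4]; powers
   of the weight are rounded up to 8. *)
have A7 x : (Q x - q) ^+ 2 <= e ^+ 2 * B x ^+ 2 + C6 * (e ^+ 3 * expl1 x ^+ 8).
  pose dl := Q x - q - e * B x.
  have -> : (Q x - q) ^+ 2 = e ^+ 2 * B x ^+ 2 + (2 * e * (B x * dl) + dl ^+ 2).
    by rewrite /dl; ring.
  rewrite lerD2l /C6 [leRHS]mulrDl lerD//.
    apply: (@le_trans _ _ (2 * e * (expl1 x * (C5 * (e ^+ 2 * expl1 x ^+ 4))))).
      rewrite ler_wpM2l ?mulr_ge0// (le_trans (ler_norm _))// normrM ler_pM//.
      exact: A6.
    rewrite (_ : 2 * e * _ = 2 * C5 * (e ^+ 3 * expl1 x ^+ 5)); last by ring.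
    by rewrite ler_wpM2l ?mulr_ge0// ler_wpM2l ?exprn_ge0// ww.
  rewrite -[dl ^+ 2]real_normK ?num_real//.
  apply: (@le_trans _ _ ((C5 * (e ^+ 2 * expl1 x ^+ 4)) ^+ 2)).
    by rewrite lerXn2r ?nnegrE ?A6//; nonneg.
  rewrite (_ : _ ^+ 2 = C5 ^+ 2 * (e * e ^+ 3 * expl1 x ^+ 8)); last by ring.
  rewrite ler_wpM2l ?sqr_ge0// ler_wpM2r ?exprn_ge0// ler_piMl// exprn_ge0//.
have A8 x : `|Q x - q| ^+ 3 <= (1 + C5) ^+ 3 * (e ^+ 3 * expl1 x ^+ 12).
  rewrite (_ : _ * _ = ((1 + C5) * (e * expl1 x ^+ 4)) ^+ 3); last by ring.
  rewrite lerXn2r ?nnegrE//.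
    by nonneg.
  rewrite -[_ - q](subrK (e * B x)) (le_trans (ler_normD _ _))//.
  rewrite mulrDl mul1r addrC lerD//.
    rewrite normrM ger0_norm// ler_wpM2l// (le_trans (Bw x))//.
    exact: (ww x 1%N 4%N).
  apply: (le_trans (A6 x)); rewrite ler_wpM2l// ler_wpM2r ?exprn_ge0//.
  exact: (e2 1%N).
have dB : dom (@expl1 R n) B by exact: (domM W dc (dom_cst W f0^-1)).
have dB2 := domX W 2 dB.
have dQq := domB W dQ (dom_cst W q).
have T1 : 0 <= (1 + C5) ^+ 3 * M 12 * e ^+ 3.
  by nonneg.
have T2 : 0 <= C6 * M 8 * e ^+ 3 by nonneg.
split.
  have dr := domZ W C6 (domZ W (e ^+ 3) (dw 8%N)).
  apply: (@le_trans _ _ (\int[gam]_x (e ^+ 2 * B x ^+ 2 + C6 * (e ^+ 3 * expl1 x ^+ 8)))).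
    exact: (Er_le W (domX W 2 dQq) (domD W (domZ W (e ^+ 2) dB2) dr)).
  rewrite (ErD W (domZ W (e ^+ 2) dB2) dr) (ErZ W _ dB2).
  rewrite (ErZ W _ (domZ W (e ^+ 3) (dw 8%N))) (ErZ W _ (dw 8%N)) -/(M 8%N).
  (* By [barycenter_le] this quotient is at most 1, which gives the coefficient 1 of [e ^+ 2]. *)
  have -> : \int[gam]_x (B x ^+ 2) = vdot c c / f0 ^+ 2.
    rewrite -(integral_vdot_sqr gamE) mulrC -(ErZ W _ (domX W 2 dc)).
    by apply: eq_Rintegral => x _; rewrite /B exprMn exprVn mulrC.
  apply: (@le_trans _ _ (e ^+ 2 + C6 * M 8 * e ^+ 3)); last first.
    by rewrite lerD2l (mulrDl (C6 * M 8%N)) lerDl.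
  rewrite lerD//; last by rewrite le_eqVlt; apply/orP; left; apply/eqP; ring.
  by rewrite ler_piMr ?sqr_ge0// ler_pdivrMr ?exprn_gt0// mul1r.
have dr := domZ W ((1 + C5) ^+ 3) (domZ W (e ^+ 3) (dw 12%N)).
apply: (@le_trans _ _ (\int[gam]_x ((1 + C5) ^+ 3 * (e ^+ 3 * expl1 x ^+ 12)))).
  exact: (Er_le W (domX W 3 (dom_norm W dQq)) dr).
rewrite (ErZ W _ (domZ W (e ^+ 3) (dw 12%N))) (ErZ W _ (dw 12%N)) -/(M 12%N).
apply: (@le_trans _ _ ((1 + C5) ^+ 3 * M 12 * e ^+ 3)); last by rewrite (mulrDl (C6 * M 8%N)) lerDr.
by rewrite le_eqVlt; apply/orP; left; apply/eqP; ring.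
Qed.

End quantile_expansion.

(** * Comparison with half-spaces *)

Section step.
Context {R : realType}.
Local Notation N := (@normal_prob R 0 1).

(** [ou_Gcdf] removes the term linear in [Gcdf], and the second moment of [Y - q] is [e ^+ 2] plus a
    square. Since the quadratic coefficient is nonnegative, a lower bound on this moment is
    enough. *)
Lemma ou_lower (C K : R) : 0 <= C -> 0 <= K -> exists2 D : R, 0 <= D &
  forall (G G1 G2 : R -> R) (q e : R), gconvex C G G1 G2 -> `|q| <= K -> 0 <= e -> e <= 1 ->
  G q + (G2 q + q * G1 q) / 2 * e ^+ 2 <= ou e G q + D * e ^+ 3.
Proof.
move=> C0 K0; have W := @weight_expabs R.
pose C' := C + C / nphi K * 3.
have C'0 : 0 <= C' by rewrite addr_ge0// mulr_ge0// divr_ge0// nphi_ge0.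
have dw3 : dom expabs (fun y : R => expabs y ^+ 3) by exact: (domX W _ (dom_w W)).
pose M : R := \int[N]_y (expabs y ^+ 3).
have w0 y : 0 <= @expabs R y by rewrite (le_trans ler01)// expabs_ge1.
have M0 : 0 <= M by apply: Rintegral_ge0 => y _; rewrite exprn_ge0.
exists (C' * (K + 1) ^+ 3 * M); first by nonneg.
move=> G G1 G2 q e hG qK e0 e1.
pose a := Num.sqrt (1 + e ^+ 2); pose Y y := a * q + e * y.
have a1 : 1 <= a by exact: sqrt1b_ge1.
have ae : a - 1 <= e.
  rewrite lerBlDl -(@ler_pXn2r _ 2) ?nnegrE ?sqrtr_ge0 ?addr_ge0//.
  by rewrite sqr_sqrt1b; nra.
have YE y : Y y - q = (a - 1) * q + e * y by rewrite /Y; ring.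
have Yw y : `|Y y - q| <= (K + 1) * (e * expabs y).
  rewrite YE (le_trans (ler_normD _ _))// [leRHS]mulrDl mul1r lerD//.
    rewrite normrM mulrC ler_pM// ger0_norm ?subr_ge0//.
    by apply: (le_trans ae); rewrite ler_peMr// expabs_ge1.
  rewrite normrM ger0_norm// ler_wpM2l//.
  by apply: le_trans (le_abs_expabs y); rewrite lerDr.
set la := G1 q / nphi q; set ka := (G2 q + q * G1 q) / 2.
have ka0 : 0 <= ka by rewrite divr_ge0//; exact: gc_cvx hG q.
have dG : dom expabs (fun y => G (Y y)).
  apply: (dom_affine (C := C)); first exact: gc_m hG.
  by move=> y; rewrite ger0_norm ?(gc_ge0 hG)// (gc_le hG).
have G01 y : `|@Gcdf R y| <= 1 by rewrite ger0_norm ?Gcdf_ge0// ltW// Gcdf_lt1.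
have dP : dom expabs (fun y => Gcdf (Y y)) by apply: dom_affine G01; exact: measurable_Gcdf.
have dY : dom expabs (fun y => Y y - q).
  apply: (domB W _ (dom_cst W q)); apply: (domD W (dom_cst W (a * q))).
  exact: (domZ W e (@dom_id R)).
have d1 := domZ W la (domB W dP (dom_cst W (Gcdf q))).
have d2 := domZ W ka (domX W 2 dY).
have d3 := domZ W C' (dom_cst W ((K + 1) ^+ 3 * e ^+ 3)).
have d3' := domZ W (C' * ((K + 1) ^+ 3 * e ^+ 3)) dw3.
have h : \int[N]_y (G q + la * (Gcdf (Y y) - Gcdf q) + ka * (Y y - q) ^+ 2) <=
    \int[N]_y (G (Y y) + C' * ((K + 1) ^+ 3 * e ^+ 3) * expabs y ^+ 3).
  apply: (Er_le W (domD W (domD W (dom_cst W _) d1) d2) (domD W dG d3')) => y.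
  have := gconvex_expand hG qK (Y y); rewrite -/la -/ka -/C' ler_norml => /andP[h _].
  have h3 : C' * `|Y y - q| ^+ 3 <= C' * ((K + 1) ^+ 3 * e ^+ 3) * expabs y ^+ 3.
    rewrite -mulrA ler_wpM2l// (_ : _ * _ = ((K + 1) * (e * expabs y)) ^+ 3); last by ring.
    by rewrite lerXn2r ?nnegrE//; nonneg.
  by move: h h3; rewrite /cst/=; set X := C' * `|_| ^+ 3; set X' := _ * expabs y ^+ 3; lra.
move: h; rewrite (ErD W (domD W (dom_cst W (G q)) d1) d2) (ErD W (dom_cst W (G q)) d1).
rewrite (ErZ W la (domB W dP (dom_cst W (Gcdf q)))) (ErB W dP (dom_cst W (Gcdf q))).
rewrite !(Er_cst N) (ErZ W ka (domX W 2 dY)) (ErD W dG d3') (ErZ W _ dw3) -/M.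
have -> : \int[N]_y Gcdf (Y y) = Gcdf q by exact: ou_Gcdf.
rewrite subrr mulr0 addr0 -/(ou e G q).
have V : e ^+ 2 <= \int[N]_y ((Y y - q) ^+ 2).
  have di := @dom_id R; have di2 := domX W 2 di.
  have dl := domZ W (2 * ((a - 1) * q) * e) di.
  have -> : \int[N]_y ((Y y - q) ^+ 2) = ((a - 1) * q) ^+ 2 + e ^+ 2.
    transitivity (\int[N]_y (((a - 1) * q) ^+ 2 + 2 * ((a - 1) * q) * e * y + e ^+ 2 * y ^+ 2)).
      by apply: eq_Rintegral => y _; rewrite YE; ring.
    rewrite (ErD W (domD W (dom_cst W _) dl) (domZ W _ di2)) (ErD W (dom_cst W _) dl).
    rewrite (ErZ W _ di) (ErZ W _ di2) normal_mean0 normal_var1 (Er_cst N).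
    by rewrite mulr0 addr0 mulr1.
  by rewrite lerDr sqr_ge0.
move=> h; apply: le_trans (_ : G q + ka * \int[N]_y ((Y y - q) ^+ 2) <= _).
  by rewrite lerD2l ler_wpM2l.
apply: (le_trans h); rewrite le_eqVlt; apply/orP; left; apply/eqP; ring.
Qed.

Context {n : nat} (gam : probability (n.-tuple R) R).
Hypothesis gamE : is_std_gaussian gam.

(** The expansion of [G (Q x)] is taken at the q of the right-hand side, so [Gcdf (Q x)] has mean
    [Gcdf q] and the linear term drops out here too. What remains is the comparison of second
    moments, up to third-order errors. *)
Lemma step_local (C K : R) : 0 <= C -> 0 <= K -> exists2 D : R, 0 <= D &
  forall (G G1 G2 : R -> R) (u : n.-tuple R -> R) (e : R), gconvex C G G1 G2 ->
  measurable_fun setT u -> (forall x, Gcdf (- K) <= u x <= Gcdf K) -> 0 <= e -> e <= 1 ->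
  \int[gam]_x G (Gquantile (noise gam e u x)) <=
  ou e G (Gquantile (\int[gam]_x noise gam e u x)) + D * e ^+ 3.
Proof.
move=> C0 K0; have W := weight_expl1 gamE.
have [D1 D10 hD1] := ou_lower C0 K0.
have [D2 D20 hD2] := quantile_expansion gamE K.
pose C' := C + C / nphi K * 3.
have C'0 : 0 <= C' by rewrite addr_ge0// mulr_ge0// divr_ge0// nphi_ge0.
(* [D1] is the loss in [ou_lower]; [(C + K * C) / 2] bounds the quadratic coefficient, which
   multiplies the excess of the second moment; [C'] multiplies the third moment. *)
exists (D1 + (C + K * C) / 2 * D2 + C' * D2); first by nonneg; rewrite ?divr_ge0//; nonneg.
move=> G G1 G2 u e hG mu uK e0 e1.
have u0 x : 0 <= u x by have /andP[h _] := uK x; rewrite (le_trans _ h)// Gcdf_ge0.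
have [V1 V2] := hD2 u e mu uK e0 e1; move: V1 V2.
set q := Gquantile _; move=> V1 V2.
have mU := measurable_noise gam e mu u0.
have UK x : Gcdf (- K) <= noise gam e u x <= Gcdf K.
  by apply: (Er_range gamE) => //; apply: (measurableT_comp mu); exact: measurable_vlin.
have [qE qn] : Gcdf q = \int[gam]_x noise gam e u x /\ `|q| <= K.
  by apply: GquantileP; exact: (Er_range gamE).
pose Q x := Gquantile (noise gam e u x).
have QK x : Gcdf (Q x) = noise gam e u x /\ `|Q x| <= K by exact: GquantileP.
have mQ : measurable_fun setT Q by exact: measurable_Gquantile UK.
have dQ : dom (@expl1 R n) Q.
  by apply: (dom_bounded W (C := K)) => // x; have [] := QK x.
have dU : dom (@expl1 R n) (noise gam e u).
  apply: (dom_bounded W mU (C := 1)) => x; have /andP[h1 h2] := UK x.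
  rewrite ger0_norm; first by rewrite (le_trans h2)// ltW// Gcdf_lt1.
  by rewrite (le_trans _ h1)// Gcdf_ge0.
have dG : dom (@expl1 R n) (fun x => G (Q x)).
  apply: (dom_bounded W (C := C)); first exact: (measurableT_comp (gc_m hG)).
  by move=> x; rewrite ger0_norm ?(gc_ge0 hG)// (gc_le hG).
set la := G1 q / nphi q; pose ka := (G2 q + q * G1 q) / 2.
have ka0 : 0 <= ka by rewrite divr_ge0//; exact: gc_cvx hG q.
have kaC : ka <= (C + K * C) / 2.
  rewrite ler_wpM2r// lerD//; first by rewrite (le_trans (ler_norm _))// (gc_2 hG).
  by rewrite (le_trans (ler_norm _))// normrM ler_pM// (gc_1 hG).
have dQq := domB W dQ (dom_cst W q).
have d1 := domZ W la (domB W dU (dom_cst W (Gcdf q))).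
have d2 := domZ W ka (domX W 2 dQq).
have d3 := domZ W C' (domX W 3 (dom_norm W dQq)).
have h : \int[gam]_x G (Q x) <= \int[gam]_x (G q + la * (noise gam e u x - Gcdf q)
    + ka * (Q x - q) ^+ 2 + C' * `|Q x - q| ^+ 3).
  apply: (Er_le W dG (domD W (domD W (domD W (dom_cst W (G q)) d1) d2) d3)) => x.
  have := gconvex_expand hG qn (Q x); rewrite -/la -/ka -/C' ler_norml => /andP[_].
  by rewrite (QK x).1 /cst/=; set X := C' * `|_| ^+ 3; lra.
apply: (le_trans h).
rewrite (ErD W (domD W (domD W (dom_cst W (G q)) d1) d2) d3).
rewrite (ErD W (domD W (dom_cst W (G q)) d1) d2) (ErD W (dom_cst W (G q)) d1).
rewrite (ErZ W la (domB W dU (dom_cst W (Gcdf q)))) (ErB W dU (dom_cst W (Gcdf q))).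
rewrite !(Er_cst gam) (ErZ W ka (domX W 2 dQq)) (ErZ W C' (domX W 3 (dom_norm W dQq))).
rewrite qE subrr mulr0 addr0.
have h1 := hD1 G G1 G2 q e hG qn e0 e1; rewrite -/ka in h1.
have h2 : ka * \int[gam]_x ((Q x - q) ^+ 2) <= ka * e ^+ 2 + (C + K * C) / 2 * D2 * e ^+ 3.
  apply: (@le_trans _ _ (ka * (e ^+ 2 + D2 * e ^+ 3))); first by rewrite ler_wpM2l.
  rewrite mulrDr lerD2l -[leRHS]mulrA ler_wpM2r//; nonneg.
have h3 : C' * \int[gam]_x (`|Q x - q| ^+ 3) <= C' * D2 * e ^+ 3.
  by rewrite -mulrA ler_wpM2l.
rewrite (mulrDl (D1 + _)) (mulrDl D1).
move: h1 h2 h3; rewrite -/ka; set I2 := ka * Rintegral _ _ _; set I3 := C' * Rintegral _ _ _.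
set X1 := _ * e ^+ 3; set X2 := _ * D2 * e ^+ 3; set X3 := C' * D2 * e ^+ 3.
by set k2 := ka * _; lra.
Qed.

(** Real-valued form of [Urho], to which it is convertible. *)
Definition Ur (r : R) (u : n.-tuple R -> R) (x : n.-tuple R) : R :=
  \int[gam]_z u (vlin r (Num.sqrt (1 - r ^+ 2)) x z).

Lemma comb_real (C a b : R) (g : n.-tuple R -> R) : measurable_fun setT g ->
  (forall x, 0 <= g x) -> (forall x, g x <= C) ->
  \int[gam]_x \int[gam]_z g (vlin a b x z) =
  \int[gam]_x g (vscale (Num.sqrt (a ^+ 2 + b ^+ 2)) x).
Proof.
move=> mg g0 gC; have W := weight_expl1 gamE.
rewrite [LHS]/Rintegral [RHS]/Rintegral; congr fine.
rewrite -(ge0_std_gaussian_comb _ _ gamE (g := EFin \o g))//; last exact/measurable_EFinP.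
apply: eq_integral => x _; rewrite -(Er_EFin W)//.
apply: (dom_bounded W (C := C)); last by move=> z; rewrite ger0_norm.
by apply: (measurableT_comp mg); exact: measurable_vlin.
Qed.

Lemma measurable_Ur r (u : n.-tuple R -> R) : measurable_fun setT u ->
  (forall x, 0 <= u x) -> measurable_fun setT (Ur r u).
Proof.
move=> mu u0; apply: (measurableT_comp (f := fine)); first exact: fine_measurable.
have mG : measurable_fun setT
    (fun p : n.-tuple R * n.-tuple R => (u (vlin r (Num.sqrt (1 - r ^+ 2)) p.1 p.2))%:E).
  by apply/measurable_EFinP/(measurableT_comp mu); exact: measurable_vlin.
by apply: (@measurable_fun_fubini_tonelli_F _ _ _ _ _ gam _ mG) => p; rewrite lee_fin.
Qed.

(** With s the square root of [1 - r ^+ 2], the vector [r x] is distributed as [r' x + e s y], where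
    y is independent of x. Fixing [w = r' x] leaves the function [uw w] with noise in the increment
    y, to which [step_local] applies. Averaging over y too gives [Ur r' u x], because
    [1 - r' ^+ 2 = s ^+ 2 * (1 + e ^+ 2)]. *)
Lemma step (C K : R) : 0 <= C -> 0 <= K -> exists2 D : R, 0 <= D &
  forall (G G1 G2 : R -> R) (u : n.-tuple R -> R) (e r r' : R), gconvex C G G1 G2 ->
  measurable_fun setT u -> (forall x, Gcdf (- K) <= u x <= Gcdf K) -> 0 <= e -> e <= 1 ->
  0 <= r -> r ^+ 2 <= 1 -> 1 - r' ^+ 2 = (1 - r ^+ 2) * (1 + e ^+ 2) ->
  \int[gam]_x G (Gquantile (Ur r u x)) <= \int[gam]_x ou e G (Gquantile (Ur r' u x)) + D * e ^+ 3.
Proof.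
move=> C0 K0; have W := weight_expl1 gamE.
have [D D0 hD] := step_local C0 K0; exists D => // G G1 G2 u e r r' hG mu uK e0 e1 r0 r1 rr.
have u0 x : 0 <= u x by have /andP[h _] := uK x; rewrite (le_trans _ h)// Gcdf_ge0.
have u1 x : u x <= 1 by have /andP[_ h] := uK x; rewrite (le_trans h)// ltW// Gcdf_lt1.
pose s := Num.sqrt (1 - r ^+ 2).
have s2 : s ^+ 2 = 1 - r ^+ 2 by rewrite sqr_sqrtr// subr_ge0.
pose uw w z := u (vlin 1 s w z).
have muw w : measurable_fun setT (uw w).
  by apply: (measurableT_comp mu); exact: measurable_vlin.
have uwK w x : Gcdf (- K) <= uw w x <= Gcdf K by exact: uK.
pose V w := \int[gam]_z uw w z.
have mV : measurable_fun setT V.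
  apply: (measurableT_comp (f := fine)); first exact: fine_measurable.
  have mG : measurable_fun setT
      (fun p : n.-tuple R * n.-tuple R => (u (vlin 1 s p.1 p.2))%:E).
    by apply/measurable_EFinP/(measurableT_comp mu); exact: measurable_vlin.
  by apply: (@measurable_fun_fubini_tonelli_F _ _ _ _ _ gam _ mG) => p; rewrite lee_fin.
have VK w : Gcdf (- K) <= V w <= Gcdf K by exact: (Er_range gamE).
have UK t x : Gcdf (- K) <= Ur t u x <= Gcdf K.
  by apply: (Er_range gamE) => //; apply: (measurableT_comp mu); exact: measurable_vlin.
pose g w := G (Gquantile (V w)).
have mg : measurable_fun setT g.
  by apply: (measurableT_comp (gc_m hG)); exact: measurable_Gquantile VK.
have gE x : G (Gquantile (Ur r u x)) = g (vscale r x).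
  rewrite /g /V /uw /Ur -/s; congr (G (Gquantile _)); apply: eq_Rintegral => z _; congr (u _).
  by apply: eq_from_tnth => i; rewrite !tnth_mktuple mul1r.
have rE : Num.sqrt (r' ^+ 2 + (e * s) ^+ 2) = r.
  rewrite exprMn s2 (_ : _ + _ = r ^+ 2) ?sqrtr_sqr ?ger0_norm//.
  have -> : r' ^+ 2 = 1 - (1 - r ^+ 2) * (1 + e ^+ 2) by rewrite -rr; ring.
  by ring.
have g0 w : 0 <= g w by exact: (gc_ge0 hG).
have gC w : g w <= C by exact: (gc_le hG).
have -> : \int[gam]_x G (Gquantile (Ur r u x)) = \int[gam]_x \int[gam]_z g (vlin r' (e * s) x z).
  by rewrite (comb_real _ _ mg g0 gC) rE; apply: eq_Rintegral => x _; exact: gE.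
have oC q : `|ou e G q| <= C * Num.sqrt (1 + e ^+ 2) ^+ 3.
  by rewrite ger0_norm ?(gc_ge0 (gconvex_ou e hG))// (gc_le (gconvex_ou e hG)).
have dou : dom (@expl1 R n) (fun x => ou e G (Gquantile (Ur r' u x))).
  apply: (dom_bounded W (C := C * Num.sqrt (1 + e ^+ 2) ^+ 3)) => //.
  apply: (measurableT_comp (gc_m (gconvex_ou e hG))).
  by apply: (measurable_Gquantile _ (UK r')); exact: measurable_Ur.
rewrite -[D * e ^+ 3](Er_cst gam) -(ErD W dou (dom_cst W (D * e ^+ 3))).
have dg : dom (@expl1 R n) (fun x => \int[gam]_z g (vlin r' (e * s) x z)).
  have m : measurable_fun setT (fun x => \int[gam]_z g (vlin r' (e * s) x z)).
    apply: (measurableT_comp (f := fine)); first exact: fine_measurable.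
    have mG : measurable_fun setT
        (fun p : n.-tuple R * n.-tuple R => (g (vlin r' (e * s) p.1 p.2))%:E).
      by apply/measurable_EFinP/(measurableT_comp mg); exact: measurable_vlin.
    by apply: (@measurable_fun_fubini_tonelli_F _ _ _ _ _ gam _ mG) => p; rewrite lee_fin.
  apply: (dom_bounded W m (C := C)) => x.
  have /andP[h1 h2] : 0 <= \int[gam]_z g (vlin r' (e * s) x z) <= C.
    apply: (Er_range gamE); last by move=> z; rewrite g0 gC.
    by apply: (measurableT_comp mg); exact: measurable_vlin.
  by rewrite ger0_norm.
apply: (Er_le W dg (domD W dou (dom_cst W (D * e ^+ 3)))) => x.
pose w := vscale r' x.
have := hD G G1 G2 (uw w) e hG (muw w) (uwK w) e0 e1.
have -> : \int[gam]_y noise gam e (uw w) y = Ur r' u x.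
  transitivity (\int[gam]_y \int[gam]_z uw w (vlin e 1 y z)).
    apply: eq_Rintegral => y _; apply: eq_Rintegral => z _; congr (uw w _).
    by apply: eq_from_tnth => i; rewrite !tnth_mktuple addrC.
  rewrite (comb_real _ _ (muw w) (fun _ => u0 _) (fun _ => u1 _)).
  rewrite /Ur /uw; apply: eq_Rintegral => z _; congr (u _).
  have -> : Num.sqrt (1 - r' ^+ 2) = s * Num.sqrt (e ^+ 2 + 1 ^+ 2).
    by rewrite rr sqrtrM ?subr_ge0// expr1n [e ^+ 2 + 1]addrC.
  by apply: eq_from_tnth => i; rewrite !tnth_mktuple mul1r mulrA.
move=> h; apply: (le_trans _ h); rewrite le_eqVlt; apply/orP; left; apply/eqP.
apply: eq_Rintegral => y _; rewrite /g; congr (G (Gquantile _)).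
apply: eq_Rintegral => z _; rewrite /uw; congr (u _).
by apply: eq_from_tnth => i; rewrite !tnth_mktuple; ring.
Qed.

End step.

(** * Iteration of the step *)

Section iterate.
Context {R : realType} {n : nat} (gam : probability (n.-tuple R) R).
Hypothesis gamE : is_std_gaussian gam.

Lemma ou0 (H : R -> R) q : ou 0 H q = H q.
Proof.
rewrite /ou expr0n addr0 sqrtr1.
under eq_Rintegral do rewrite mul0r addr0 mul1r.
exact: (Er_cst (normal_prob 0 1)).
Qed.

(** D is fixed before H, e and m: every [ou (b j) H] satisfies the bounds with the one constant
    [C'], since [1 + b j ^+ 2 <= L]. *)
Lemma iterate_step (C K rho : R) : 0 <= C -> 0 <= K -> 0 <= rho -> rho < 1 ->
  exists2 D : R, 0 <= D &
  forall (H H1 H2 : R -> R) (u : n.-tuple R -> R) (e : R) (m : nat), gconvex C H H1 H2 ->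
  measurable_fun setT u -> (forall x, Gcdf (- K) <= u x <= Gcdf K) -> 0 <= e -> e <= 1 ->
  (1 - rho ^+ 2) * (1 + e ^+ 2) ^+ m = 1 ->
  \int[gam]_x H (Gquantile (Ur gam rho u x)) <=
  ou (Num.sqrt ((1 - rho ^+ 2)^-1 - 1)) H (Gquantile (\int[gam]_x u x)) + m%:R * (D * e ^+ 3).
Proof.
move=> C0 K0 rho0 rho1.
have s0 : 0 < 1 - rho ^+ 2 by rewrite subr_gt0 expr_lt1.
have s1 : 1 - rho ^+ 2 <= 1 by rewrite gerBl sqr_ge0.
pose L := (1 - rho ^+ 2)^-1.
have L0 : 0 <= L by rewrite invr_ge0 ltW.
pose C' := C * Num.sqrt L ^+ 3.
have C'0 : 0 <= C' by rewrite mulr_ge0// exprn_ge0// sqrtr_ge0.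
have [D D0 hD] := step gamE C'0 K0; exists D => // H H1 H2 u e m hH mu uK e0 e1 em.
have u0 x : 0 <= u x by have /andP[h _] := uK x; rewrite (le_trans _ h)// Gcdf_ge0.
(* Both parameters follow [t j]: [1 + b j ^+ 2 = t j] and [1 - r j ^+ 2 = (1 - rho ^+ 2) * t j].
   Hence [r m = 0] exactly. *)
pose t j := (1 + e ^+ 2) ^+ j.
have e21 : 1 <= 1 + e ^+ 2 by rewrite lerDl sqr_ge0.
have t1 j : 1 <= t j by rewrite exprn_ege1.
have tm : t m = L by rewrite /L -[LHS](mulKf (lt0r_neq0 s0)) em mulr1.
pose b j := Num.sqrt (t j - 1).
have b2 j : 1 + b j ^+ 2 = t j.
  by rewrite sqr_sqrtr ?subr_ge0// addrC subrK.
pose r j := Num.sqrt (1 - (1 - rho ^+ 2) * t j).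
have st j : (j <= m)%N -> (1 - rho ^+ 2) * t j <= 1.
  move=> jm; rewrite -[leRHS]em ler_wpM2l ?(ltW s0)//.
  by rewrite ler_weXn2l.
have r2 j : (j <= m)%N -> 1 - r j ^+ 2 = (1 - rho ^+ 2) * t j.
  by move=> jm; rewrite sqr_sqrtr ?subr_ge0 ?st// opprB addrC subrK.
have arith (A B X : R) k : A <= B + X -> A + k%:R * X <= B + k.+1%:R * X.
  by rewrite -natr1 mulrDl mul1r; lra.
have iter j : (j <= m)%N -> \int[gam]_x H (Gquantile (Ur gam rho u x)) <=
    \int[gam]_x ou (b j) H (Gquantile (Ur gam (r j) u x)) + j%:R * (D * e ^+ 3).
  elim: j => [_|j IH jm].
    rewrite mul0r addr0 /b /r /t expr0 subrr sqrtr0 mulr1 opprB addrC subrK.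
    rewrite sqrtr_sqr ger0_norm// le_eqVlt; apply/orP; left; apply/eqP.
    by apply: eq_Rintegral => x _; rewrite ou0.
  apply: (le_trans (IH (ltnW jm))).
  have hG : gconvex C' (ou (b j) H) (fun q => Num.sqrt (1 + b j ^+ 2) * ou (b j) H1 q)
      (fun q => Num.sqrt (1 + b j ^+ 2) ^+ 2 * ou (b j) H2 q).
    apply: gconvex_le (gconvex_ou (b j) hH).
    rewrite ler_wpM2l// lerXn2r ?nnegrE ?sqrtr_ge0// ler_sqrt// b2 -tm.
    by rewrite ler_weXn2l// ltnW.
  have rj0 : 0 <= r j by exact: sqrtr_ge0.
  have rj1 : r j ^+ 2 <= 1.
    rewrite -subr_ge0 r2 ?(ltnW jm)// mulr_ge0 ?(ltW s0)//.
    by rewrite (le_trans ler01).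
  have rr : 1 - r j.+1 ^+ 2 = (1 - r j ^+ 2) * (1 + e ^+ 2).
    by rewrite (r2 _ jm) (r2 _ (ltnW jm)) /t -mulrA -exprSr.
  apply: arith.
  apply: (le_trans (hD _ _ _ u e (r j) (r j.+1) hG mu uK e0 e1 rj0 rj1 rr)).
  rewrite lerD2r le_eqVlt; apply/orP; left; apply/eqP.
  apply: eq_Rintegral => x _; apply: (ou_ou (C := C)).
  - exact: gc_m hH.
  - exact: gc_ge0 hH.
  - exact: gc_le hH.
  - exact: sqrtr_ge0.
  - by rewrite !b2 /t exprS.
have := iter m (leqnn m).
rewrite (_ : \int[gam]_x ou _ _ _ = ou (Num.sqrt (L - 1)) H (Gquantile (\int[gam]_x u x)))//.
rewrite /b tm; have -> : r m = 0 by rewrite /r em subrr sqrtr0.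
rewrite -[RHS](Er_cst gam); apply: eq_Rintegral => x _; congr (ou _ _ (Gquantile _)).
rewrite /Ur expr0n subr0 sqrtr1; apply: eq_Rintegral => z _; congr (u _).
by apply: eq_from_tnth => i; rewrite !tnth_mktuple mul0r add0r mul1r.
Qed.

Lemma noise_stability (C K rho : R) (H H1 H2 : R -> R) (u : n.-tuple R -> R) :
  0 <= K -> 0 <= rho -> rho < 1 -> gconvex C H H1 H2 ->
  measurable_fun setT u -> (forall x, Gcdf (- K) <= u x <= Gcdf K) ->
  \int[gam]_x H (Gquantile (Ur gam rho u x)) <=
  ou (Num.sqrt ((1 - rho ^+ 2)^-1 - 1)) H (Gquantile (\int[gam]_x u x)).
Proof.
move=> K0 rho0 rho1 hH mu uK; have C0 := gconvex_C0 hH.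
have [D D0 hD] := iterate_step C0 K0 rho0 rho1.
have s0 : 0 < 1 - rho ^+ 2 by rewrite subr_gt0 expr_lt1.
set L := (1 - rho ^+ 2)^-1.
have L1 : 1 <= L by rewrite invf_ge1// gerBl sqr_ge0.
have L0 : 0 < L by rewrite (lt_le_trans ltr01).
apply/ler_addgt0Pr => eta eta0.
pose A := D * (L - 1).
have A0 : 0 <= A by rewrite mulr_ge0// subr_ge0.
(* The target for e: it makes [A * e <= eta], and the minimum with 1 ensures [e <= 1]. *)
pose th := Num.min 1 (eta / (A + 1)).
have th0 : 0 < th by rewrite lt_min ltr01 divr_gt0// ltr_wpDl.
have th1 : th <= 1 by rewrite ge_min lexx.
have Ath : A * th <= eta.
  apply: (@le_trans _ _ ((A + 1) * (eta / (A + 1)))).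
    by rewrite ler_pM ?(ltW th0) ?lerDl// ge_min lexx orbT.
  by rewrite mulrC divfK// gt_eqF// ltr_wpDl.
pose m := (Num.bound ((L - 1) / th ^+ 2)).+1.
have mb : (L - 1) / th ^+ 2 <= m%:R.
  apply: (@le_trans _ _ (Num.bound ((L - 1) / th ^+ 2))%:R); last by rewrite ler_nat.
  by apply/ltW/archi_boundP; rewrite divr_ge0 ?subr_ge0 ?sqr_ge0.
have m0 : 0 < m%:R :> R by rewrite ltr0n.
(* The factor of one step is the m-th root of [L], so that m steps end exactly at noise parameter 0.
   Bernoulli's inequality gives [m * e ^+ 2 <= L - 1], hence a total loss of at most [A * e]. *)
pose v := L `^ (m%:R^-1).
have vm : v ^+ m = L.
  by rewrite -powR_mulrn ?powR_ge0// /v -powRrM mulVf ?gt_eqF// powRr1// ltW.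
have v1 : 1 <= v.
  rewrite leNgt; apply/negP => v1; have : v ^+ m < 1 by rewrite exprn_ilt1// ?powR_ge0.
  by rewrite vm ltNge L1.
pose e := Num.sqrt (v - 1).
have e0 : 0 <= e by exact: sqrtr_ge0.
have e2 : e ^+ 2 = v - 1 by rewrite sqr_sqrtr// subr_ge0.
have me : m%:R * e ^+ 2 <= L - 1.
  have bern k : 1 + k%:R * (v - 1) <= v ^+ k.
    elim: k => [|k IH]; first by rewrite mul0r addr0 expr0.
    rewrite exprS; apply: (@le_trans _ _ (v * (1 + k%:R * (v - 1)))).
      rewrite -natr1; have k0 : 0 <= k%:R :> R by []. 
      have : 0 <= k%:R * (v - 1) ^+ 2 by rewrite mulr_ge0// sqr_ge0.
      by nra.
    by rewrite ler_wpM2l// (le_trans ler01).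
  by rewrite e2 lerBrDl -vm bern.
have eth : e <= th.
  rewrite -(@ler_pXn2r _ 2) ?nnegrE ?(ltW th0)//.
  rewrite -(ler_pM2l m0); apply: (le_trans me).
  by move: mb; rewrite ler_pdivrMr ?exprn_gt0.
have em : (1 - rho ^+ 2) * (1 + e ^+ 2) ^+ m = 1.
  by rewrite e2 (_ : 1 + (v - 1) = v) ?vm ?divff ?gt_eqF//; ring.
apply: (le_trans (hD H H1 H2 u e m hH mu uK e0 (le_trans eth th1) em)).
rewrite lerD2l; apply: le_trans Ath.
rewrite (_ : _ * _ = D * (m%:R * e ^+ 2) * e); last by ring.
by rewrite ler_pM ?mulr_ge0 ?sqr_ge0 ?ler0n// ler_wpM2l.
Qed.

End iterate.

(** * Application to the binary entropy *)

Section entropy.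
Context {R : realType}.
Implicit Types (x t d : R).

Lemma ln2_gt0 : 0 < ln (2 : R).
Proof. by apply: ln_gt0; lra. Qed.

Definition xlnx x : R := x * ln x.

Lemma binentE x : binent x = - (xlnx x + xlnx (1 - x)) / ln 2.
Proof.
have xE y : xlog2x y = xlnx y / ln 2 :> R.
  by rewrite /xlog2x /xlnx; case: eqP => [->|_]; rewrite ?mul0r// mulrA.
by rewrite /binent !xE; field; rewrite gt_eqF// ln2_gt0.
Qed.

Lemma xlnx_le0 x : 0 <= x -> x <= 1 -> xlnx x <= 0.
Proof. by move=> x0 x1; rewrite /xlnx mulr_ge0_le0// ln_le0. Qed.

Lemma ln_lower x : 0 < x -> 1 - x^-1 <= ln x.
Proof.
move=> x0; have xi0 : 0 < x^-1 by rewrite invr_gt0.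
have := @le_ln1Dx R (x^-1 - 1); rewrite (_ : 1 + (x^-1 - 1) = x^-1); last by ring.
by rewrite lnV ?posrE// => h; have := h ltac:(lra); lra.
Qed.

Lemma xlnx_geN1 x : 0 <= x -> x <= 1 -> -1 <= xlnx x.
Proof.
rewrite le_eqVlt => /predU1P[<-|x0] x1; first by rewrite /xlnx mul0r; lra.
have := ln_lower x0; rewrite -(ler_pM2l x0) mulrBr mulfV ?gt_eqF// -/(xlnx x); lra.
Qed.

(** Each of the two terms is at most [1 / ln 2]. The bound is crude, but it only serves as an
    additive constant and as a dominating function. *)
Lemma binent_bound x : 0 <= x <= 1 -> 0 <= binent x <= 2 / ln 2.
Proof.
move=> /andP[x0 x1]; have l2 := ln2_gt0.
have y0 : 0 <= 1 - x by lra.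
have y1 : 1 - x <= 1 by lra.
have := (xlnx_le0 x0 x1, xlnx_le0 y0 y1, xlnx_geN1 x0 x1, xlnx_geN1 y0 y1).
move=> [[[h1 h2] h3] h4]; rewrite binentE; apply/andP; split.
  by rewrite divr_ge0 ?(ltW l2)//; lra.
by rewrite ler_wpM2r ?invr_ge0 ?(ltW l2)//; lra.
Qed.

Lemma measurable_binent : measurable_fun setT (@binent R).
Proof.
rewrite (_ : @binent R = fun x => - (xlnx x + xlnx (1 - x)) / ln 2); last exact/funext/binentE.
have mx : measurable_fun setT xlnx.
  apply: measurable_funM => //; exact: measurable_ln.
apply: measurable_funM => //; apply: measurableT_comp => //; apply: measurable_funD => //.
by apply: (measurableT_comp mx); exact: measurable_funB.
Qed.

(** The argument stays in [[d / 2, 1 - d / 2]], where the derivatives of the entropy are bounded.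
    The constant [2 / ln 2] provides the nonnegativity in [gconvex] and cancels in the final
    comparison. *)
Lemma gconvex_entropy d : 0 < d -> d < 1 -> exists C H1 H2,
  gconvex C ((fun t => 2 / ln 2 - binent (d / 2 + (1 - d) * t)) \o Gcdf) H1 H2.
Proof.
move=> d0 d1; have l2 := ln2_gt0.
pose k := 1 - d; pose l t := d / 2 + k * t; pose g := d / 2.
have g0 : 0 < g by rewrite divr_gt0.
have k0 : 0 < k by rewrite subr_gt0.
have k1 : k <= 1 by rewrite /k; lra.
have lb t : 0 < t < 1 -> g <= l t /\ g <= 1 - l t.
  by move=> /andP[t0 t1]; rewrite /l /g /k; split; nra.
(* One bound for the function and three derivatives: logarithms and inverses of [l t] and [1 - l t]
   are at most [g^-1] in absolute value, and [g^-1 >= 1]. *)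
pose M := 2 / g ^+ 2 / ln 2.
pose p1 t := k * (ln (l t) - ln (1 - l t)) / ln 2.
pose p2 t := k ^+ 2 * ((l t)^-1 + (1 - l t)^-1) / ln 2.
pose p3 t := k ^+ 3 * ((1 - l t) ^- 2 - (l t) ^- 2) / ln 2.
have dl (t : R) : is_derive t 1 l k.
  by apply: is_derive_eq; rewrite /GRing.scale/=; ring.
have dl' (t : R) : is_derive t 1 (fun t => 1 - l t) (- k).
  have := dl t => ?; by apply: is_derive_eq; ring.
have lb0 t : 0 < t < 1 -> 0 < l t /\ 0 < 1 - l t.
  by move=> /lb[h1 h2]; split; [exact: lt_le_trans h1|exact: lt_le_trans h2].
have dln (t : R) : 0 < t < 1 -> is_derive t 1 (fun t => ln (l t)) ((l t)^-1 * k).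
  move=> /lb0[h1 h2]; have := dl t => ?; have := is_derive1_ln h1 => ?.
  exact: is_derive1_comp.
have dln' (t : R) : 0 < t < 1 -> is_derive t 1 (fun t => ln (1 - l t)) ((1 - l t)^-1 * - k).
  move=> /lb0[h1 h2]; have := dl' t => ?; have := is_derive1_ln h2 => ?.
  exact: (@is_derive1_comp _ (@ln R) (fun t => 1 - l t)).
have dinv (t : R) : 0 < t < 1 -> is_derive t 1 (fun t => (l t)^-1) (- (l t) ^- 2 * k).
  move=> /lb0[h1 h2]; have := dl t => ?.
  have nz : l t != 0 by rewrite gt_eqF.
  exact: (@is_deriveV R l t k 1 nz (dl t)).
have dinv' (t : R) : 0 < t < 1 -> is_derive t 1 (fun t => (1 - l t)^-1) (- (1 - l t) ^- 2 * - k).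
  move=> /lb0[h1 h2]; have := dl' t => ?.
  have nz : 1 - l t != 0 by rewrite gt_eqF.
  exact: (@is_deriveV R (fun t => 1 - l t) t (- k) 1 nz (dl' t)).
exists (7 * M), (fun y => p1 (Gcdf y) * nphi y),
  (fun y => p2 (Gcdf y) * nphi y ^+ 2 - y * nphi y * p1 (Gcdf y)).
pose p t := 2 / ln 2 + (l t * ln (l t) + (1 - l t) * ln (1 - l t)) / ln 2.
rewrite (_ : (fun t => _) = p); last first.
  by apply/funext => t; rewrite binentE -/k -/(l t) /p /xlnx; field; rewrite gt_eqF.
have g1 : 1 <= g^-1 by rewrite invf_ge1// /g; lra.
have invb t : 0 < t < 1 -> (l t)^-1 <= g^-1 /\ (1 - l t)^-1 <= g^-1.
  by move=> t01; have [h1 h2] := lb t t01; have [h3 h4] := lb0 t t01; rewrite !lef_pV2.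
have lnb t : 0 < t < 1 -> - g^-1 <= ln (l t) <= 0 /\ - g^-1 <= ln (1 - l t) <= 0.
  move=> t01; have [h3 h4] := lb0 t t01; have [h1 h2] := invb t t01.
  have a1 := ln_lower h3; have a2 := ln_lower h4.
  by rewrite !ln_le0; [split; lra|lra|lra].
apply: (@gconvex_psi R M p p1 p2 p3).
- move=> t t01; have [h1 h2] := lb0 t t01.
  have := dl t => ?; have := dl' t => ?; have := dln t t01 => ?; have := dln' t t01 => ?.
  apply: is_derive_eq; rewrite /GRing.scale/= /p1; field.
  by rewrite !gt_eqF.
- move=> t t01; have [h1 h2] := lb0 t t01.
  have := dln t t01 => ?; have := dln' t t01 => ?.
  apply: is_derive_eq; rewrite /GRing.scale/= /p2; field.
  by rewrite !gt_eqF.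
- move=> t t01; have [h1 h2] := lb0 t t01.
  have := dinv t t01 => ?; have := dinv' t t01 => ?.
  apply: is_derive_eq; rewrite /GRing.scale/= /p3; field.
  by rewrite !gt_eqF.
- move=> t t01; have [h1 h2] := lb0 t t01.
  have bl : 0 <= binent (l t) <= 2 / ln 2 by apply: binent_bound; apply/andP; split; lra.
  have pE : p t = 2 / ln 2 - binent (l t).
    by rewrite binentE /p /xlnx; field; rewrite gt_eqF.
  have M2 : 2 / ln 2 <= M.
    rewrite /M ler_wpM2r ?invr_ge0 ?(ltW l2)// ler_peMr// invf_ge1 ?exprn_gt0//.
    by rewrite exprn_ile1 ?(ltW g0)// /g; lra.
  by rewrite pE; move/andP: bl => [b1 b2]; apply/andP; split; lra.
- move=> t t01; have [la lb'] := lnb t t01.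
  rewrite /p1 /M normrM [`|_^-1|]ger0_norm ?invr_ge0 ?(ltW l2)// ler_wpM2r ?invr_ge0 ?(ltW l2)//.
  rewrite normrM ger0_norm ?(ltW k0)// -exprVn.
  apply: (@le_trans _ _ (1 * g^-1)).
    apply: ler_pM; rewrite ?(ltW k0)//.
    by rewrite ler_norml; lra.
  by rewrite mul1r; nra.
- move=> t t01; have [h1 h2] := lb0 t t01; have [i1 i2] := invb t t01.
  have [j1 j2] : 0 <= (l t)^-1 /\ 0 <= (1 - l t)^-1 by split; rewrite invr_ge0; exact: ltW.
  have k2 : 0 <= k ^+ 2 <= 1 by rewrite exprn_ge0 ?exprn_ile1 ?(ltW k0).
  apply/andP; split; first by rewrite /p2 divr_ge0 ?(ltW l2)// mulr_ge0 ?addr_ge0//; case/andP: k2.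
  rewrite /p2 /M ler_wpM2r ?invr_ge0 ?(ltW l2)// -exprVn.
  apply: (@le_trans _ _ (1 * (g^-1 + g^-1))); last by rewrite mul1r; nra.
  by case/andP: k2 => k2 k2'; apply: ler_pM => //; [exact: addr_ge0|exact: lerD].
- move=> t t01; have [h1 h2] := lb0 t t01; have [i1 i2] := invb t t01.
  have [j1 j2] : 0 <= (l t)^-1 /\ 0 <= (1 - l t)^-1 by split; rewrite invr_ge0; exact: ltW.
  have k3 : 0 <= k ^+ 3 <= 1 by rewrite exprn_ge0 ?exprn_ile1 ?(ltW k0).
  rewrite /p3 /M normrM [`|_^-1|]ger0_norm ?invr_ge0 ?(ltW l2)// ler_wpM2r ?invr_ge0 ?(ltW l2)//.
  rewrite normrM ger0_norm; last by case/andP: k3.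
  rewrite -!exprVn; apply: (@le_trans _ _ (1 * (g^-1 ^+ 2))).
    rewrite ler_pM//; [by case/andP: k3|by case/andP: k3|].
    by rewrite ler_norml; apply/andP; split; nra.
  by rewrite mul1r ler_peMl ?sqr_ge0//; lra.
Qed.

(** With y the square root of x, [xlnx x] is [2 * y] times [y * ln y], and [y * ln y >= y - 1]. This
    serves for the limit at 0, where ln is not continuous. *)
Lemma xlnx_sqrt_bound x : 0 <= x -> x <= 1 -> `|xlnx x| <= 2 * Num.sqrt x.
Proof.
rewrite le_eqVlt => /predU1P[<-|x0] x1.
  by rewrite /xlnx mul0r normr0 mulr_ge0// sqrtr_ge0.
rewrite ler0_norm ?xlnx_le0 ?(ltW x0)//.
pose y := Num.sqrt x; have y0 : 0 < y by rewrite sqrtr_gt0.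
have xE : x = y ^+ 2 by rewrite sqr_sqrtr// ltW.
rewrite -/y /xlnx xE lnXn//; have := ln_lower y0.
rewrite -(ler_pM2l y0) mulrBr mulfV ?gt_eqF// mulr1 mulr2n => h.
by have := mulr_ge0 (ltW y0) (ltW y0); nra.
Qed.

Lemma xlnx_cvg (v : nat -> R) x : (forall k, 0 <= v k <= 1) -> 0 <= x ->
  v k @[k --> \oo] --> x -> xlnx (v k) @[k --> \oo] --> xlnx x.
Proof.
move=> v01; rewrite le_eqVlt => /predU1P[<-|x0] vx; last first.
  by apply: cvgM => //; apply: (cvg_comp _ _ vx); exact: continuous_ln.
rewrite [xlnx 0]mul0r; apply: norm_cvg0.
have hs : 2 * Num.sqrt (v k) @[k --> \oo] --> (0 : R).
  rewrite -[X in _ --> X](mulr0 2) -[in X in _ --> X](sqrtr0 R).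
  apply: cvgM; first exact: cvg_cst.
  by apply: (cvg_comp _ _ vx); exact: sqrt_continuous.
apply: squeeze_cvgr (cvg_cst 0) hs; apply: nearW => k.
by have /andP[h1 h2] := v01 k; rewrite normr_ge0 xlnx_sqrt_bound.
Qed.

Lemma binent_cvg (v : nat -> R) x : (forall k, 0 <= v k <= 1) -> 0 <= x <= 1 ->
  v k @[k --> \oo] --> x -> binent (v k) @[k --> \oo] --> binent x.
Proof.
move=> v01 /andP[x0 x1] vx.
rewrite (_ : (fun k => binent (v k)) = fun k => - (xlnx (v k) + xlnx (1 - v k)) / ln 2); last first.
  by apply/funext => k; exact: binentE.
rewrite binentE; apply: cvgM; last exact: cvg_cst.
apply: cvgN; apply: cvgD; first exact: xlnx_cvg.
apply: xlnx_cvg; [|by rewrite subr_ge0|by apply: cvgB => //; exact: cvg_cst].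
by move=> k; have /andP[h1 h2] := v01 k; apply/andP; split; lra.
Qed.

End entropy.

(** * Half-spaces under the noise operator *)

Section halfspace.
Context {R : realType} {n : nat} (gam : probability (n.-tuple R) R).
Hypothesis gamE : is_std_gaussian gam.
Variables (a : n.-tuple R) (t rho : R).
Hypotheses (a0 : 0 < vnorm a) (rho0 : 0 <= rho) (rho1 : rho < 1).

Let s := Num.sqrt (1 - rho ^+ 2).

Let s2_gt0 : 0 < 1 - rho ^+ 2.
Proof. by rewrite subr_gt0 expr_lt1. Qed.

Let s_gt0 : 0 < s.
Proof. by rewrite sqrtr_gt0. Qed.

Let s2 : s ^+ 2 = 1 - rho ^+ 2.
Proof. by rewrite sqr_sqrtr// ltW. Qed.

Definition halfspace := [set x : n.-tuple R | t <= vdot a x].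

Lemma measurable_halfspace (t' : R) : measurable [set x : n.-tuple R | t' <= vdot a x].
Proof.
rewrite (_ : [set x | _] = vdot a @^-1` `[t', +oo[%classic).
  by rewrite -[X in measurable X]setTI; exact: measurable_vdot.
by apply/seteqP; split => z /=; rewrite in_itv/= andbT.
Qed.

Lemma Rintegral_halfspace (t' : R) :
  \int[gam]_x (\1_[set x : n.-tuple R | t' <= vdot a x] x) = Gcdf (- (t' / vnorm a)).
Proof.
rewrite /Rintegral integral_indic//; last exact: measurable_halfspace.
rewrite setIT; apply: (congr1 fine (y := (Gcdf (- (t' / vnorm a)))%:E)).
exact: (prob_halfspace gamE t' a0).
Qed.

Lemma Ur_halfspace x :
  Ur gam rho (\1_halfspace : _ -> R) x = Gcdf ((rho * vdot a x - t) / (s * vnorm a)).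
Proof.
rewrite /Ur -/s.
rewrite (_ : \int[gam]_z _ = \int[gam]_z (\1_[set z : n.-tuple R | (t - rho * vdot a x) / s <= vdot a z] z)).
  by rewrite Rintegral_halfspace; congr (Gcdf _); field; rewrite !gt_eqF.
apply: eq_Rintegral => z _; rewrite !indicE; congr ((_ : bool)%:R).
transitivity (t <= vdot a (vlin rho s x z)); first by apply/idP/idP; rewrite inE.
transitivity ((t - rho * vdot a x) / s <= vdot a z); last by apply/idP/idP; rewrite inE.
rewrite ler_pdivrMr// lerBlDl; congr (_ <= _).
rewrite /vdot mulr_sumr mulr_suml -big_split/=; apply: eq_bigr => i _.
by rewrite tnth_mktuple; ring.
Qed.

(** With [q = - (t / vnorm a)] and y standard normal, the argument of [Gcdf] in [Ur_halfspace] is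
    [q / s + rho / s * y], and [b = rho / s] satisfies [1 + b ^+ 2 = s ^- 2]. *)
Lemma integral_Ur_halfspace (k : R -> R) :
  measurable_fun setT k -> (forall y, 0 <= k y) ->
  \int[gam]_x k (Ur gam rho (\1_halfspace : _ -> R) x) =
  ou (Num.sqrt ((1 - rho ^+ 2)^-1 - 1)) (k \o Gcdf) (- (t / vnorm a)).
Proof.
move=> mk k0.
pose kk y := k (Gcdf ((rho * y - t) / (s * vnorm a))).
transitivity (\int[gam]_x kk (vdot a x)).
  by apply: eq_Rintegral => x _; rewrite Ur_halfspace.
have mkk : measurable_fun setT kk.
  apply: (measurableT_comp mk); apply: (measurableT_comp (@measurable_Gcdf R)).
  by apply: measurable_funM => //; apply: measurable_funB => //; exact: measurable_funM.
rewrite (marginal_real gamE a mkk (fun _ => k0 _)) /kk.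
rewrite /ou -s2; set b := Num.sqrt ((s ^+ 2)^-1 - 1).
have s1 : s ^+ 2 <= 1 by rewrite s2 gerBl sqr_ge0.
have rs0 : 0 <= rho / s by rewrite divr_ge0 ?(ltW s_gt0).
have si0 : 0 <= s^-1 by rewrite invr_ge0 ltW.
have bE : b = rho / s.
  rewrite /b (_ : _ - 1 = (rho / s) ^+ 2).
    by rewrite sqrtr_sqr ger0_norm.
  rewrite expr_div_n (_ : rho ^+ 2 = 1 - s ^+ 2); last by rewrite s2; ring.
  by field; rewrite gt_eqF.
have cE : Num.sqrt (1 + b ^+ 2) = s^-1.
  rewrite bE (_ : 1 + _ = s^-1 ^+ 2); first by rewrite sqrtr_sqr ger0_norm.
  rewrite expr_div_n (_ : rho ^+ 2 = 1 - s ^+ 2); last by rewrite s2; ring.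
  by field; rewrite gt_eqF.
apply: eq_Rintegral => y _; rewrite cE bE /=; congr (k (Gcdf _)).
by field; rewrite !gt_eqF.
Qed.

End halfspace.

(** * The inequality for the smoothed problem *)

Section smoothed.
Context {R : realType} {n : nat} (gam : probability (n.-tuple R) R).
Hypothesis gamE : is_std_gaussian gam.
Variables (a : n.-tuple R) (t rho : R).
Hypotheses (a0 : 0 < vnorm a) (rho0 : 0 <= rho) (rho1 : rho < 1).
Variable f : n.-tuple R -> R.
Hypotheses (mf : measurable_fun setT f) (f01 : forall x, 0 <= f x <= 1).
Hypothesis fE : \int[gam]_x f x = Gcdf (- (t / vnorm a)).
Let W := weight_expl1 gamE.
Let m := Gcdf (- (t / vnorm a)).

Lemma Ur_range (g : n.-tuple R -> R) x : measurable_fun setT g ->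
  (forall z, 0 <= g z <= 1) -> 0 <= Ur gam rho g x <= 1.
Proof.
move=> mg g01; apply: (Er_range gamE) => //.
by apply: (measurableT_comp mg); exact: measurable_vlin.
Qed.

(* f is mixed with its mean, so that its values stay away from 0 and 1 while
   its expectation is unchanged. *)
Lemma smoothed_entropy (d : R) : 0 < d -> d < 1 ->
  \int[gam]_x binent (d / 2 + (1 - d) * Ur gam rho (\1_(halfspace a t) : _ -> R) x) <=
  \int[gam]_x binent (d / 2 + (1 - d) * ((1 - d) * Ur gam rho f x + d * m)).
Proof.
move=> d0 d1; have [C [H1 [H2 hH]]] := gconvex_entropy d0 d1.
set P := (fun t => _ - _) in hH.
have m01 : 0 < m < 1 by rewrite Gcdf_gt0 Gcdf_lt1.
have /andP[m0 m1] := m01.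
(* The mixture takes its values between [d * m] and [1 - d * (1 - m)]; [K1] serves the lower end and
   [K2], by symmetry of the normal law, the upper one. *)
have [K1 hK1] := @Gcdf_small R (d * m) (mulr_gt0 d0 m0).
have [K2 hK2] := @Gcdf_small R (d * (1 - m)) ltac:(by rewrite mulr_gt0// subr_gt0).
pose K := Num.max 0 (Num.max K1 K2).
have K0 : 0 <= K by rewrite le_max lexx.
have KK1 : K1 <= K by rewrite !le_max lexx !orbT.
have KK2 : K2 <= K by rewrite !le_max lexx !orbT.
pose u z := (1 - d) * f z + d * m.
have mu : measurable_fun setT u by apply: measurable_funD => //; exact: measurable_funM.
have uK x : Gcdf (- K) <= u x <= Gcdf K.
  have h1 : Gcdf (- K) <= Gcdf (- K1) by rewrite ler_Gcdf lerN2.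
  have h2 : Gcdf (- K) <= Gcdf (- K2) by rewrite ler_Gcdf lerN2.
  have := Gcdf_oppE K; have /andP[f0 f1] := f01 x => e.
  by apply/andP; rewrite /u; split; nra.
have mono : measurable_fun setT P.
  apply: measurable_funB => //; apply: (measurableT_comp (@measurable_binent R)).
  by apply: measurable_funD => //; exact: measurable_funM.
have df : dom (@expl1 R n) f.
  by apply: (dom_bounded W mf (C := 1)) => x; have /andP[h1 h2] := f01 x; rewrite ger0_norm.
have Eu : \int[gam]_x u x = m.
  rewrite /u (ErD W (domZ W (1 - d) df) (dom_cst W (d * m))) (ErZ W _ df) (Er_cst gam) fE.
  by rewrite -/m; ring.
have := noise_stability gamE K0 rho0 rho1 hH mu uK.
rewrite Eu (@Gquantile_eq _ _ (- (t / vnorm a)))//.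
have mH (g : n.-tuple R -> R) : measurable_fun setT g -> (forall z, 0 <= g z <= 1) ->
    measurable_fun setT (Ur gam rho g).
  by move=> mg g01; apply: measurable_Ur => // x; case/andP: (g01 x).
have me : measurable_fun setT (\1_(halfspace a t) : _ -> R).
  by apply: measurable_indic; exact: measurable_halfspace.
have e01 z : 0 <= (\1_(halfspace a t) z : R) <= 1.
  by rewrite indicE; case: (_ \in _); rewrite /= ?lexx ?ler01.
have affine v : 0 <= v <= 1 -> 0 <= d / 2 + (1 - d) * v <= 1.
  by move=> /andP[v0 v1]; apply/andP; split; nra.
have bb v : 0 <= v <= 1 -> `|binent (d / 2 + (1 - d) * v)| <= 2 / ln 2.
  by move=> /affine/binent_bound/andP[h1 h2]; rewrite ger0_norm.
have Pge v : 0 <= v <= 1 -> 0 <= P v.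
  by move=> /affine/binent_bound/andP[h1 h2]; rewrite /P subr_ge0.
(* [P] is known to be nonnegative on [[0, 1]] only, while the formula asks for nonnegativity
   everywhere; hence the clamping, which changes no value that occurs. *)
have := @integral_Ur_halfspace R n gam gamE a t rho a0 rho0 rho1 (fun v => P (Num.min 1 (Num.max 0 v))).
have clamp v : 0 <= v <= 1 -> Num.min 1 (Num.max 0 v) = v.
  by move=> /andP[v0 v1]; rewrite max_r// min_r.
have Ue x := Ur_range x me e01; have Uf x := Ur_range x mf f01.
rewrite (_ : _ \o Gcdf = P \o Gcdf); last first.
  by apply/funext => y /=; rewrite clamp// !ltW// ?Gcdf_gt0// Gcdf_lt1.
move=> <-; last 2 first.
- apply: (measurableT_comp mono); apply: measurable_minr => //; exact: measurable_maxr.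
- move=> y; apply: Pge; rewrite le_min ler01 le_max lexx/=.
  by rewrite ge_min lexx.
under [X in _ <= X -> _]eq_Rintegral do rewrite clamp//.
have UuE x : Ur gam rho u x = (1 - d) * Ur gam rho f x + d * m.
  have dfv : dom (@expl1 R n) (fun z => f (vlin rho (Num.sqrt (1 - rho ^+ 2)) x z)).
    apply: (dom_bounded W (C := 1)).
      by apply: (measurableT_comp mf); exact: measurable_vlin.
    by move=> z; have /andP[h1 h2] := f01 (vlin rho (Num.sqrt (1 - rho ^+ 2)) x z); rewrite ger0_norm.
  by rewrite /Ur /u (ErD W (domZ W (1 - d) dfv) (dom_cst W (d * m))) (ErZ W _ dfv) (Er_cst gam).
have HE x : (P \o Gcdf) (Gquantile (Ur gam rho u x)) = P ((1 - d) * Ur gam rho f x + d * m).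
  rewrite /= UuE; congr P; rewrite -UuE.
  have [|-> _] := @GquantileP R K (Ur gam rho u x); last by [].
  by apply: (Er_range gamE) => //; apply: (measurableT_comp mu); exact: measurable_vlin.
under [X in X <= _ -> _]eq_Rintegral do rewrite HE.
have db (v : n.-tuple R -> R) : measurable_fun setT v -> (forall x, 0 <= v x <= 1) ->
    dom (@expl1 R n) (fun x => binent (d / 2 + (1 - d) * v x)).
  move=> mv v01; apply: (dom_bounded W (C := 2 / ln 2)); last by move=> x; exact: bb.
  apply: (measurableT_comp (@measurable_binent R)).
  by apply: measurable_funD => //; exact: measurable_funM.
have d1' := db _ (mH _ me e01) Ue.
have d2' : dom (@expl1 R n) (fun x => binent (d / 2 + (1 - d) * ((1 - d) * Ur gam rho f x + d * m))).
  apply: db.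
    by apply: measurable_funD => //; apply: measurable_funM => //; exact: mH.
  by move=> x; have /andP[h1 h2] := Uf x; apply/andP; split; nra.
rewrite /P (ErB W (dom_cst W (2 / ln 2)) d1') (ErB W (dom_cst W (2 / ln 2)) d2').
by rewrite lerD2l lerN2.
Qed.

End smoothed.

Lemma vnorm_gt0 (R : realType) n (a : n.-tuple R) i : tnth a i != 0 -> 0 < vnorm a.
Proof.
move=> ai; rewrite sqrtr_gt0 /vdot (bigD1 i)//= -expr2.
rewrite ltr_wpDr//; last by rewrite lt_neqAle eq_sym sqrf_eq0 ai sqr_ge0.
by apply: sumr_ge0 => j _; rewrite -expr2 sqr_ge0.
Qed.

(** Dominated convergence with the constant of [binent_bound]. The limits may reach 0 and 1, which
    [binent_cvg] allows. *)
Lemma cvg_entropy_integral (R : realType) d (T : measurableType d) (P : probability T R)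
    (v : nat -> T -> R) (w : T -> R) :
  (forall k, measurable_fun setT (v k)) -> (forall k x, 0 <= v k x <= 1) ->
  (forall x, 0 <= w x <= 1) -> (forall x, v k x @[k --> \oo] --> w x) ->
  (\int[P]_x (binent (v k x))%:E)%E @[k --> \oo] --> (\int[P]_x (binent (w x))%:E)%E.
Proof.
move=> mv v01 w01 vw.
apply: (@dominated_cvg _ _ _ P setT measurableT (fun k x => (binent (v k x))%:E) _
  (cst (2 / ln 2)%:E)) => //.
- by move=> k; apply/measurable_EFinP; apply: (measurableT_comp (@measurable_binent R)).
- move=> x _; apply/fine_cvgP; split; first exact: nearW.
  exact: binent_cvg.
- exact: finite_measure_integrable_cst.
- move=> k x _; have /andP[h1 h2] := binent_bound (v01 k x).
  by rewrite abse_EFin lee_fin ger0_norm.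
Qed.

Theorem theorem1 (R : realType) (n : nat) (gam : probability (n.-tuple R) R)
  (f : n.-tuple R -> R) (rho : R) (eta : set (n.-tuple R)) :
  (0 < n)%N ->
  is_std_gaussian gam ->
  measurable_fun setT f ->
  (forall x, f x = 0 \/ f x = 1) ->
  0 <= rho -> rho < 1 ->
  is_halfspace eta ->
  (\int[gam]_x (\1_eta x : R)%:E = \int[gam]_x (f x)%:E)%E ->
  (- condH gam rho f <= - condH gam rho (fun x => \1_eta x : R))%E.
Proof.
move=> _ gamE mf f01' rho0 rho1 [a [t [[i ai] ->]]] Ef.
have a0 := vnorm_gt0 ai.
have f01 x : 0 <= f x <= 1 by case: (f01' x) => ->; rewrite ?lexx ?ler01.
have fE : \int[gam]_x f x = Gcdf (- (t / vnorm a)).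
  by rewrite -(Rintegral_halfspace gamE a0 t) /Rintegral Ef.
rewrite leeN2 /condH.
pose Uf := Ur gam rho f; pose Ue := Ur gam rho (\1_(halfspace a t) : _ -> R).
change (\int[gam]_x (binent (Ue x))%:E <= \int[gam]_x (binent (Uf x))%:E)%E.
have me : measurable_fun setT (\1_(halfspace a t) : _ -> R).
  by apply: measurable_indic; exact: measurable_halfspace.
have e01 z : 0 <= (\1_(halfspace a t) z : R) <= 1.
  by rewrite indicE; case: (_ \in _); rewrite /= ?lexx ?ler01.
have mUe : measurable_fun setT Ue by apply: measurable_Ur => // x; case/andP: (e01 x).
have mUf : measurable_fun setT Uf by apply: measurable_Ur => // x; case/andP: (f01 x).
have Ue01 x : 0 <= Ue x <= 1 by apply: (Ur_range gamE).
have Uf01 x : 0 <= Uf x <= 1 by apply: (Ur_range gamE).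
pose m : R := Gcdf (- (t / vnorm a)).
have m0 : 0 <= m <= 1 by rewrite !ltW ?Gcdf_gt0 ?Gcdf_lt1.
(* [k.+2] keeps [d k] strictly below 1 already for [k = 0]. *)
pose d k : R := k.+2%:R^-1.
have d0 k : 0 < d k by rewrite invr_gt0.
have d1 k : d k < 1 by rewrite invf_lt1// ltr1n.
have dcvg : d k @[k --> \oo] --> (0 : R).
  by have := @cvg_harmonic R; rewrite -cvg_shiftS.
pose ve k x := d k / 2 + (1 - d k) * Ue x.
pose vf k x := d k / 2 + (1 - d k) * ((1 - d k) * Uf x + d k * m).
have mve k : measurable_fun setT (ve k).
  by apply: measurable_funD => //; exact: measurable_funM.
have mvf k : measurable_fun setT (vf k).
  apply: measurable_funD => //; apply: measurable_funM => //.
  by apply: measurable_funD => //; exact: measurable_funM.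
have ve01 k x : 0 <= ve k x <= 1.
  have := d0 k; have := d1 k; have /andP[h1 h2] := Ue01 x => h3 h4.
  by apply/andP; rewrite /ve; split; nra.
have vf01 k x : 0 <= vf k x <= 1.
  have h3 := d0 k; have h4 := d1 k; have /andP[h1 h2] := Uf01 x; have /andP[h5 h6] := m0.
  have w01 : 0 <= (1 - d k) * Uf x + d k * m <= 1 by apply/andP; split; nra.
  by move: w01; rewrite /vf; set z := _ + d k * m => /andP[z0 z1]; apply/andP; split; nra.
have ce : (\int[gam]_x (binent (ve k x))%:E)%E @[k --> \oo] --> (\int[gam]_x (binent (Ue x))%:E)%E.
  apply: cvg_entropy_integral => // x.
  rewrite (_ : Ue x = 0 * 2^-1 + (1 - 0) * Ue x); last by ring.
  by apply: cvgD; apply: cvgM => //; [exact: cvg_cst|apply: cvgB => //; exact: cvg_cst|exact: cvg_cst].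
have cf : (\int[gam]_x (binent (vf k x))%:E)%E @[k --> \oo] --> (\int[gam]_x (binent (Uf x))%:E)%E.
  apply: cvg_entropy_integral => // x.
  rewrite (_ : Uf x = 0 * 2^-1 + (1 - 0) * ((1 - 0) * Uf x + 0 * m)); last by ring.
  have c1 : 1 - d k @[k --> \oo] --> (1 - 0 : R) by apply: cvgB => //; exact: cvg_cst.
  apply: cvgD; apply: cvgM => //; first exact: cvg_cst.
  by apply: cvgD; apply: cvgM => //; exact: cvg_cst.
(* It remains to compare the two sides at each fixed level [d k]; contraction and mixture have both
   disappeared in the limits. *)
apply: (lee_cvg_to ce cf); apply: nearW => k.
have W := weight_expl1 gamE.
have db (v : n.-tuple R -> R) : measurable_fun setT v -> (forall x, 0 <= v x <= 1) ->
    (\int[gam]_x (binent (v x))%:E = (\int[gam]_x binent (v x))%:E)%E.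
  move=> mv v01; rewrite (Er_EFin W)//; apply: (dom_bounded W (C := 2 / ln 2)).
    exact: (measurableT_comp (@measurable_binent R)).
  by move=> x; have /andP[h1 h2] := binent_bound (v01 x); rewrite ger0_norm.
rewrite (db _ (mve k) (ve01 k)) (db _ (mvf k) (vf01 k)) lee_fin.
exact: (smoothed_entropy gamE a0 rho0 rho1 mf f01 fE (d0 k) (d1 k)).
Qed.
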